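(* Let $\mu$ be a non-integer complex number. Consider the following data. The boxes are those with coordinates $(i,k,1)$, of color $i+1$ mod $2$, and those with coordinates $(i,k+\mu,0)$, of color $i$ mod $2$, where $i,k\in\mathbb{Z}_{\ge0}$; all boxes are positive. Boxes with the same $z$-coordinate are ordered lexicographically, comparing first $y$ (i.e. $k$), then $x$; boxes with $z$-coordinate $1$ are larger than boxes with $z$-coordinate $0$. The set of states $S(G_0^\mu)$ is the set of pairs of partitions positioned vertically: the states are the sets $\{(i,k,1):(i,k)\in D_1\}\sqcup\{(i,k+\mu,0):(i,k)\in D_2\}$, where $D_1,D_2\subset\mathbb{Z}_{\ge0}^2$ are Young diagrams (finite subsets such that $(i,k)\in D$, $0\le i'\le i$, $0\le k'\le k$ imply $(i',k')\in D$); the reference state is the pair of empty partitions. Let $$\Psi(G_0^\mu)=\Big(q_3q^{-\mu}\frac{z-q_3^{-2}}{z-q_2^{-\mu}},\ q^\mu\frac{z-q_3^{-1}q_2^{-\mu}}{z-q_3^{-1}}\Big).$$ Then the space $G_0^\mu=\bigoplus_{\lambda\in S(G_0^\mu)}\mathbb{C}|\lambda\rangle$ with the combinatorial action associated with $(S(G_0^\mu),\Psi(G_0^\mu))$ is an irreducible tame highest $\ell$-weight $\mathcal{E}$-module of highest $\ell$-weight $\Psi(G_0^\mu)$. In particular, the level of $G_0^\mu$ is $q_3$.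
   Context: **Parameters.** Fix $\log q,\log d\in\mathbb{C}$, $q=e^{\log q}$, $d=e^{\log d}$, $q_1=q^{-1}d$, $q_2=q^2$, $q_3=q^{-1}d^{-1}$, so $q_1q_2q_3=1$. Complex powers: $q^\alpha=e^{\alpha\log q}$, $q_2^\alpha=e^{2\alpha\log q}$. Assume $q,d$ generic: for rational $a,b$, $q^ad^b=1$ iff $a=b=0$. Write $[A,B]_p=AB-pBA$, $[A,B]=[A,B]_1$, $\delta(z)=\sum_{k\in\mathbb{Z}}z^k$, and $\mathrm{Sym}_{z_1,z_2,z_3}f=\frac1{6}\sum_{\pi\in\mathfrak{S}_3}f(z_{\pi(1)},z_{\pi(2)},z_{\pi(3)})$. For $i,j\in\mathbb{Z}/2\mathbb{Z}$ let $g_{i,j}(z,w)=z-q_2w$ if $i=j$ and $g_{i,j}(z,w)=(z-q_1w)(z-q_3w)$ if $i\ne j$. **Algebra $\mathcal{E}$** (quantum toroidal $\mathfrak{gl}_2$, parallel realization). It is the unital associative $\mathbb{C}$-algebra generated by $E_{i,k},F_{i,k},H_{i,r},K_i^{\pm1}$ ($i\in\mathbb{Z}/2\mathbb{Z}$, $k\in\mathbb{Z}$, $r\in\mathbb{Z}\setminus\{0\}$) and an invertible central element ${\sf t}$ subject to no further relations. With $E_i(z)=\sum_kE_{i,k}z^{-k}$, $F_i(z)=\sum_kF_{i,k}z^{-k}$, $K_i^\pm(z)=K_i^{\pm1}\exp(\pm(q-q^{-1})\sum_{r>0}H_{i,\pm r}z^{\mp r})$, the relations are: all $K_i^\pm(z),K_j^\pm(w),K_j^\mp(w)$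 commute; $(-1)^{i+j}g_{i,j}(z,w)K_i^\pm(z)E_j(w)+g_{j,i}(w,z)E_j(w)K_i^\pm(z)=0$; $(-1)^{i+j}g_{j,i}(w,z)K_i^\pm(z)F_j(w)+g_{i,j}(z,w)F_j(w)K_i^\pm(z)=0$; $[E_i(z),F_j(w)]=\frac{\delta_{i,j}}{q-q^{-1}}\delta(z/w)(K_i^+(w)-K_i^-(z))$; $(-1)^{i+j}g_{i,j}(z,w)E_i(z)E_j(w)+g_{j,i}(w,z)E_j(w)E_i(z)=0$; $(-1)^{i+j}g_{j,i}(w,z)F_i(z)F_j(w)+g_{i,j}(z,w)F_j(w)F_i(z)=0$; $\mathrm{Sym}_{z_1,z_2,z_3}[E_i(z_1),[E_i(z_2),[E_i(z_3),E_{i+1}(w)]_{q^2}]]_{q^{-2}}=0$ and the same with $E$ replaced by $F$. **Modules.** A vector $v$ of an $\mathcal{E}$-module has $\ell$-weight $\phi(z)=(\phi^0(z),\phi^1(z))$ if $K_i^\pm(z)v=\phi^i(z)v$, $i=0,1$, where the rational function $\phi^i$ is expanded at $z=\infty$ for $K_i^+$ and at $z=0$ for $K_i^-$. A module is a highest $\ell$-weight module of highest $\ell$-weight $\phi(z)$ if it is generated by a vector $v$ of $\ell$-weight $\phi(z)$ with $E_0(z)v=E_1(z)v=0$. A module is tame if it has a basis of $\ell$-weight vectors with distinct $\ell$-weights. It has level $\kappa$ if the central element $K_0K_1$ acts as the scalar $\kappa$. **Combinatorial action** (case where all boxes are positive). A box $\Box$ has color $c(\Box)\in\{0,1\}$ and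 coordinates $(x,y,z)\in\mathbb{C}^3$; its position is $p(\Box)=q_1^{-x}q_2^{-y}q_3^{-z}$. As a general convention of the construction, boxes with the same position and different colors are not allowed. The set of boxes is totally ordered. A state is a finite set of boxes; $\emptyset$ is the reference state. Given a set of states $S\ni\emptyset$ and a pair $\Psi(z)=(\Psi^0(z),\Psi^1(z))$ of rational functions that are balanced (regular at $0$ and $\infty$, with product of the values at $0$ and $\infty$ equal to $1$): for $\lambda\in S$, a box $\Box\in\lambda$ is convex if $\lambda\setminus\Box\in S$, and a box $\Box\notin\lambda$ is concave if $\lambda\sqcup\Box\in S$. $CV_i(\lambda)$, $CC_i(\lambda)$ are the sets of convex, concave boxes of color $i$. Pairs of rational functions are multiplied componentwise. Let $A_{0,a}(z)=\Big(\frac{q_2z-a}{z-q_2a},\frac{(q_1z-a)(q_3z-a)}{(z-q_1a)(z-q_3a)}\Big)$, $A_{1,a}(z)=\Big(\frac{(q_1z-a)(q_3z-a)}{(z-q_1a)(z-q_3a)},\frac{q_2z-a}{z-q_2a}\Big)$, $\phi_\lambda(z)=\Psi(z)\prod_{\Box\in\lambda}A^{-1}_{c(\Box),p(\Box)}(z)$, $\phi_{\lambda,<\Box}(z)=\Psi(z)\prod_{\Box_1\in\lambda,\Box_1<\Box}A^{-1}_{c(\Box_1),p(\Box_1)}(z)$, $\phi_{\lambda,>\Box}(z)=\prod_{\Box_1\in\lambda,\Box_1>\Box}A^{-1}_{c(\Box_1),p(\Box_1)}(z)$. Upper index $i\in\{0,1\}$ denotes the component. Set $a^i_{\lambda,\Box}=\phi^i_{\lambda,>\Box}(p(\Box))$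 for $\Box\in CC_i(\lambda)$ and $b^i_{\lambda,\Box}=\frac{1}{q-q^{-1}}\mathrm{res}_{z=p(\Box)}\phi^i_{\lambda,<\Box}(z)\frac{dz}{z}$ for $\Box\in CV_i(\lambda)$. The combinatorial action associated with $(S,\Psi)$ on $\bigoplus_{\lambda\in S}\mathbb{C}|\lambda\rangle$ is ${\sf t}=1$ and $K_i^\pm(z)|\lambda\rangle=\phi^i_\lambda(z)|\lambda\rangle$, $F_i(z)|\lambda\rangle=\sum_{\Box\in CC_i(\lambda)}a^i_{\lambda,\Box}\delta(z/p(\Box))|\lambda\sqcup\Box\rangle$, $E_i(z)|\lambda\rangle=\sum_{\Box\in CV_i(\lambda)}b^i_{\lambda,\Box}\delta(z/p(\Box))|\lambda\setminus\Box\rangle$.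
   Formalization: Besides μ non-integer, it is assumed that q_2^μ is not of the form q_1^{2a}q_2^b with integers a, b; in those excluded cases boxes of the two layers share positions, two states have the same ℓ-weight, and the module is not tame. *)

(* Defs.v *)
From HB Require Import structures.
From mathcomp Require Import all_boot all_order all_algebra.
From mathcomp Require Import perm finmap generic_quotient ring_quotient.
From mathcomp Require Import boolp classical_sets fsbigop reals.
From mathcomp Require Import sequences exp trigo complex.
From mathcomp Require Import multinomials.monalg.

Set Implicit Arguments.
Unset Strict Implicit.
Unset Printing Implicit Defensive.

Import Order.TTheory GRing.Theory Num.Theory.

Local Open Scope ring_scope.

(* Associative algebras given by generators and relations: the quotient of    *)
(* the free algebra on G by the two-sided ideal generated by a set of relators.*)
Section PresentedAlgebra.
Variables (C : comNzRingType) (G : choiceType).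

Definition free_alg := {malg C[{fmonom G}]}.

Definition free_gen (x : G) : free_alg := << fmu x >>.

Inductive ideal_of (X : free_alg -> Prop) : free_alg -> Prop :=
| ideal_of0 : ideal_of X 0
| ideal_ofD u v : ideal_of X u -> ideal_of X v -> ideal_of X (u + v)
| ideal_ofM u x v : X x -> ideal_of X (u * x * v).

Variable X : free_alg -> Prop.

Definition rel_ideal : {pred free_alg} := [pred u | `[< ideal_of X u >]].

Lemma rel_idealP u : reflect (ideal_of X u) (u \in rel_ideal).
Proof. exact: asboolP. Qed.

Lemma ideal_ofMl a u : ideal_of X u -> ideal_of X (a * u).
Proof.
elim=> [|v w _ iv _ iw|v x w Xx]; first by rewrite mulr0; constructor.
- by rewrite mulrDr; apply: ideal_ofD.
- by rewrite !mulrA; apply: ideal_ofM.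
Qed.

Lemma ideal_ofMr a u : ideal_of X u -> ideal_of X (u * a).
Proof.
elim=> [|v w _ iv _ iw|v x w Xx]; first by rewrite mul0r; constructor.
- by rewrite mulrDl; apply: ideal_ofD.
- by rewrite -!mulrA mulrA; apply: ideal_ofM.
Qed.

Lemma rel_ideal_closed : zmod_closed rel_ideal.
Proof.
split=> [|u v /rel_idealP iu /rel_idealP iv]; apply/rel_idealP.
  exact: ideal_of0.
by apply: ideal_ofD => //; rewrite -mulN1r; apply: ideal_ofMl.
Qed.

HB.instance Definition _ :=
  GRing.isZmodClosed.Build free_alg rel_ideal rel_ideal_closed.

Definition presented := Quotient.quot rel_ideal.

HB.instance Definition _ := Choice.on presented.
HB.instance Definition _ := GRing.Zmodule.on presented.

Local Open Scope quotient_scope.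

Definition presented_pi (u : free_alg) : presented := \pi_presented u.

Lemma presented_piP u v :
  presented_pi u = presented_pi v <-> ideal_of X (u - v).
Proof.
have e : (u - v \in rel_ideal) = (u == v %[mod Quotient.quot rel_ideal]).
  exact: Quotient.idealrBE.
split=> [uv|/rel_idealP]; last by rewrite e => /eqP.
by apply/rel_idealP; rewrite e; apply/eqP.
Qed.

Lemma presented_piK (x : presented) : presented_pi (repr x) = x.
Proof. exact: reprK. Qed.

Lemma presented_piD u v :
  presented_pi (u + v) = presented_pi u + presented_pi v.
Proof. exact: Quotient.pi_add. Qed.

Definition presented_one : presented := presented_pi 1.
Definition presented_mul (x y : presented) : presented :=
  presented_pi (repr x * repr y).
Definition presented_scale (c : C) (x : presented) : presented :=
  presented_pi (c *: repr x).

Lemma presented_reprP u : ideal_of X (repr (presented_pi u) - u).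
Proof. by apply/presented_piP; rewrite presented_piK. Qed.

Lemma presented_piM u v :
  presented_mul (presented_pi u) (presented_pi v) = presented_pi (u * v).
Proof.
apply/presented_piP; set u' := repr _; set v' := repr _.
have -> : u' * v' - u * v = (u' - u) * v' + u * (v' - v).
  by rewrite mulrBl mulrBr addrA subrK.
apply: ideal_ofD; [apply: ideal_ofMr|apply: ideal_ofMl];
  exact: presented_reprP.
Qed.

Lemma presented_piZ c u :
  presented_scale c (presented_pi u) = presented_pi (c *: u).
Proof.
apply/presented_piP; rewrite -scalerBr -[_ - _]mul1r scalerAl.
exact/ideal_ofMl/presented_reprP.
Qed.

Lemma presented_mulA : associative presented_mul.
Proof.
move=> x y z; rewrite -[x]presented_piK -[y]presented_piK -[z]presented_piK.
by rewrite !presented_piM mulrA.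
Qed.

Lemma presented_mul1l : left_id presented_one presented_mul.
Proof. by move=> x; rewrite -[x]presented_piK presented_piM mul1r. Qed.

Lemma presented_mul1r : right_id presented_one presented_mul.
Proof. by move=> x; rewrite -[x]presented_piK presented_piM mulr1. Qed.

Lemma presented_mulDl : left_distributive presented_mul +%R.
Proof.
move=> x y z; rewrite -[x]presented_piK -[y]presented_piK -[z]presented_piK.
by rewrite -presented_piD !presented_piM mulrDl presented_piD.
Qed.

Lemma presented_mulDr : right_distributive presented_mul +%R.
Proof.
move=> x y z; rewrite -[x]presented_piK -[y]presented_piK -[z]presented_piK.
by rewrite -presented_piD !presented_piM mulrDr presented_piD.
Qed.

HB.instance Definition _ := GRing.Zmodule_isPzRing.Build presented
  presented_mulA presented_mul1l presented_mul1r presented_mulDl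
  presented_mulDr.

Lemma presented_scaleA a b x :
  presented_scale a (presented_scale b x) = presented_scale (a * b) x.
Proof. by rewrite -[x]presented_piK !presented_piZ scalerA. Qed.

Lemma presented_scale1 : left_id 1 presented_scale.
Proof. by move=> x; rewrite -[x]presented_piK presented_piZ scale1r. Qed.

Lemma presented_scaleDr : right_distributive presented_scale +%R.
Proof.
move=> c x y; rewrite -[x]presented_piK -[y]presented_piK.
by rewrite -presented_piD !presented_piZ scalerDr presented_piD.
Qed.

Lemma presented_scaleDl x : {morph presented_scale^~ x : a b / a + b}.
Proof.
move=> a b; rewrite -[x]presented_piK !presented_piZ scalerDl.
exact: presented_piD.
Qed.

HB.instance Definition _ := GRing.Zmodule_isLmodule.Build C presented
  presented_scaleA presented_scale1 presented_scaleDr presented_scaleDl.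

Definition presented_gen (x : G) : presented := presented_pi (free_gen x).

End PresentedAlgebra.

Local Notation "p %:F" := (@tofrac _ p).

Section RationalFunctions.
Variable C : fieldType.

Definition ratfun := {fraction {poly C}}.

Definition is_value (f : ratfun) (p v : C) : Prop :=
  exists n d : {poly C},
    [/\ d.[p] != 0, f = n%:F / d%:F & v = n.[p] / d.[p]].

Definition is_value_infty (f : ratfun) (v : C) : Prop :=
  exists n d : {poly C},
    [/\ d != 0, (size n <= size d)%N, f = n%:F / d%:F
      & v = n`_(size d).-1 / lead_coef d].

Definition balanced (f : ratfun) : Prop :=
  exists v0 voo : C, [/\ is_value f 0 v0, is_value_infty f voo & v0 * voo = 1].

(* The residue of f(z) dz at p: the coefficient of (z - p)^-1 in the partial   *)
(* fraction decomposition at p, s listing the coefficients of (z - p)^-2, ... *)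
Definition is_residue (f : ratfun) (p r : C) : Prop :=
  exists (h : ratfun) (s : seq C),
    (exists v, is_value h p v) /\
    f = h + r%:P%:F / ('X - p%:P)%:F
          + \sum_(j < size s) (s`_j)%:P%:F / ('X - p%:P)%:F ^+ j.+2.

(* Laurent expansions are recorded as s : int -> C with s m the coefficient   *)
(* of z^(-m), and characterized by d(z) s(z) = n(z) for f = n / d.            *)
Definition laurent_quotient (n d : {poly C}) (s : int -> C) : Prop :=
  forall m : int, \sum_(j < size d) d`_j * s (m + j%:Z) =
                  if m <= 0 then n`_`|m|%N else 0.

Definition expansion_infty (f : ratfun) (s : int -> C) : Prop :=
  exists n d : {poly C},
    [/\ d != 0, f = n%:F / d%:F, laurent_quotient n d s
      & exists N : int, forall m, m < N -> s m = 0].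

Definition expansion_zero (f : ratfun) (s : int -> C) : Prop :=
  exists n d : {poly C},
    [/\ d != 0, f = n%:F / d%:F, laurent_quotient n d s
      & exists N : int, forall m, N < m -> s m = 0].

(* A pair (phi^0(z), phi^1(z)) of rational functions. *)
Definition lweight := 'Z_2 -> ratfun.

End RationalFunctions.

Section FormalSeries.
Variables (C : fieldType) (A : lalgType C).

(* Power series in one variable. *)
Definition series_mul (u v : nat -> A) (n : nat) : A :=
  \sum_(r < n.+1) u r * v (n - r)%N.

Definition series_pow (u : nat -> A) (m : nat) : nat -> A :=
  iter m (series_mul u) (fun n => (n == 0)%:R).

(* For u without constant term; then u^m has no terms of degree less than m.  *)
Definition series_exp (u : nat -> A) (n : nat) : A :=
  \sum_(m < n.+1) (m`!%:R)^-1 *: series_pow u m n.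

(* Product of P(z, w) with a formal series T(z, w), where T m n is the        *)
(* coefficient of z^(-m) w^(-n) in T, and P is a polynomial in z = 'X with    *)
(* coefficients in C[w].                                                      *)
Definition poly_mul_series2 (P : {poly {poly C}}) (T : int -> int -> A)
    (m n : int) : A :=
  \sum_(a < size P) \sum_(b < size P`_a)
    P`_a`_b *: T (m + a%:Z) (n + b%:Z).

(* [x, y]_p *)
Definition pcomm (p : C) (x y : A) : A := x * y - p *: (y * x).

End FormalSeries.

Inductive toroidal_gen : Type :=
| GenE of 'Z_2 & int
| GenF of 'Z_2 & int
| GenH (i : 'Z_2) (r : int) of r != 0
| GenK of 'Z_2
| GenKV of 'Z_2
| GenT
| GenTV.

HB.instance Definition _ := gen_eqMixin toroidal_gen.
HB.instance Definition _ := gen_choiceMixin toroidal_gen.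

Section Toroidal.
Variable R : realType.
Local Notation C := R[i].

Definition cexp (z : C) : C :=
  let: Complex x y := z in Complex (expR x * cos y) (expR x * sin y).

Definition is_integer (z : C) : Prop := exists m : int, z = m%:~R.

Variables logq logd : C.

Definition q : C := cexp logq.
Definition d : C := cexp logd.
Definition q1 : C := q^-1 * d.
Definition q2 : C := q ^+ 2.
Definition q3 : C := q^-1 * d^-1.

(* Complex powers, relative to log q1 = log d - log q, log q2 = 2 log q and   *)
(* log q3 = - log q - log d.                                                  *)
Definition qpow (a : C) : C := cexp (a * logq).
Definition dpow (a : C) : C := cexp (a * logd).
Definition q1pow (a : C) : C := cexp (a * (logd - logq)).
Definition q2pow (a : C) : C := cexp (a * (2 * logq)).
Definition q3pow (a : C) : C := cexp (a * (- logq - logd)).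

Definition generic : Prop :=
  forall a b : rat, qpow (ratr a) * dpow (ratr b) = 1 <-> a = 0 /\ b = 0.

Definition gpoly (i j : 'Z_2) (z w : {poly {poly C}}) : {poly {poly C}} :=
  if i == j then z - q2%:P%:P * w
  else (z - q1%:P%:P * w) * (z - q3%:P%:P * w).

Local Notation zv := ('X : {poly {poly C}}).
Local Notation wv := ('X%:P : {poly {poly C}}).

Section Relations.
Local Notation FA := (free_alg C toroidal_gen).

Definition fE (i : 'Z_2) (k : int) : FA := free_gen C (GenE i k).
Definition fF (i : 'Z_2) (k : int) : FA := free_gen C (GenF i k).
Definition fK (i : 'Z_2) : FA := free_gen C (GenK i).
Definition fKV (i : 'Z_2) : FA := free_gen C (GenKV i).
Definition fT : FA := free_gen C GenT.
Definition fTV : FA := free_gen C GenTV.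

(* In what follows the sign s is + if true, - if false. The series            *)
(* sum_(r > 0) H_{i, +r} u^r and sum_(r > 0) H_{i, -r} u^r:                   *)
Definition fHseries (s : bool) (i : 'Z_2) (r : nat) : FA :=
  if r is r'.+1 then
    free_gen C (if s then @GenH i (Posz r'.+1) isT else @GenH i (Negz r') isT)
  else 0.

(* The coefficient of z^(-m) in K_i^+(z) and K_i^-(z). *)
Definition fKseries (s : bool) (i : 'Z_2) (m : int) : FA :=
  if s then
    if 0 <= m then
      fK i * series_exp (fun r => (q - q^-1) *: fHseries true i r) `|m|%N
    else 0
  else
    if m <= 0 then
      fKV i * series_exp (fun r => - (q - q^-1) *: fHseries false i r) `|m|%N
    else 0.

Definition serre (X : 'Z_2 -> int -> FA) (i : 'Z_2) (k : 'I_3 -> int)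
    (l : int) : FA :=
  6%:R^-1 *: \sum_(p : 'S_3)
    pcomm (q ^- 2) (X i (k (p 0)))
      (pcomm 1 (X i (k (p 1)))
        (pcomm (q ^+ 2) (X i (k (p 2%:R))) (X (i + 1) l))).

Definition sgn (i j : 'Z_2) : C := (-1) ^+ (i + j)%N.

(* Every relation between currents is imposed coefficientwise, m and n (k and *)
(* l in the Serre relations) being the opposites of the exponents of z and w. *)
Inductive toroidal_relator : FA -> Prop :=
| rel_KKV i : toroidal_relator (fK i * fKV i - 1)
| rel_KVK i : toroidal_relator (fKV i * fK i - 1)
| rel_TTV : toroidal_relator (fT * fTV - 1)
| rel_TVT : toroidal_relator (fTV * fT - 1)
| rel_Tcentral x :
    toroidal_relator (fT * free_gen C x - free_gen C x * fT)
| rel_KK s s' i j m n :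
    toroidal_relator (fKseries s i m * fKseries s' j n
                      - fKseries s' j n * fKseries s i m)
| rel_KE s i j m n :
    toroidal_relator
      (sgn i j *: poly_mul_series2 (gpoly i j zv wv)
                    (fun m n => fKseries s i m * fE j n) m n
       + poly_mul_series2 (gpoly j i wv zv)
                    (fun m n => fE j n * fKseries s i m) m n)
| rel_KF s i j m n :
    toroidal_relator
      (sgn i j *: poly_mul_series2 (gpoly j i wv zv)
                    (fun m n => fKseries s i m * fF j n) m n
       + poly_mul_series2 (gpoly i j zv wv)
                    (fun m n => fF j n * fKseries s i m) m n)
(* delta(z/w) X(w) = delta(z/w) X(z) has coefficient X_{m+n} at z^(-m) w^(-n) *)
| rel_EF i j m n :
    toroidal_relator
      (pcomm 1 (fE i m) (fF j n)
       - ((i == j)%:R / (q - q^-1)) *: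
           (fKseries true i (m + n) - fKseries false i (m + n)))
| rel_EE i j m n :
    toroidal_relator
      (sgn i j *: poly_mul_series2 (gpoly i j zv wv)
                    (fun m n => fE i m * fE j n) m n
       + poly_mul_series2 (gpoly j i wv zv)
                    (fun m n => fE j n * fE i m) m n)
| rel_FF i j m n :
    toroidal_relator
      (sgn i j *: poly_mul_series2 (gpoly j i wv zv)
                    (fun m n => fF i m * fF j n) m n
       + poly_mul_series2 (gpoly i j zv wv)
                    (fun m n => fF j n * fF i m) m n)
| rel_serreE i k l : toroidal_relator (serre fE i k l)
| rel_serreF i k l : toroidal_relator (serre fF i k l).

End Relations.

(* The quantum toroidal algebra of gl_2. *)
Definition toroidal := presented toroidal_relator.

Definition tpi (u : free_alg C toroidal_gen) : toroidal :=
  presented_pi toroidal_relator u.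

Record toroidal_module (V : lmodType C) := ToroidalModule {
  act :> toroidal -> V -> V;
  actDl : forall x y v, act (x + y) v = act x v + act y v;
  actZl : forall c x v, act (c *: x) v = c *: act x v;
  actDr : forall x v w, act x (v + w) = act x v + act x w;
  actZr : forall c x v, act x (c *: v) = c *: act x v;
  act1 : forall v, act 1 v = v;
  actM : forall x y v, act (x * y) v = act x (act y v)
}.

Section Modules.
Variables (V : lmodType C) (M : toroidal_module V).

Definition has_lweight (phi : lweight C) (v : V) : Prop :=
  forall i : 'Z_2,
    (exists2 s : int -> C, expansion_infty (phi i) s &
       forall m, M (tpi (fKseries true i m)) v = s m *: v) /\
    (exists2 s : int -> C, expansion_zero (phi i) s &
       forall m, M (tpi (fKseries false i m)) v = s m *: v).

Definition highest_lweight_module (phi : lweight C) : Prop :=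
  exists v : V,
    [/\ has_lweight phi v,
        forall i k, M (tpi (fE i k)) v = 0
      & forall w, exists x : toroidal, w = M x v].

Definition is_submodule (W : set V) : Prop :=
  [/\ W 0, forall v w, W v -> W w -> W (v + w),
      forall c v, W v -> W (c *: v) & forall x v, W v -> W (M x v)].

Definition irreducible_module : Prop :=
  (exists v : V, v != 0) /\
  forall W : set V, is_submodule W -> W = [set 0]%classic \/ W = setT.

Definition is_basis (B : set V) : Prop :=
  (forall (s : seq V) (c : V -> C),
     uniq s -> (forall v, v \in s -> B v) -> \sum_(v <- s) c v *: v = 0 ->
     forall v, v \in s -> c v = 0) /\
  (forall w, exists (s : seq V) (c : V -> C),
     (forall v, v \in s -> B v) /\ w = \sum_(v <- s) c v *: v).

Definition tame_module : Prop :=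
  exists B : set V,
    [/\ is_basis B,
        forall v, B v -> exists phi, has_lweight phi v
      & forall v w phi, B v -> B w ->
          has_lweight phi v -> has_lweight phi w -> v = w].

Definition has_level (kappa : C) : Prop :=
  forall v : V, M (tpi (fK 0 * fK 1)) v = kappa *: v.

End Modules.

(* A totally ordered set of colored boxes, a set of states (all boxes being   *)
(* positive, a state is a finite set of boxes) and a pair Psi.                *)
Record comb_data := CombData {
  comb_disp : Order.disp_t;
  box : orderType comb_disp;
  box_color : box -> 'Z_2;
  box_coord : box -> C * C * C;
  states : set {fset box};
  Psi : lweight C
}.

Arguments states : clear implicits.

Section CombinatorialAction.
Variable D : comb_data.
Local Notation box := (box D).

Definition box_pos (b : box) : C :=
  let: (x, y, z) := box_coord b in q1pow (- x) * q2pow (- y) * q3pow (- z).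

Definition position_color_convention : Prop :=
  forall b b' : box, box_pos b = box_pos b' -> box_color b = box_color b'.

Definition A_weight (c : 'Z_2) (a : C) : lweight C := fun i =>
  if i == c then (q2 *: 'X - a%:P)%:F / ('X - (q2 * a)%:P)%:F
  else ((q1 *: 'X - a%:P) * (q3 *: 'X - a%:P))%:F
       / (('X - (q1 * a)%:P) * ('X - (q3 * a)%:P))%:F.

Definition A_box (b : box) : lweight C := A_weight (box_color b) (box_pos b).

Definition phi (la : {fset box}) : lweight C := fun i =>
  Psi D i * \prod_(b <- la) (A_box b i)^-1.

Definition phi_lt (la : {fset box}) (b : box) : lweight C := fun i =>
  Psi D i * \prod_(b1 <- la | (b1 < b)%O) (A_box b1 i)^-1.

Definition phi_gt (la : {fset box}) (b : box) : lweight C := fun i =>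
  \prod_(b1 <- la | (b < b1)%O) (A_box b1 i)^-1.

Definition convex_boxes (i : 'Z_2) (la : {fset box}) : set box :=
  [set b | [/\ box_color b = i, b \in la & states D (la `\ b)%fset]]%classic.

Definition concave_boxes (i : 'Z_2) (la : {fset box}) : set box :=
  [set b | [/\ box_color b = i, b \notin la & states D (b |` la)%fset]]%classic.

(* The space with basis |la>, la a state. *)
Definition comb_space : lmodType C := {malg C[set_type (states D)]}.

Definition ket (la : {fset box}) : comb_space :=
  if insub la is Some l then << l >> else 0.

(* delta(z / p) has coefficient p^k at z^(-k). *)
Record is_comb_action (M : toroidal_module comb_space) : Prop := {
  comb_states0 : states D fset0;
  comb_balanced : forall i, balanced (Psi D i);
  comb_T : forall v, M (tpi fT) v = v;
  comb_K : forall la, states D la -> has_lweight M (phi la) (ket la);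
  comb_F : exists a : 'Z_2 -> {fset box} -> box -> C,
    (forall i la b, states D la -> concave_boxes i la b ->
       is_value (phi_gt la b i) (box_pos b) (a i la b)) /\
    (forall i la k, states D la ->
       M (tpi (fF i k)) (ket la) =
       \sum_(b \in concave_boxes i la)
         (a i la b * box_pos b ^ k) *: ket (b |` la)%fset);
  comb_E : exists r : 'Z_2 -> {fset box} -> box -> C,
    (forall i la b, states D la -> convex_boxes i la b ->
       is_residue (phi_lt la b i / 'X%:F) (box_pos b) (r i la b)) /\
    (forall i la k, states D la ->
       M (tpi (fE i k)) (ket la) =
       \sum_(b \in convex_boxes i la)
         ((q - q^-1)^-1 * r i la b * box_pos b ^ k) *: ket (la `\ b)%fset)
}.

End CombinatorialAction.

Section G0mu.
Variable mu : C.

(* (z, (k, i)) is the box with coordinates (i, k, 1) if z is true and         *)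
(* (i, k + mu, 0) if z is false; the order is lexicographic in z, k, i.       *)
Definition G0_box := (bool *l (nat *l nat))%type.

Definition G0_color (b : G0_box) : 'Z_2 :=
  let: (z, (k, i)) := b in if z then i%:R + 1 else i%:R.

Definition G0_coord (b : G0_box) : C * C * C :=
  let: (z, (k, i)) := b in
  if z then (i%:R, k%:R, 1) else (i%:R, k%:R + mu, 0).

Definition young_diagram (D : {fset nat * nat}) : Prop :=
  forall i k i' k' : nat,
    (i, k) \in D -> (i' <= i)%N -> (k' <= k)%N -> (i', k') \in D.

Definition G0_states : set {fset G0_box} :=
  [set la : {fset G0_box} | exists D1 D2 : {fset nat * nat},
     [/\ young_diagram D1, young_diagram D2
       & forall (z : bool) (k i : nat),
           ((z, (k, i)) : G0_box) \in la = ((i, k) \in if z then D1 else D2)]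
  ]%classic.

Definition G0_Psi : lweight C := fun i =>
  if i == 0 then
    (q3 * qpow (- mu))%:P%:F
    * (('X - (q3 ^- 2)%:P)%:F / ('X - (q2pow (- mu))%:P)%:F)
  else
    (qpow mu)%:P%:F
    * (('X - (q3^-1 * q2pow (- mu))%:P)%:F / ('X - (q3^-1)%:P)%:F).

Definition G0 : comb_data := CombData G0_color G0_coord G0_states G0_Psi.

End G0mu.

End Toroidal.

(* Main.v *)
From HB Require Import structures.
From mathcomp Require Import all_boot all_order all_algebra.
From mathcomp Require Import perm finmap.
From mathcomp Require Import boolp classical_sets fsbigop reals.
From mathcomp Require Import sequences exp trigo complex.
From mathcomp Require Import zify ring.
From mathcomp Require Import multinomials.monalg.
Require Import Defs.

(** Every relation is checked on the basis of states, and everything about a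
    state is read off the zeros and poles of its l-weight.

    The position of a box and the zeros and poles of Psi and of the inverses
    A_b^-1 are points q1^-x q2^-y of a lattice, shifted by q3^-1 for the boxes
    with z-coordinate 1 and by q2^-mu for the others. The conditions on
    the parameters make distinct lattice points distinct complex numbers
    (lpos_injective): genericity separates the points of one shift, and the
    colour convention and the condition on q2^mu exclude that a point of one
    shift meets a point of the other, for odd and for even powers of q1. Hence the
    order of an l-weight at a lattice point is a count over boxes. If the
    indicator function of a diagram is extended by 1 to negative coordinates,
    which accounts for Psi, this order is an alternating sum of six of its
    values (phiorder_ext), it is at least -1, and it is -1 exactly at the
    convex and the concave boxes (phiorder_boundary). So the l-weight is a
    constant plus simple poles at these boxes; its expansions at infinity and
    at zero give the action of K, and their difference is a sum of delta
    functions, one for each convex or concave box.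

    The coefficients of E and F are leading coefficients (flead) at the position
    of the box, which are multiplicative where values and residues are not. The
    coefficient of removing a box b is thus a product of factors M x b over the
    other boxes x, and the coefficient of adding b has the same form. All that
    the relations need is how M x y compares with M y x (ME_exchange,
    MF_exchange). The coefficient of removing several boxes one after another is
    a product over the boxes times a product over the ordered pairs of removed
    boxes (wordE); a pair taken in an inadmissible order contributes 0, which is
    also what the structure functions g give. The quadratic relations involve one
    pair, and the Serre relations become a polynomial identity in four
    positions (serre_polynomial). In the commutator of E and F, two different
    boxes contribute nothing (ME_MF), and a single box contributes the residue
    of the l-weight (weightEF_convex, weightEF_concave), which is what K^+ - K^-
    contributes. The relations of K with E and F hold because the l-weight is
    multiplied by A_b^{+-1} (expansion_mul). The generators H are obtained from
    the K currents by taking logarithms of power series (series_expK).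

    The orders of the l-weight determine the state (phiorder_inj), so the modes
    of K separate the states, and the module is tame. A submodule contains the
    weight components of its vectors (weight_component); removing boxes leads
    from every state to the empty one and adding boxes leads back, with nonzero
    coefficients, so a nonzero submodule is everything (simple_span). *)

Set Implicit Arguments.
Unset Strict Implicit.
Unset Printing Implicit Defensive.

Import Order.TTheory GRing.Theory Num.Theory.

Local Open Scope ring_scope.
Local Notation "p %:F" := (@tofrac _ p).


(** * Polynomials acting on two-sided sequences *)

Section PolyAction.
Variable C : fieldType.
Implicit Types (P Q n d : {poly C}) (s t : int -> C).

(** The sequence s stands for the formal series with coefficient s m at z^(-m),
    so that multiplication by z shifts the index up. *)
Definition pact P s (m : int) : C := \sum_(j < size P) P`_j * s (m + j%:Z).

Definition pseq n (m : int) : C := if m <= 0 then n`_`|m|%N else 0.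

Lemma pact_widen (N : nat) P s m : (size P <= N)%N ->
  pact P s m = \sum_(j < N) P`_j * s (m + j%:Z).
Proof.
move=> le; rewrite /pact (big_ord_widen _ (fun j => P`_j * s (m + j%:Z)) le).
rewrite big_mkcond /=; apply: eq_bigr => j _; case: ltnP => // lej.
by rewrite nth_default ?mul0r.
Qed.

Lemma eq_pact P s t : s =1 t -> pact P s =1 pact P t.
Proof. by move=> e m; apply: eq_bigr => j _; rewrite e. Qed.

Lemma pact0 s m : pact 0 s m = 0.
Proof. by rewrite /pact size_poly0 big_ord0. Qed.

Lemma pactD P Q s m : pact (P + Q) s m = pact P s m + pact Q s m.
Proof.
set N := maxn (size P) (size Q).
rewrite !(pact_widen (N := N)) ?leq_maxl ?leq_maxr ?size_polyD //.
by rewrite -big_split; apply: eq_bigr => j _; rewrite coefD mulrDl.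
Qed.

Lemma pactZ c P s m : pact (c *: P) s m = c * pact P s m.
Proof.
rewrite [LHS](pact_widen (N := size P)) ?size_scale_leq // mulr_sumr.
by apply: eq_bigr => j _; rewrite coefZ mulrA.
Qed.

Lemma pactN P s m : pact (- P) s m = - pact P s m.
Proof. by rewrite -scaleN1r pactZ mulN1r. Qed.

Lemma pactC c s m : pact c%:P s m = c * s m.
Proof.
by rewrite (pact_widen (N := 1)) ?size_polyC_leq1 // big_ord1 coefC addr0.
Qed.

Lemma pactMX P s m : pact (P * 'X) s m = pact P s (m + 1).
Proof.
rewrite (pact_widen (N := (size P).+1)); last first.
  by rewrite (leq_trans (size_polyMleq _ _)) // size_polyX addn2.
rewrite big_ord_recl coefMX mul0r add0r; apply: eq_bigr => j _.
rewrite coefMX /= /bump /= add1n; congr (_ * s _); rewrite intS; ring.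
Qed.

Lemma pactM P Q s m : pact (P * Q) s m = pact P (pact Q s) m.
Proof.
elim/poly_ind: P m => [|P c ih] m; first by rewrite mul0r !pact0.
rewrite mulrDl !pactD -mulrA [_ * Q]mulrC mulrA !pactMX ih.
by rewrite mul_polyC pactZ pactC.
Qed.

Lemma pactDr P s t m : pact P (fun k => s k + t k) m = pact P s m + pact P t m.
Proof.
by rewrite -big_split; apply: eq_bigr => j _; rewrite mulrDr.
Qed.

Lemma pactBr P s t m : pact P (fun k => s k - t k) m = pact P s m - pact P t m.
Proof.
by rewrite -sumrB; apply: eq_bigr => j _; rewrite mulrBr.
Qed.

Lemma pseqMX n m : pseq (n * 'X) m = pseq n (m + 1).
Proof.
rewrite /pseq; case: m => [[|k]|k] //=.
- by rewrite coefMX.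
- have -> : Negz k + 1 = - k%:Z by lia.
  by rewrite coefMX oppr_le0 abszN absz_nat.
Qed.

Lemma pseqD n d m : pseq (n + d) m = pseq n m + pseq d m.
Proof. by rewrite /pseq; case: ifP; rewrite ?coefD ?addr0. Qed.

Lemma pseqZ c n m : pseq (c *: n) m = c * pseq n m.
Proof. by rewrite /pseq; case: ifP; rewrite ?coefZ ?mulr0. Qed.

Lemma pact_pseq P n m : pact P (pseq n) m = pseq (P * n) m.
Proof.
elim/poly_ind: P m => [|P c ih] m.
  by rewrite mul0r pact0 /pseq coef0 if_same.
rewrite pactD pactMX ih pactC mulrDl pseqD -mulrA ['X * n]mulrC mulrA pseqMX.
by rewrite mul_polyC pseqZ.
Qed.

(** The first nonzero term of s times the leading coefficient of P is the first
    nonzero term of P s. *)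
Lemma pact_eq0_lo P s : P != 0 -> (forall m, pact P s m = 0) ->
  (exists N, forall m, m < N -> s m = 0) -> forall m, s m = 0.
Proof.
move=> P0 h [N hN].
suff H k : forall m, m < N + k%:Z -> s m = 0.
  by move=> m; apply: (H (`|m - N|.+1)%N); lia.
elim: k => [|k ih] m lt; first by apply: hN; lia.
have := h (m - (size P).-1%:Z); rewrite /pact.
have sP : (0 < size P)%N by rewrite size_poly_gt0.
case E: (size P) sP => [//|p] _; rewrite big_ord_recr big1 /=; last first.
  by move=> j _; rewrite ih ?mulr0 //; have := ltn_ord j; lia.
rewrite add0r subrK => /eqP; rewrite mulf_eq0 => /orP[|/eqP//].
by rewrite -[p]/(p.+1.-1) -E -lead_coefE lead_coef_eq0 (negbTE P0).
Qed.

(** The mirror image, with the lowest nonzero coefficient of P. *)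
Lemma pact_eq0_hi P s : P != 0 -> (forall m, pact P s m = 0) ->
  (exists N, forall m, N < m -> s m = 0) -> forall m, s m = 0.
Proof.
move=> P0 h [N hN].
suff H k : forall m, N - k%:Z < m -> s m = 0.
  by move=> m; apply: (H (`|m - N|.+1)%N); lia.
elim: k => [|k ih] m lt; first by apply: hN; lia.
have exv : exists v, P`_v != 0.
  by exists (size P).-1; rewrite -lead_coefE lead_coef_eq0.
case: (ex_minnP exv) => v Pv minv.
have := h (m - v%:Z); rewrite /pact.
have lv : (v < size P)%N.
  by rewrite ltnNge; apply/negP => /(nth_default 0) e; rewrite e eqxx in Pv.
rewrite (bigD1 (Ordinal lv)) //= big1 => [|j nj].
  rewrite addr0 subrK => /eqP; rewrite mulf_eq0 (negbTE Pv) /= => /eqP //.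
have [ltj|gej] := ltnP j v.
  have [->|/minv] := eqVneq P`_j 0; first by rewrite mul0r.
  by rewrite leqNgt ltj.
rewrite ih ?mulr0 //; suff : nat_of_ord j != v by lia.
by apply: contra nj => /eqP e; apply/eqP/val_inj.
Qed.

Definition bounded_series (dir : bool) s : Prop :=
  if dir then exists N, forall m, m < N -> s m = 0
  else exists N, forall m, N < m -> s m = 0.

(** The boolean records the point of expansion: true for infinity. *)
Definition expansion (dir : bool) (f : ratfun C) s : Prop :=
  if dir then expansion_infty f s else expansion_zero f s.

Lemma expansionP dir f s : expansion dir f s <->
  exists n d, [/\ d != 0, f = n%:F / d%:F, forall m, pact d s m = pseq n m
    & bounded_series dir s].
Proof. by case: dir. Qed.

Lemma bounded_pact dir P s : bounded_series dir s -> bounded_series dir (pact P s).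
Proof.
case: dir => -[N h].
  exists (N - (size P)%:Z) => m lt; rewrite /pact big1 // => j _.
  by rewrite h ?mulr0 //; have := ltn_ord j; lia.
by exists N => m lt; rewrite /pact big1 // => j _; rewrite h ?mulr0 //; lia.
Qed.

Lemma bounded_seriesB dir s t : bounded_series dir s -> bounded_series dir t ->
  bounded_series dir (fun m => s m - t m).
Proof.
case: dir => -[N h] [M k].
  by exists (Num.min N M) => m lt; rewrite h ?k ?subr0 //; lia.
by exists (Num.max N M) => m lt; rewrite h ?k ?subr0 //; lia.
Qed.

Lemma pact_eq0 dir P s : P != 0 -> (forall m, pact P s m = 0) ->
  bounded_series dir s -> forall m, s m = 0.
Proof. by case: dir; [apply: pact_eq0_lo | apply: pact_eq0_hi]. Qed.

Lemma tofrac_neq0 P : (P%:F != 0) = (P != 0).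
Proof. by rewrite tofrac_eq0. Qed.

(** A relation G f = H g passes to the expansions on the same side, because the
    denominators of f and g kill the difference, and a nonzero polynomial kills
    no nonzero series that is bounded on one side. *)
Lemma expansion_mul dir (G H : {poly C}) f g s t :
  expansion dir f s -> expansion dir g t -> G%:F * f = H%:F * g ->
  forall m, pact G s m = pact H t m.
Proof.
move=> /expansionP[n [d [d0 -> hs bs]]] /expansionP[n' [d' [d'0 -> ht bt]]] e m.
apply/eqP; rewrite -subr_eq0; apply/eqP; move: m.
apply: (@pact_eq0 dir (d * d')); first by rewrite mulf_neq0.
  move=> m; rewrite pactBr.
  have e1 k : pact (d * d') (pact G s) k = pseq (d' * G * n) k.
    rewrite -pactM; have -> : d * d' * G = d' * G * d by ring.
    by rewrite pactM (eq_pact _ hs) pact_pseq.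
  have e2 k : pact (d * d') (pact H t) k = pseq (d * H * n') k.
    rewrite -pactM; have -> : d * d' * H = d * H * d' by ring.
    by rewrite pactM (eq_pact _ ht) pact_pseq.
  rewrite e1 e2.
  have -> : d' * G * n = d * H * n'; last by rewrite subrr.
  apply/eqP; rewrite -(tofrac_eq (d' * G * n)) !tofracM; apply/eqP.
  move: e; rewrite !mulrA => /eqP; rewrite eqr_div ?tofrac_neq0 // => /eqP e.
  by rewrite -mulrA mulrC e; ring.
exact: bounded_seriesB (bounded_pact _ bs) (bounded_pact _ bt).
Qed.

Lemma expansion_uniq dir f s t :
  expansion dir f s -> expansion dir f t -> s =1 t.
Proof.
move=> hs ht m; have := expansion_mul hs ht (erefl (1%:P%:F * f)) m.
by rewrite !pactC !mul1r.
Qed.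

Lemma expansion_inj dir f g s t :
  expansion dir f s -> expansion dir g t -> s =1 t -> f = g.
Proof.
move=> /expansionP[n [d [d0 -> hs _]]] /expansionP[n' [d' [d'0 -> ht _]]] e.
apply/eqP; rewrite eqr_div ?tofrac_neq0 // -!tofracM tofrac_eq; apply/eqP.
have h m : pseq (n * d') m = pseq (n' * d) m.
  have -> : pseq (n * d') m = pact (d' * d) s m.
    by rewrite pactM (eq_pact _ hs) pact_pseq mulrC.
  have -> : pseq (n' * d) m = pact (d' * d) t m.
    by rewrite [d' * d]mulrC pactM (eq_pact _ ht) pact_pseq mulrC.
  exact: eq_pact.
apply/polyP => k; have := h (- k%:Z).
by rewrite /pseq oppr_le0 abszN absz_nat.
Qed.

End PolyAction.

(** * Logarithms of power series *)

Section SeriesLog.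
Variable C : numFieldType.
Implicit Types (u v : nat -> C^o).

Lemma series_powS u m n :
  series_pow u m.+1 n = \sum_(r < n.+1) u r * series_pow u m (n - r)%N.
Proof. by []. Qed.

Lemma series_pow1 u n : series_pow u 1 n = u n.
Proof.
rewrite series_powS big_ord_recr big1 => [|r _] /=; rewrite /series_pow /=.
  by rewrite add0r subnn eqxx mulr1.
by have -> : (n - r == 0)%N = false; [have := ltn_ord r; lia | rewrite mulr0].
Qed.

Lemma eq_series_pow u v m n : (forall k, (k <= n)%N -> u k = v k) ->
  series_pow u m n = series_pow v m n.
Proof.
elim: m n => [//|m ih] n e; rewrite !series_powS; apply: eq_bigr => r _.
rewrite e -1?ltnS // (ih (n - r)%N) // => k le; apply: e.
exact: leq_trans le (leq_subr _ _).
Qed.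

Lemma series_pow0 u m : u 0%N = 0 -> (0 < m)%N -> series_pow u m 0 = 0.
Proof. by case: m => // m u0 _; rewrite series_powS big_ord1 u0 mul0r. Qed.

(** In degree n the powers u^m with m > 1 only involve the terms of u of
    degree less than n. *)
Lemma eq_series_pow2 u v m n : u 0%N = 0 -> v 0%N = 0 ->
  (forall k, (k < n)%N -> u k = v k) ->
  series_pow u m.+2 n = series_pow v m.+2 n.
Proof.
move=> u0 v0 e; rewrite !(series_powS _ m.+1); apply: eq_bigr => r _.
have [r0|rp] := posnP r; first by rewrite r0 u0 v0 !mul0r.
have [ltr|ger] := ltnP r n.
  rewrite e //; congr (_ * _); apply: eq_series_pow => k le; apply: e; lia.
by rewrite (eqP (_ : (n - r == 0)%N)) ?subn_eq0 // !series_pow0 ?mulr0.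
Qed.

Lemma series_exp0 u : series_exp u 0 = 1.
Proof. by rewrite /series_exp big_ord1 fact0 invr1 scale1r. Qed.

Lemma series_expS u n : series_exp u n.+1 =
  u n.+1 + \sum_(m < n) (m.+2`!%:R)^-1 *: series_pow u m.+2 n.+1.
Proof.
rewrite /series_exp !big_ord_recl /= scaler0 add0r.
rewrite -[X in _ *: X + _]/(series_pow u 1 n.+1) series_pow1 /bump /= addn0 invr1 scale1r.
by congr (_ + _); apply: eq_bigr => m _; rewrite !add1n.
Qed.

(** The first n terms of the logarithm. *)
Fixpoint series_log (c : nat -> C) (n : nat) : nat -> C^o :=
  if n is n'.+1 then
    let h := series_log c n' in
    fun k => if k == n then c n - series_exp h n else h k
  else fun=> 0.

Lemma series_log_gt c n k : (n < k)%N -> series_log c n k = 0.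
Proof. by elim: n => //= n ih lt; case: eqP => [e|_]; [lia | apply: ih; lia]. Qed.

Lemma series_log_stable c n k : (k <= n)%N -> series_log c n k = series_log c k k.
Proof.
elim: n => [|n ih]; first by rewrite leqn0 => /eqP ->.
rewrite leq_eqVlt => /orP[/eqP -> //|lt] /=.
by case: eqP => [e|_]; [lia | apply: ih].
Qed.

Definition slog (c : nat -> C) (n : nat) : C^o := series_log c n n.

(** The terms of the logarithm are determined one at a time, since the term of
    degree n of exp h is that of h plus a function of the preceding ones. *)
Lemma series_expK (c : nat -> C) n : c 0%N = 1 -> series_exp (slog c) n = c n.
Proof.
move=> c0; case: n => [|n]; first by rewrite series_exp0 c0.
have l0 : series_log c n 0%N = 0 by rewrite series_log_stable.
rewrite series_expS {1}/slog /= eqxx series_expS series_log_gt // add0r.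
set S := (X in _ - X); suff -> : S = \sum_(m < n) (m.+2`!%:R)^-1 *:
    series_pow (slog c) m.+2 n.+1 by rewrite subrK.
apply: eq_bigr => m _; rewrite (@eq_series_pow2 _ (slog c)) // => k lt.
by rewrite /slog series_log_stable.
Qed.

End SeriesLog.

(** * Rational functions given by their zeros and poles *)

Section FactoredFunctions.
Variable C : fieldType.
Implicit Types (p : C) (s N D : seq C) (P Q : {poly C}).

(** Common zeros and poles may occur: cancelling them would break the
    multiplicativity of the data. *)
Record factored := Factored { fscal : C; fzeros : seq C; fpoles : seq C }.
Implicit Types F G : factored.

Definition polyroots s : {poly C} := \prod_(x <- s) ('X - x%:P).

Definition fval F : ratfun C :=
  (fscal F)%:P%:F * (polyroots (fzeros F))%:F / (polyroots (fpoles F))%:F.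

Definition ford F p : int :=
  (count_mem p (fzeros F))%:Z - (count_mem p (fpoles F))%:Z.

Definition diffprod p s : C := \prod_(x <- s | x != p) (p - x).

(** The value at p of (z - p)^(-k) F(z), with k the order of F at p. It is
    multiplicative in F, unlike values and residues. *)
Definition flead F p : C :=
  fscal F * diffprod p (fzeros F) / diffprod p (fpoles F).

Definition fmul F G := Factored (fscal F * fscal G)
  (fzeros F ++ fzeros G) (fpoles F ++ fpoles G).

Definition fprod (T : Type) (f : T -> factored) (r : seq T) : factored :=
  foldr (fun x => fmul (f x)) (Factored 1 [::] [::]) r.

Lemma polyroots_neq0 s : polyroots s != 0.
Proof. by rewrite prodf_seq_neq0; apply/allP=> x _; rewrite polyXsubC_eq0. Qed.

Lemma polyroots_cat s t : polyroots (s ++ t) = polyroots s * polyroots t.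
Proof. by rewrite /polyroots big_cat. Qed.

Lemma polyroots_monic s : polyroots s \is monic.
Proof. by apply: monic_prod => x _; rewrite monicXsubC. Qed.

Lemma size_polyroots s : size (polyroots s) = (size s).+1.
Proof. by rewrite /polyroots size_prod_XsubC. Qed.

Lemma polyroots_eval s p : (polyroots s).[p] = \prod_(x <- s) (p - x).
Proof.
by rewrite /polyroots horner_prod; apply: eq_bigr => x _; rewrite !hornerE.
Qed.

Lemma diffprod_neq0 p s : diffprod p s != 0.
Proof.
rewrite /diffprod big_seq_cond prodf_seq_neq0; apply/allP => x xs.
by apply/implyP => /andP[_ n]; rewrite subr_eq0 eq_sym.
Qed.

Lemma diffprod_cat p s t : diffprod p (s ++ t) = diffprod p s * diffprod p t.
Proof. by rewrite /diffprod big_cat. Qed.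

Lemma diffprod_notin p s : p \notin s -> diffprod p s = (polyroots s).[p].
Proof.
move=> ps; rewrite polyroots_eval /diffprod [LHS]big_mkcond /=.
apply: eq_big_seq => x xs; case: eqP => // e; by rewrite -e xs in ps.
Qed.

Lemma fvalM F G : fval (fmul F G) = fval F * fval G.
Proof.
by rewrite /fval /fmul /= !polyroots_cat polyCM !tofracM invfM; ring.
Qed.

Lemma fordM F G p : ford (fmul F G) p = ford F p + ford G p.
Proof. by rewrite /ford /fmul /= !count_cat; lia. Qed.

Lemma fleadM F G p : flead (fmul F G) p = flead F p * flead G p.
Proof. by rewrite /flead /fmul /= !diffprod_cat invfM; ring. Qed.

Lemma flead_neq0 F p : fscal F != 0 -> flead F p != 0.
Proof. by move=> c0; rewrite /flead !mulf_neq0 ?invr_neq0 ?diffprod_neq0. Qed.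

Lemma fprod_val (T : Type) (f : T -> factored) r :
  fval (fprod f r) = \prod_(x <- r) fval (f x).
Proof.
elim: r => [|x r ih]; last by rewrite big_cons -ih -fvalM.
by rewrite big_nil /fval /polyroots /= !big_nil mulr1 tofrac1 divr1.
Qed.

Lemma fprod_ord (T : Type) (f : T -> factored) r p :
  ford (fprod f r) p = \sum_(x <- r) ford (f x) p.
Proof. by elim: r => [|x r ih]; rewrite ?big_nil // big_cons -ih -fordM. Qed.

Lemma fprod_lead (T : Type) (f : T -> factored) r p :
  flead (fprod f r) p = \prod_(x <- r) flead (f x) p.
Proof.
elim: r => [|x r ih]; last by rewrite big_cons -ih -fleadM.
by rewrite big_nil /flead /diffprod /= !big_nil divr1 mulr1.
Qed.

Lemma fprod_scal (T : Type) (f : T -> factored) r :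
  fscal (fprod f r) = \prod_(x <- r) fscal (f x).
Proof. by elim: r => [|x r ih]; rewrite ?big_nil // big_cons -ih. Qed.

Lemma fprod_zeros (T : Type) (f : T -> factored) r :
  fzeros (fprod f r) = flatten [seq fzeros (f x) | x <- r].
Proof. by elim: r => //= x r ->. Qed.

Lemma fprod_poles (T : Type) (f : T -> factored) r :
  fpoles (fprod f r) = flatten [seq fpoles (f x) | x <- r].
Proof. by elim: r => //= x r ->. Qed.

Lemma polyroots_split p s : polyroots s =
  ('X - p%:P) ^+ count_mem p s * polyroots [seq x <- s | x != p].
Proof.
elim: s => [|x s ih] /=; first by rewrite expr0 mul1r.
rewrite /polyroots big_cons -/(polyroots s) ih; case: (eqVneq x p) => [->|n] /=.
  by rewrite add1n exprS mulrA.
by rewrite add0n big_cons mulrCA.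
Qed.

Lemma diffprod_filter p s :
  diffprod p s = (polyroots [seq x <- s | x != p]).[p].
Proof.
rewrite -diffprod_notin ?mem_filter ?eqxx //.
by rewrite /diffprod big_filter_cond; apply: eq_bigl => x; rewrite andbb.
Qed.

Definition fnum F p := fscal F *: polyroots [seq x <- fzeros F | x != p].
Definition fden F p := polyroots [seq x <- fpoles F | x != p].

Lemma flead_eval F p : flead F p = (fnum F p).[p] / (fden F p).[p].
Proof. by rewrite /flead /fnum hornerZ -!diffprod_filter. Qed.

Lemma fden_neq0 F p : (fden F p).[p] != 0.
Proof. by rewrite -diffprod_filter diffprod_neq0. Qed.

Lemma frac_eq P Q P' Q' : Q != 0 -> Q' != 0 -> P * Q' = P' * Q ->
  P%:F / Q%:F = P'%:F / Q'%:F.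
Proof.
move=> Q0 Q'0 e; apply: (mulIf (x := Q%:F)); first by rewrite tofrac_neq0.
rewrite divfK ?tofrac_neq0 //; apply: (mulIf (x := Q'%:F)).
  by rewrite tofrac_neq0.
by rewrite mulrAC divfK ?tofrac_neq0 // -!tofracM e.
Qed.

(** Takes the zeros and poles at p out of F, with two exponents because the order
    at p may have either sign. *)
Lemma fval_split F p k l : (count_mem p (fzeros F) + l)%N =
    (count_mem p (fpoles F) + k)%N ->
  fval F * (('X - p%:P) ^+ l)%:F = (('X - p%:P) ^+ k)%:F * (fnum F p)%:F / (fden F p)%:F.
Proof.
move=> e; rewrite /fval (polyroots_split p (fzeros F)).
rewrite (polyroots_split p (fpoles F)) /fnum /fden -mul_polyC.
set A := polyroots _; set B := polyroots _; set X := _ - _.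
rewrite mulrAC -!tofracM; apply: frac_eq.
- by rewrite mulf_neq0 ?polyroots_neq0 ?expf_neq0 ?polyXsubC_eq0.
- exact: polyroots_neq0.
set a := count_mem p _ in e *.
set b := count_mem p _ in e *; have : X ^+ a * X ^+ l = X ^+ b * X ^+ k.
  by rewrite -!exprD e.
move=> E; transitivity ((fscal F)%:P * (X ^+ a * X ^+ l) * A * B); first ring.
by rewrite E; ring.
Qed.

Lemma fval_value F p : ford F p = 0 -> is_value (fval F) p (flead F p).
Proof.
move=> o; exists (fnum F p), (fden F p); split; last exact: flead_eval.
  exact: fden_neq0.
have e : (count_mem p (fzeros F) + 0 = count_mem p (fpoles F) + 0)%N.
  by move: o; rewrite /ford; lia.
by have := fval_split e; rewrite expr0 tofrac1 mulr1 mul1r.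
Qed.

Lemma frac_polar_part P Q Y Z M c : Q != 0 -> Y != 0 -> Z != 0 ->
  P - c * (Q * Z) = M * Y ->
  P%:F / Q%:F / Y%:F / Z%:F = M%:F / (Q * Z)%:F + c%:F / Y%:F.
Proof.
have aux (K : fieldType) (q y z m t : K) : q != 0 -> y != 0 -> z != 0 ->
    (m * y + t * (q * z)) / q / y / z = m / (q * z) + t / y.
  by move=> q0 y0 z0; field; rewrite q0 y0 z0.
move=> Q0 Y0 Z0 h; have -> : P = M * Y + c * (Q * Z) by rewrite -h subrK.
rewrite tofracD !tofracM; apply: aux; by rewrite tofrac_neq0.
Qed.

Lemma simple_pole_residue (f : ratfun C) p P Q : p != 0 -> Q.[p] != 0 ->
  f * ('X - p%:P)%:F = P%:F / Q%:F ->
  is_residue (f / 'X%:F) p (P.[p] / Q.[p] / p).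
Proof.
move=> p0 Qp e; set r := _ / p.
have Q0 : Q != 0 by apply: contraNneq Qp => ->; rewrite horner0.
have X0 : ('X - p%:P)%:F != 0 :> ratfun C.
  by rewrite tofrac_neq0 polyXsubC_eq0.
have : root (P - r *: (Q * 'X)) p.
  rewrite /root hornerD hornerN hornerZ hornerM hornerX /r.
  by apply/eqP; field; rewrite p0.
move=> /factor_theorem[m em].
have QX0 : Q * 'X != 0 by rewrite mulf_neq0 ?polyX_eq0.
exists (m%:F / (Q * 'X)%:F), [::]; split.
  exists (m.[p] / (Q * 'X).[p]), m, (Q * 'X); split=> //.
  by rewrite hornerM hornerX mulf_neq0.
rewrite big_ord0 addr0 (canRL (mulfK X0) e).
have := @frac_polar_part P Q ('X - p%:P) 'X m r%:P Q0 (negbT (polyXsubC_eq0 _)).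
by rewrite polyX_eq0 mul_polyC => /(_ isT em) ->.
Qed.

Lemma fval_residue F p : p != 0 -> ford F p = -1 ->
  is_residue (fval F / 'X%:F) p (flead F p / p).
Proof.
move=> p0 o; rewrite flead_eval; apply: simple_pole_residue => //.
  exact: fden_neq0.
have e : (count_mem p (fzeros F) + 1 = count_mem p (fpoles F) + 0)%N.
  by move: o; rewrite /ford; lia.
by have := fval_split e; rewrite expr0 expr1 tofrac1 mul1r.
Qed.

(** Both sides are monic of the same degree, so their difference has lower
    degree; it vanishes at the points of L, as in Lagrange interpolation. *)
Lemma lagrange_roots (M L : seq C) : uniq L -> size M = size L ->
  polyroots M = polyroots L + \sum_(p <- L)
    ((polyroots M).[p] / diffprod p L) *: polyroots [seq x <- L | x != p].
Proof.
move=> uL sz; apply/eqP; rewrite -subr_eq0; apply/eqP.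
set P := (X in X = 0); apply: contraTeq isT => P0.
have rP : all (root P) L.
  apply/allP => p pL; rewrite /P /root !hornerE opprD addrA horner_sum.
  have -> : (polyroots L).[p] = 0.
    by apply/eqP; rewrite -[_ == 0]/(root _ _) root_prod_XsubC.
  rewrite subr0 (bigD1_seq p) //= big1 ?addr0.
    by rewrite hornerZ -diffprod_filter divfK ?subrr ?diffprod_neq0.
  move=> x xp; rewrite hornerZ (_ : _.[p] = 0) ?mulr0 //.
  apply/eqP; rewrite -[_ == 0]/(root _ _) root_prod_XsubC mem_filter.
  by rewrite eq_sym xp.
have := max_poly_roots P0 rP uL; rewrite ltnNge => /negP; case.
rewrite /P opprD addrA -ltnS; apply: (@leq_ltn_trans (size L)) => //.
apply: (leq_trans (size_polyD _ _)); rewrite geq_max; apply/andP; split.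
  rewrite -ltnS -size_polyroots.
  have e : lead_coef (polyroots M) = lead_coef (polyroots L).
    by rewrite !(monicP (polyroots_monic _)).
  have s1 : size (polyroots M) = size (polyroots L).
    by rewrite !size_polyroots sz.
  rewrite size_polyroots ltnS; apply/leq_sizeP => j lej.
  rewrite coefB; move: lej; rewrite leq_eqVlt => /orP[/eqP <-|lt].
    move: e; rewrite !lead_coefE s1 size_polyroots /= => ->; exact: subrr.
  by rewrite !nth_default ?subrr ?size_polyroots ?sz.
rewrite size_polyN; apply: (leq_trans (size_sum _ _ _)).
apply/bigmax_leqP_seq => p pL _; apply: (leq_trans (size_scale_leq _ _)).
rewrite size_polyroots size_filter -(count_predC (pred1 p)) /=.
have -> : count (pred1 p) L = 1%N by rewrite count_uniq_mem ?pL.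
by rewrite add1n ltnS.
Qed.

Lemma count_le_split (D S : seq C) :
  (forall p, (count_mem p D <= count_mem p S)%N) -> exists M, perm_eq S (D ++ M).
Proof.
elim: D S => [|x D ih] S h; first by exists S.
have xS : x \in S by rewrite -has_pred1 has_count; have := h x; rewrite /= eqxx; lia.
have pS := perm_to_rem xS.
have [p|M pM] := ih (rem x S).
  by have := h p; rewrite (seq.permP pS) /= leq_add2l.
by exists M; rewrite (permPl pS) cat_cons perm_cons.
Qed.

Lemma polyroots_perm s t : perm_eq s t -> polyroots s = polyroots t.
Proof. by move=> e; rewrite /polyroots (perm_big _ e). Qed.

Lemma diffprod_perm p s t : perm_eq s t -> diffprod p s = diffprod p t.
Proof. by move=> e; rewrite /diffprod (perm_big _ e). Qed.

Lemma scaled_frac (c : C) P : (c *: P)%:F = c%:P%:F * P%:F.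
Proof. by rewrite -mul_polyC tofracM. Qed.

(** After cancellation F is a quotient of two monic polynomials of the same
    degree, up to a constant, which lagrange_roots expands; the second claim
    compares the values at 0. *)
Lemma fval_partial_fractions F (L : seq C) :
  size (fzeros F) = size (fpoles F) -> uniq L -> 
  (forall p, p \in L -> ford F p = -1) ->
  (forall p, p \notin L -> 0 <= ford F p) ->
  fval F = (fscal F)%:P%:F +
    \sum_(p <- L) (flead F p)%:P%:F / ('X - p%:P)%:F /\
  (0 \notin fzeros F -> 0 \notin fpoles F ->
   fscal F * \prod_(x <- fzeros F) x / \prod_(x <- fpoles F) x
   = fscal F - \sum_(p <- L) flead F p / p).
Proof.
move=> sz uL oL onL.
have cL p : count_mem p L = (p \in L) by rewrite count_uniq_mem.
have [p|M pM] := @count_le_split (fpoles F) (fzeros F ++ L).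
  rewrite count_cat cL; have [/oL|/onL] := boolP (p \in L); rewrite /ford; lia.
have sM : size M = size L.
  by have := perm_size pM; rewrite !size_cat sz => /addnI.
have lead p : p \in L ->
    flead F p = fscal F * ((polyroots M).[p] / diffprod p L).
  move=> pL; have := diffprod_perm p pM; rewrite !diffprod_cat => e.
  have pnM : p \notin M.
    rewrite -has_pred1 has_count -leqNgt leqn0; apply/eqP.
    have := seq.permP pM (pred1 p); rewrite !count_cat cL pL.
    by have := oL _ pL; rewrite /ford; lia.
  rewrite -diffprod_notin // /flead -mulrA; congr (_ * _).
  apply/eqP; rewrite eqr_div ?diffprod_neq0 //; apply/eqP.
  by rewrite e mulrC.
have lag := lagrange_roots uL sM.
have L0 : (polyroots L)%:F != 0 :> ratfun C by rewrite tofrac_neq0 polyroots_neq0.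
split.
  have -> : fval F = (fscal F)%:P%:F * (polyroots M)%:F / (polyroots L)%:F.
    rewrite /fval -!mulrA; congr (_ * _); apply/eqP.
    rewrite eqr_div ?tofrac_neq0 ?polyroots_neq0 // -!tofracM tofrac_eq.
    by rewrite -polyroots_cat (polyroots_perm pM) polyroots_cat mulrC.
  rewrite lag tofracD mulrDr mulrDl mulfK //; congr (_ + _).
  rewrite -mulrA raddf_sum mulr_suml mulr_sumr; apply: eq_big_seq => p pL /=.
  have e1 : (polyroots [seq x <- L | x != p])%:F / (polyroots L)%:F =
      1%:F / ('X - p%:P)%:F :> ratfun C.
    apply: frac_eq; rewrite ?polyroots_neq0 ?polyXsubC_eq0 //.
    by rewrite mul1r (polyroots_split p L) cL pL expr1 mulrC.
  rewrite lead //; move: (_ / diffprod p L) => t.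
  by rewrite scaled_frac polyCM tofracM -[_ / (polyroots L)%:F]mulrA e1 tofrac1
    mul1r mulrA.
move=> z0 p0; have nz (s : seq C) : 0 \notin s -> \prod_(x <- s) x != 0.
  move=> s0; rewrite prodf_seq_neq0; apply/allP => x xs /=.
  by apply: contraNneq s0 => <-.
have L00 : 0 \notin L.
  by apply/negP => /oL; rewrite /ford (count_memPn z0) (count_memPn p0).
have M00 : 0 \notin M.
  rewrite -has_pred1 has_count -leqNgt leqn0.
  have := seq.permP pM (pred1 0); rewrite !count_cat.
  by rewrite (count_memPn z0) (count_memPn p0) (count_memPn L00) !add0n => <-.
have := perm_big _ pM : \prod_(x <- _) x = _; rewrite !big_cat /= => pe.
rewrite -mulrA; have -> : \prod_(x <- fzeros F) x / \prod_(x <- fpoles F) x =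
    \prod_(x <- M) x / \prod_(x <- L) x.
  by apply/eqP; rewrite eqr_div ?nz // pe mulrC.
have ev (s : seq C) : (polyroots s).[0] = (-1) ^+ size s * \prod_(x <- s) x :> C.
  rewrite polyroots_eval; elim: s => [|x s ih].
    by rewrite !big_nil expr0 mulr1.
  by rewrite !big_cons ih exprS; ring.
have sg0 : (-1) ^+ size L != 0 :> C by rewrite expf_neq0 // oppr_eq0 oner_eq0.
have -> : \prod_(x <- M) x / \prod_(x <- L) x =
    (polyroots M).[0] / (polyroots L).[0].
  by rewrite !ev sM -mulf_div divff // mul1r.
have eL : (polyroots L).[0] != 0 by rewrite ev mulf_neq0 ?nz.
rewrite {1}lag hornerD mulrDl divff // mulrDr mulr1; congr (_ + _).
rewrite horner_sum mulr_suml mulr_sumr -sumrN; apply: eq_big_seq => p pL.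
have p0' : p != 0 by apply: contraNneq L00 => <-.
rewrite lead // hornerZ (polyroots_split p L) cL pL expr1 hornerM hornerXsubC.
set A := (polyroots [seq _ <- _ | _]).[0]; have A0 : A != 0.
  move: eL; rewrite (polyroots_split p L) hornerM mulf_eq0 negb_or.
  by case/andP.
by field; rewrite ?oppr_eq0 ?sub0r ?oppr_eq0 p0' ?A0 diffprod_neq0.
Qed.

(** ** Laurent expansions *)

(** The expansions of r / (z - p) at infinity and at 0. *)
Definition polar_series (dir : bool) p (r : C) (m : int) : C :=
  if dir then if 0 < m then r * p ^ (m - 1) else 0
  else if m <= 0 then - (r * p ^ (m - 1)) else 0.

Definition const_series (c : C) (m : int) : C := if m == 0 then c else 0.

Lemma expansion_const dir (c : C) : expansion dir c%:P%:F (const_series c).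
Proof.
apply/expansionP; exists c%:P, 1; split; first exact: oner_neq0.
- by rewrite tofrac1 divr1.
- move=> m; rewrite -[1]/(1%:P) pactC mul1r /pseq /const_series coefC absz_eq0.
  by case: eqP => [->|]; rewrite ?lexx // if_same.
- by case: dir; exists 0 => m lt; rewrite /const_series; case: eqP => // e; lia.
Qed.

Lemma expansion_polar dir p r : p != 0 ->
  expansion dir (r%:P%:F / ('X - p%:P)%:F) (polar_series dir p r).
Proof.
move=> p0; apply/expansionP; exists r%:P, ('X - p%:P); split => //.
- by rewrite polyXsubC_eq0.
- move=> m; rewrite -['X]mul1r pactD pactN pactMX pactC -[1]/(1%:P) pactC mul1r.
  have e : p ^ m = p * p ^ (m - 1).
    by rewrite -[X in X * _]expr1z -expfzDr //; congr (_ ^ _); lia.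
  rewrite /polar_series /pseq coefC absz_eq0 addrK.
  case: (ltgtP m 0) => [lt|gt|m0]; case: dir.
  + by rewrite (_ : 0 < m + 1 = false) ?mulr0 ?subr0 //; lia.
  + by rewrite (_ : m + 1 <= 0 = true) ?e; [ring | lia].
  + by rewrite (_ : 0 < m + 1 = true) ?e; [ring | lia].
  + by rewrite (_ : m + 1 <= 0 = false) ?mulr0 ?subr0 //; lia.
  + by rewrite (_ : 0 < m + 1 = true) ?m0 ?expr0z; [ring | lia].
  + rewrite (_ : m + 1 <= 0 = false) ?sub0r; last by lia.
    by rewrite mulrN opprK mulrCA -e m0 expr0z mulr1.
- by case: dir; exists 0 => m lt; rewrite /polar_series ifF //; lia.
Qed.

Lemma bounded_seriesD dir (s t : int -> C) : bounded_series dir s ->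
  bounded_series dir t -> bounded_series dir (fun m => s m + t m).
Proof.
case: dir => -[N h] [M k].
  by exists (Num.min N M) => m lt; rewrite h ?k ?addr0 //; lia.
by exists (Num.max N M) => m lt; rewrite h ?k ?addr0 //; lia.
Qed.

Lemma expansionD dir f g (s t : int -> C) :
  expansion dir f s -> expansion dir g t ->
  expansion dir (f + g) (fun m => s m + t m).
Proof.
move=> /expansionP[n [d [d0 -> hs bs]]] /expansionP[n' [d' [d'0 -> ht bt]]].
apply/expansionP; exists (n * d' + n' * d), (d * d'); split.
- exact: mulf_neq0.
- by rewrite addf_div ?tofrac_neq0 // tofracD !tofracM.
- move=> m; rewrite pactDr pseqD; congr (_ + _).
    by rewrite mulrC pactM (eq_pact _ hs) pact_pseq mulrC.
  by rewrite pactM (eq_pact _ ht) pact_pseq mulrC.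
- exact: bounded_seriesD.
Qed.

Definition simple_series dir (c : C) (L : seq (C * C)) (m : int) : C :=
  const_series c m + \sum_(pr <- L) polar_series dir pr.1 pr.2 m.

Lemma expansion_simple dir c (L : seq (C * C)) :
  (forall pr, pr \in L -> pr.1 != 0) ->
  expansion dir (c%:P%:F + \sum_(pr <- L) pr.2%:P%:F / ('X - pr.1%:P)%:F)
    (simple_series dir c L).
Proof.
move=> nz; apply: expansionD; first exact: expansion_const.
elim: L nz => [|pr L ih] nz.
  have e0 : 0%:P%:F = 0 :> ratfun C by rewrite polyC0 tofrac0.
  rewrite big_nil -e0.
  have := expansion_const dir 0; congr (expansion _ _ _).
  by apply/funext => m; rewrite big_nil /const_series if_same.
rewrite big_cons.
have := expansionD (expansion_polar dir pr.2 (nz _ (mem_head _ _))) (ih _).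
have -> : (fun m => polar_series dir pr.1 pr.2 m + \sum_(pr0 <- L) polar_series dir pr0.1 pr0.2 m) = (fun m : int => \sum_(pr0 <- pr :: L) polar_series dir pr0.1 pr0.2 m).
  by apply/funext => m; rewrite big_cons.
by apply => x xL; apply: nz; rewrite inE xL orbT.
Qed.

Lemma simple_series_diff c L m :
  (forall pr, pr \in L -> pr.1 != 0) ->
  simple_series true c L m - simple_series false c L m =
  \sum_(pr <- L) pr.2 / pr.1 * pr.1 ^ m.
Proof.
move=> nz; rewrite /simple_series opprD addrACA subrr add0r -sumrB.
apply: eq_big_seq => pr /nz p0; rewrite /polar_series.
have e : pr.1 ^ (m - 1) = pr.1^-1 * pr.1 ^ m.
  by rewrite expfzDr // mulrC.
by case: ltP => _; rewrite ?subr0 ?sub0r ?opprK -mulrA -e.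
Qed.

Lemma simple_series0 c L :
  simple_series true c L 0 = c /\
  simple_series false c L 0 = c - \sum_(pr <- L) pr.2 / pr.1.
Proof.
rewrite /simple_series /const_series eqxx; split.
  by rewrite big1 ?addr0.
by rewrite -sumrN; congr (_ + _); apply: eq_bigr => pr _; rewrite /polar_series.
Qed.

Lemma simple_series_out dir c L m :
  (if dir then m < 0 else 0 < m) -> simple_series dir c L m = 0.
Proof.
move=> h; rewrite /simple_series /const_series big1 => [|pr _].
  by case: eqP h => [->|]; case: dir; rewrite ?ltxx ?addr0.
by rewrite /polar_series; case: dir h => h; rewrite ifF //; lia.
Qed.

End FactoredFunctions.

(** * Pairs of Young diagrams in the lattice *)

Section Lattice.

(** (z, (y, x)) stands for q1^(-x) q2^(-y) times the shift of the family z of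
    boxes. The indices are integers, since zeros and poles lie outside the
    quadrant of the boxes. *)
Definition lattice := (bool * (int * int))%type.
Implicit Types (P Q : lattice) (b : G0_box) (A B : pred G0_box) (i : 'Z_2).

Definition lshift P (dy dx : int) : lattice := (P.1, (P.2.1 + dy, P.2.2 + dx)).

Definition lcolor P : 'Z_2 := P.2.2%:~R + P.1%:R.

Definition lbox b : lattice := let: (z, (k, x)) := b in (z, (k%:Z, x%:Z)).

Lemma Z2_add1_neq i : (i + 1 == i) = false.
Proof. by case: i => [[|[|]]]. Qed.

Lemma Z2_neq i j : i != j -> i = j + 1.
Proof.
by case: i j => [[|[|m]] hm] [[|[|m']] hm'] //= _; apply/val_inj.
Qed.

Lemma Z2_intr (x : int) : x%:~R = (odd `|x|%N)%:R :> 'Z_2.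
Proof.
have h (n : nat) : n%:R = (odd n)%:R :> 'Z_2.
  rewrite -[in LHS](odd_double_half n) natrD -mul2n natrM.
  have -> : 2%:R = 0 :> 'Z_2 by apply/val_inj.
  by rewrite mul0r addr0.
case: x => n; first exact: h.
rewrite NegzE abszN absz_nat mulrNz -pmulrn.
by rewrite [n.+1%:R]h; case: odd; apply/val_inj.
Qed.

Lemma lcolor_box b : lcolor (lbox b) = G0_color b.
Proof. by case: b => -[] [k x]; rewrite /lcolor /= ?addr0. Qed.

Lemma lcolor_shift P dy dx :
  lcolor (lshift P dy dx) = lcolor P + (odd `|dx|%N)%:R.
Proof. by rewrite /lcolor /= intrD Z2_intr [dx%:~R]Z2_intr -Z2_intr addrAC. Qed.

Lemma lshift_eq P Q dy dx : (lshift Q dy dx == P) = (Q == lshift P (- dy) (- dx)).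
Proof.
case: P Q => z [y x] [z' [y' x']]; rewrite /lshift !xpair_eqE /=.
by congr [&& _, _ & _]; lia.
Qed.

Lemma lbox_inj : injective lbox.
Proof. by move=> [z [k x]] [z' [k' x']] [-> -> ->]. Qed.

(** The zeros and poles of the inverse of A_b, component i. *)
Definition Azeros b i : seq lattice :=
  if i == G0_color b then [:: lshift (lbox b) (-1) 0]
  else [:: lshift (lbox b) 0 (-1); lshift (lbox b) 1 1].

Definition Apoles b i : seq lattice :=
  if i == G0_color b then [:: lshift (lbox b) 1 0]
  else [:: lshift (lbox b) 0 1; lshift (lbox b) (-1) (-1)].

Definition Psizeros i : seq lattice := [:: (i == 0, (-1, -1))].
Definition Psipoles i : seq lattice := [:: (i != 0, (0, 0))].

Definition phizeros (s : seq G0_box) i :=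
  Psizeros i ++ flatten [seq Azeros b i | b <- s].
Definition phipoles (s : seq G0_box) i :=
  Psipoles i ++ flatten [seq Apoles b i | b <- s].

Definition lorder (N D : seq lattice) P : int :=
  (count_mem P N)%:Z - (count_mem P D)%:Z.

Definition phiorder s i P : int := lorder (phizeros s i) (phipoles s i) P.

Lemma count_Azeros b P : count_mem P (Azeros b (lcolor P)) =
  ((lbox b == lshift P 1 0) + (lbox b == lshift P 0 1)
   + (lbox b == lshift P (-1) (-1)))%N.
Proof.
have neq dy dx : odd `|dx|%N != (lcolor P != G0_color b) ->
    (lbox b == lshift P dy dx) = false.
  apply: contraNF => /eqP e.
  have := lcolor_box b; rewrite e lcolor_shift => <-.
  case: (odd _); first by rewrite [lcolor P == _]eq_sym Z2_add1_neq.
  by rewrite addr0 eqxx.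
rewrite /Azeros; have [e|n] := eqVneq (lcolor P) (G0_color b); rewrite /= !lshift_eq.
  by rewrite !addn0 opprK oppr0 [_ == lshift P 0 1]neq ?[_ == lshift P (-1) _]neq
     ?e ?eqxx ?addn0.
by rewrite !addn0 opprK oppr0 [_ == lshift P 1 0]neq ?n.
Qed.

Lemma count_Apoles b P : count_mem P (Apoles b (lcolor P)) =
  ((lbox b == lshift P (-1) 0) + (lbox b == lshift P 0 (-1))
   + (lbox b == lshift P 1 1))%N.
Proof.
have neq dy dx : odd `|dx|%N != (lcolor P != G0_color b) ->
    (lbox b == lshift P dy dx) = false.
  apply: contraNF => /eqP e.
  have := lcolor_box b; rewrite e lcolor_shift => <-.
  case: (odd _); first by rewrite [lcolor P == _]eq_sym Z2_add1_neq.
  by rewrite addr0 eqxx.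
rewrite /Apoles; have [e|n] := eqVneq (lcolor P) (G0_color b); rewrite /= !lshift_eq.
  by rewrite !addn0 oppr0 [_ == lshift P 0 (-1)]neq ?[_ == lshift P 1 _]neq
     ?e ?eqxx ?addn0.
by rewrite !addn0 !opprK oppr0 [_ == lshift P (-1) 0]neq ?n.
Qed.

Lemma lcolor_phi s i P : P \in phizeros s i ++ phipoles s i -> lcolor P = i.
Proof.
have h b j : lcolor (lshift (lbox b) j 0) = G0_color b.
  by rewrite lcolor_shift lcolor_box addr0.
have h1 b j : i != G0_color b -> lcolor (lshift (lbox b) j 1) = i.
  by move=> /Z2_neq ->; rewrite lcolor_shift lcolor_box.
have h2 b j : i != G0_color b -> lcolor (lshift (lbox b) j (-1)) = i.
  by move=> /Z2_neq ->; rewrite lcolor_shift lcolor_box.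
rewrite !mem_cat => /orP[]/orP[].
- by rewrite mem_seq1 => /eqP ->; case: i {h h1 h2} => [[|[|]]] // ?; apply/val_inj.
- case/flatten_mapP => b _; rewrite /Azeros; case: eqVneq => [->|n].
    by rewrite mem_seq1 => /eqP ->.
  by rewrite !inE => /orP[] /eqP ->; rewrite (h1, h2).
- by rewrite mem_seq1 => /eqP ->; case: i {h h1 h2} => [[|[|]]] // ?; apply/val_inj.
- case/flatten_mapP => b _; rewrite /Apoles; case: eqVneq => [->|n].
    by rewrite mem_seq1 => /eqP ->.
  by rewrite !inE => /orP[] /eqP ->; rewrite (h1, h2).
Qed.

(** Only one component of an l-weight has zeros or poles at a given point. *)
Lemma phiorder_color s i P : lcolor P != i -> phiorder s i P = 0.
Proof.
move=> n; have h : P \notin phizeros s i ++ phipoles s i.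
  by apply: contra n => h; apply/eqP/(@lcolor_phi s).
move: h; rewrite mem_cat negb_or => /andP[hz hp].
by rewrite /phiorder /lorder (count_memPn hz) (count_memPn hp).
Qed.

(** The indicator function of A, extended by 1 to the points with a negative
    coordinate: this extension absorbs the contribution of Psi. *)
Definition ext A (z : bool) (y x : int) : bool :=
  [|| y < 0, x < 0 | A (z, (`|y|%N, `|x|%N))].

Definition boxat A (z : bool) (y x : int) : bool :=
  [&& 0 <= y, 0 <= x & A (z, (`|y|%N, `|x|%N))].

Lemma sum_lbox (s : seq G0_box) z y x : uniq s ->
  \sum_(b <- s) (lbox b == (z, (y, x)) : nat) = boxat (mem s) z y x :> nat.
Proof.
move=> us; have [h|h] := boolP ((0 <= y) && (0 <= x)); last first.
  rewrite /boxat andbA (negbTE h) big1 // => -[z' [k' x']] _ /=.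
  by apply/eqP; rewrite eqb0; apply: contra h => /eqP[_ <- <-].
rewrite /boxat andbA h /= -(count_uniq_mem _ us) -sum1_count [RHS]big_mkcond.
apply: eq_bigr => -[z' [k' x']] _ /=.
by case/andP: h; case: y => // k; case: x.
Qed.

Definition order_at (e : int -> int -> bool) (y x : int) : int :=
  Posz (e (y + 1) x) + Posz (e y (x + 1)) + Posz (e (y - 1) (x - 1))
  - Posz (e (y - 1) x) - Posz (e y (x - 1)) - Posz (e (y + 1) (x + 1)).

(** The extension by 1 contributes a zero at (-1, -1) and a pole at (0, 0), those
    of Psi; elsewhere its contributions cancel. *)
Lemma phiorder_ext s z y x : uniq s ->
  phiorder s (lcolor (z, (y, x))) (z, (y, x)) = order_at (ext (mem s) z) y x.
Proof.
move=> us; set i := lcolor _; rewrite /phiorder /lorder !count_cat.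
have sz : count_mem (z, (y, x)) (flatten [seq Azeros b i | b <- s]) =
    (boxat (mem s) z (y + 1) x + boxat (mem s) z y (x + 1)
     + boxat (mem s) z (y - 1) (x - 1))%N.
  rewrite count_flatten sumnE !big_map -!sum_lbox // -!big_split.
  by apply: eq_bigr => b _; rewrite count_Azeros /lshift /= !addr0.
have sp : count_mem (z, (y, x)) (flatten [seq Apoles b i | b <- s]) =
    (boxat (mem s) z (y - 1) x + boxat (mem s) z y (x - 1)
     + boxat (mem s) z (y + 1) (x + 1))%N.
  rewrite count_flatten sumnE !big_map -!sum_lbox // -!big_split.
  by apply: eq_bigr => b _; rewrite count_Apoles /lshift /= !addr0.
have c1 : count_mem (z, (y, x)) (Psizeros i) = ((y == -1) && (x == -1)) :> nat.
  rewrite /= addn0 !xpair_eqE ![-1 == _]eq_sym /i.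
  have [->|_] := eqVneq x (-1); last by rewrite !andbF.
  by rewrite !andbT; case: z {sz sp i}; case: eqP.
have c2 : count_mem (z, (y, x)) (Psipoles i) = ((y == 0) && (x == 0)) :> nat.
  rewrite /= addn0 !xpair_eqE ![0 == _]eq_sym /i.
  have [->|_] := eqVneq x 0; last by rewrite !andbF.
  by rewrite !andbT; case: z {sz sp c1 i}; case: eqP.
rewrite sz sp c1 c2 /order_at /ext /boxat.
set a1 := mem s _; set a2 := mem s _; set a3 := mem s _.
set a4 := mem s _; set a5 := mem s _; set a6 := mem s _.
clearbody a1 a2 a3 a4 a5 a6; rewrite !leNgt.
have -> : (y == -1) = ~~ (y + 1 < 0) && (y < 0) by lia.
have -> : (x == -1) = ~~ (x + 1 < 0) && (x < 0) by lia.
have -> : (y == 0) = ~~ (y < 0) && (y - 1 < 0) by lia.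
have -> : (x == 0) = ~~ (x < 0) && (x - 1 < 0) by lia.
have : (y + 1 < 0) ==> (y < 0) by lia.
have : (y < 0) ==> (y - 1 < 0) by lia.
have : (x + 1 < 0) ==> (x < 0) by lia.
have : (x < 0) ==> (x - 1 < 0) by lia.
move: (x + 1 < 0) (x < 0) (x - 1 < 0) (y + 1 < 0) (y < 0) (y - 1 < 0).
by do 6 case => //=; move: a1 a2 a3 a4 a5 a6; do 6 case.
Qed.

End Lattice.

(** * States and their boundaries *)

Section States.
Implicit Types (A B : pred G0_box) (b : G0_box) (s : seq G0_box).

Definition stable A : Prop := forall z (k x : nat),
  (A (z, (k.+1, x)) -> A (z, (k, x))) /\ (A (z, (k, x.+1)) -> A (z, (k, x))).

Lemma eq_stable A B : A =1 B -> stable A -> stable B.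
Proof. by move=> e sA z k x; rewrite -!e. Qed.

Lemma stableI A B : stable A -> stable B -> stable (predI A B).
Proof.
move=> sA sB z k x; split=> /= /andP[a b].
  by rewrite (sA z k x).1 ?(sB z k x).1.
by rewrite (sA z k x).2 ?(sB z k x).2.
Qed.

Lemma stableU A B : stable A -> stable B -> stable (predU A B).
Proof.
move=> sA sB z k x; split=> /= /orP[a|b].
- by rewrite (sA z k x).1.
- by rewrite (sB z k x).1 ?orbT.
- by rewrite (sA z k x).2.
- by rewrite (sB z k x).2 ?orbT.
Qed.

Lemma stable_le A z k x k' x' : stable A -> A (z, (k, x)) ->
  (k' <= k)%N -> (x' <= x)%N -> A (z, (k', x')).
Proof.
move=> sA a /subnK ek /subnK ex; move: a; rewrite -ek -ex.
move: (k - k')%N (x - x')%N => m n {ek ex}.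
elim: m => [|m ih]; last by rewrite addSn => /(sA _ _ _).1.
by rewrite add0n; elim: n => [|n ih] //; rewrite addSn => /(sA _ _ _).2.
Qed.

Lemma G0_statesP (la : {fset G0_box}) : G0_states la <-> stable (mem la).
Proof.
split=> [[D1 [D2 [y1 y2 h]]] z k x | sla].
  rewrite /= !h; have : young_diagram (if z then D1 else D2) by case: z.
  by move=> y; split => a; apply: (y _ _ _ _ a).
pose D z := [fset (b.2.2, b.2.1) | b in [fset b in la | b.1 == z]]%fset.
have mD z k x : ((x, k) \in D z) = ((z, (k, x)) \in la).
  apply/imfsetP/idP => /= [[[z' [k' x']]]|h].
    by rewrite !inE /= => /andP[h /eqP e] [-> ->]; rewrite -e.
  by exists (z, (k, x)); rewrite //= !inE /= h eqxx.
exists (D true), (D false); split; last by case=> k x; rewrite mD.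
  by move=> x k x' k'; rewrite !mD => a le le'; apply: (stable_le sla a).
by move=> x k x' k'; rewrite !mD => a le le'; apply: (stable_le sla a).
Qed.

Definition convex A b : bool := let: (z, (k, x)) := b in
  [&& ext A z k x, ~~ ext A z (k%:Z + 1) x & ~~ ext A z k (x%:Z + 1)].

Definition concave A b : bool := let: (z, (k, x)) := b in
  [&& ~~ ext A z k x, ext A z (k%:Z - 1) x & ext A z k (x%:Z - 1)].

Lemma ext_nat A z (k x : nat) : ext A z k x = A (z, (k, x)).
Proof. by rewrite /ext !ltz_nat !ltn0 !absz_nat. Qed.

Lemma ext_step A z y x : stable A ->
  (ext A z (y + 1) x -> ext A z y x) /\ (ext A z y (x + 1) -> ext A z y x).
Proof.
move=> sA; case: y => [k|k]; last by [].
case: x => [x|x]; last by rewrite /ext !orbT.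
rewrite ext_nat -!PoszD !addn1 !ext_nat; exact: sA.
Qed.

Lemma ext_step' A z y x : stable A ->
  (ext A z y x -> ext A z (y - 1) x) /\ (ext A z y x -> ext A z y (x - 1)).
Proof.
move=> sA; split.
  by have := (ext_step z (y - 1) x sA).1; rewrite subrK.
by have := (ext_step z y (x - 1) sA).2; rewrite subrK.
Qed.

Lemma convexE A z k x : convex A (z, (k, x)) =
  [&& A (z, (k, x)), ~~ A (z, (k.+1, x)) & ~~ A (z, (k, x.+1))].
Proof. by rewrite /convex -!PoszD !addn1 !ext_nat. Qed.

Lemma concaveE A z k x : concave A (z, (k, x)) =
  [&& ~~ A (z, (k, x)), (k == 0)%N || A (z, (k.-1, x))
    & (x == 0)%N || A (z, (k, x.-1))].
Proof.
rewrite /concave ext_nat; congr [&& _, _ & _].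
  case: k => [//|k]; have -> : k.+1%:Z - 1 = k by lia.
  by rewrite ext_nat.
case: x => [|x]; first by rewrite /ext orbT.
by have -> : x.+1%:Z - 1 = x by lia; rewrite ext_nat.
Qed.

Lemma eq_concave A B : A =1 B -> concave A =1 concave B.
Proof. by move=> e [z [k x]]; rewrite !concaveE !e. Qed.

Lemma convexP A b : stable A -> A b ->
  reflect (stable [pred x | A x & x != b]) (convex A b).
Proof.
case: b => z [k x] sA a; rewrite convexE a /=.
apply: (iffP andP) => [[n1 n2] z' k' x'|sb].
  split=> /= /andP[h _].
    rewrite (sA _ _ _).1 //=; apply: contraTneq h => -[-> -> ->]; exact: n1.
  rewrite (sA _ _ _).2 //=; apply: contraTneq h => -[-> -> ->]; exact: n2.
split; apply/negP => h.
  have ne : (z, (k.+1, x)) != (z, (k, x)) :> G0_box by apply/eqP => -[]; lia.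
  by have := (sb z k x).1; rewrite /= h eqxx andbF => /(_ ne).
have ne : (z, (k, x.+1)) != (z, (k, x)) :> G0_box by apply/eqP => -[]; lia.
by have := (sb z k x).2; rewrite /= h eqxx andbF => /(_ ne).
Qed.

Lemma concaveP A b : stable A -> ~~ A b ->
  reflect (stable [pred x | (x == b) || A x]) (concave A b).
Proof.
case: b => z [k x] sA a; rewrite concaveE a /=.
apply: (iffP andP) => [[n1 n2] z' k' x'|sb].
  split=> /= /orP[/eqP[e1 e2 e3]|h].
  - by move: n1; rewrite -e1 -e2 -e3 /= => ->; rewrite orbT.
  - by rewrite (sA _ _ _).1 ?orbT.
  - by move: n2; rewrite -e1 -e2 -e3 /= => ->; rewrite orbT.
  - by rewrite (sA _ _ _).2 ?orbT.
split.
  case: k a sb => [//|k] a sb; have := (sb z k x).1; rewrite /= eqxx /=.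
  by case/(_ isT)/orP => // /eqP[]; lia.
case: x a sb => [//|x] a sb; have := (sb z k x).2; rewrite /= eqxx /=.
by case/(_ isT)/orP => // /eqP[]; lia.
Qed.

Lemma convex_mem A b : convex A b -> A b.
Proof. by case: b => z [k x]; rewrite convexE => /andP[]. Qed.

Lemma concave_notin A b : concave A b -> ~~ A b.
Proof. by case: b => z [k x]; rewrite concaveE => /andP[]. Qed.

(** Stability leaves few patterns of the seven values of the extended indicator
    function around a point, and the claim is checked on each of them. *)
Lemma phiorder_boundary s P : stable (mem s) -> uniq s ->
  -1 <= phiorder s (lcolor P) P /\
  (phiorder s (lcolor P) P = -1 <->
   exists2 b, lbox b = P & convex (mem s) b || concave (mem s) b).
Proof.
case: P => z [y x] st us; rewrite phiorder_ext // /order_at.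
set e := ext _ z.
have [/implyP a1 /implyP a2] : (e (y + 1) x -> e y x) /\ (e y (x + 1) -> e y x).
  exact: ext_step.
have [/implyP b1 /implyP b2] : (e y x -> e (y - 1) x) /\ (e y x -> e y (x - 1)).
  exact: ext_step'.
have /implyP c1 := (ext_step z y (x + 1) st).1.
have /implyP c2 := (ext_step z (y + 1) x st).2.
have /implyP d1 := (ext_step' z y (x - 1) st).1.
have /implyP d2 := (ext_step' z (y - 1) x st).2.
rewrite -/e in c1 c2 d1 d2.
have -> : (exists2 b, lbox b = (z, (y, x)) & convex (mem s) b || concave (mem s) b)
  <-> [&& e y x, ~~ e (y + 1) x & ~~ e y (x + 1)] ||
      [&& ~~ e y x, e (y - 1) x & e y (x - 1)].
  split=> [[[z' [k' x']]] /= [ez <- <-]|h]; first by rewrite ez.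
  have [y0 x0] : 0 <= y /\ 0 <= x.
    case/orP: h => /and3P[h1 h2 h3].
      by move: h2 h3; rewrite /e /ext !negb_or => /and3P[_ ? _] /and3P[? _ _]; lia.
    by move: h1; rewrite /e /ext !negb_or => /and3P[? ? _]; lia.
  by case: y x y0 x0 h {a1 a2 b1 b2 c1 c2 d1 d2} => // k [] // x _ _ h;
    exists (z, (k, x)).
set B := _ || _; set t := _ - _.
suff /andP[-> /eqP <-] : (-1 <= t) && ((t == -1) == B) by split=> //; exact: rwP eqP.
rewrite /B /t {B t}; move: a1 a2 b1 b2 c1 c2 d1 d2.
move: (e y x) (e (y + 1) x) (e y (x + 1)) (e (y - 1) x) (e y (x - 1))
  (e (y - 1) (x - 1)) (e (y + 1) (x + 1)); clear.
by do 7 case => //=.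
Qed.

(** ** The order of boxes *)

Lemma box_ltE z k x z' k' x' :
  (((z, (k, x)) : G0_box) < (z', (k', x')))%O =
  [|| (z < z')%N, (z == z') && (k < k')%N | [&& z == z', k == k' & (x < x')%N]].
Proof.
rewrite !ltEprodlexi /= !leEnat ltEnat /= !leEbool.
by case: z z' => [] [] //=; lia.
Qed.

Definition below A b := [pred x : G0_box | A x & (x < b)%O].

(** The total order refines the componentwise order within a family of boxes. *)
Lemma below_stable A b : stable A -> stable (below A b).
Proof.
move=> sA z k x; split=> /= /andP[h lt].
  rewrite (sA _ _ _).1 //=; apply: lt_trans lt.
  by rewrite box_ltE eqxx ltnS leqnn orbT.
rewrite (sA _ _ _).2 //=; apply: lt_trans lt.
by rewrite box_ltE !eqxx ltnS leqnn !orbT.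
Qed.

Lemma below_concave A b : stable A -> A b || concave A b ->
  concave (below A b) b.
Proof.
case: b => z [k x] sA h; rewrite concaveE /= ltxx andbF /=.
have {h} : ((k == 0)%N || A (z, (k.-1, x))) && ((x == 0)%N || A (z, (k, x.-1))).
  case/orP: h => [a|]; last by rewrite concaveE => /and3P[_ -> ->].
  by rewrite !(stable_le sA a) ?leq_pred ?orbT.
by case: k => [|k]; case: x => [|x] //=; rewrite !box_ltE !eqxx ?ltnS ?leqnn
  ?orbT ?andbT.
Qed.

Definition boxorder b i P : int := lorder (Azeros b i) (Apoles b i) P.

Lemma phiorder_sum s i P :
  phiorder s i P = phiorder [::] i P + \sum_(b <- s) boxorder b i P.
Proof.
rewrite /phiorder /lorder !count_cat /=.
have -> : \sum_(b <- s) boxorder b i P =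
    (count_mem P (flatten [seq Azeros b i | b <- s]))%:Z
    - (count_mem P (flatten [seq Apoles b i | b <- s]))%:Z.
  elim: s => [|b s ih]; first by rewrite big_nil.
  rewrite big_cons ih /= !count_cat /boxorder /lorder.
  by rewrite !PoszD; ring.
by rewrite !PoszD; ring.
Qed.

Lemma phiorder_below s b : stable (mem s) -> uniq s -> 
  b \in s \/ concave (mem s) b ->
  phiorder [seq x <- s | (x < b)%O] (G0_color b) (lbox b) = -1.
Proof.
move=> st us h; set t := filter _ _.
have et : below (mem s) b =1 mem t.
  by move=> x; rewrite /t /= mem_filter andbC.
have sbt : stable (mem t) by apply: eq_stable et _; apply: below_stable.
rewrite -lcolor_box; apply/(phiorder_boundary _ sbt _).2.
  exact: filter_uniq.
exists b => //; rewrite -(eq_concave et) below_concave ?orbT //.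
by case: h => [h|->]; [rewrite /= h | rewrite orbT].
Qed.

(** Adding all boxes above b does not change the order at b, which is -1 with and
    without them. *)
Lemma above_order0 s b : stable (mem s) -> uniq s -> concave (mem s) b ->
  \sum_(x <- s | (b < x)%O) boxorder x (G0_color b) (lbox b) = 0.
Proof.
move=> st us cb.
have : phiorder s (G0_color b) (lbox b) = -1.
  rewrite -lcolor_box; apply/(phiorder_boundary _ st us).2.
  by exists b; rewrite ?cb ?orbT.
have := phiorder_below st us (or_intror cb).
rewrite phiorder_sum [phiorder s _ _]phiorder_sum big_filter => e1.
rewrite (bigID (fun x => x < b)%O) /= addrA e1 => e2.
have e3 : \sum_(x <- s | ~~ (x < b)%O) boxorder x (G0_color b) (lbox b) = 0.
  by apply: (@addrI _ (-1)); rewrite addr0.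
rewrite -[RHS]e3 [LHS]big_seq_cond [RHS]big_seq_cond; apply: eq_bigl => x.
case xs: (x \in s) => //=; rewrite -leNgt lt_neqAle; case: eqP => // e.
by have := concave_notin cb; rewrite /= e xs.
Qed.

(** ** Removing several boxes *)

(** These are the vanishing conditions of the structure functions: see
    gbox_eq0. A box can only be removed after those that cover it. *)
Definition covers b b' : bool :=
  (lbox b' == lshift (lbox b) 1 0) || (lbox b' == lshift (lbox b) 0 1).

Definition covers2 b b' : bool := lbox b' == lshift (lbox b) 1 1.

Lemma coversE z k x z' k' x' : covers (z, (k, x)) (z', (k', x')) =
  (z' == z) && ((k' == k.+1) && (x' == x) || (k' == k) && (x' == x.+1)).
Proof. by rewrite /covers /lshift !xpair_eqE /=; case: (z' == z) => //=; lia. Qed.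

Lemma covers2E z k x z' k' x' : covers2 (z, (k, x)) (z', (k', x')) =
  [&& z' == z, k' == k.+1 & x' == x.+1].
Proof. by rewrite /covers2 /lshift !xpair_eqE /=; case: (z' == z) => //=; lia. Qed.

Lemma covers_irr b : ~~ (covers b b || covers2 b b).
Proof. by case: b => z [k x]; rewrite coversE covers2E; lia. Qed.

Lemma covers_asym b b' : covers b b' || covers2 b' b -> ~~ (covers b' b || covers2 b b').
Proof.
case: b b' => z [k x] [z' [k' x']]; rewrite !coversE !covers2E.
by case: z z' => [] [] //=; lia.
Qed.

Lemma convex_not_covers A b b' : convex A b -> A b' -> ~~ covers b b'.
Proof.
case: b b' => z [k x] [z' [k' x']]; rewrite convexE => /and3P[_ n1 n2] a.
apply/negP; rewrite coversE => /andP[/eqP e /orP[]/andP[/eqP e1 /eqP e2]]; subst.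
  by case/negP: n1.
by case/negP: n2.
Qed.

Lemma convex_not_covers2 A b b' : stable A -> convex A b -> A b' -> ~~ covers2 b b'.
Proof.
case: b b' => z [k x] [z' [k' x']] sA; rewrite convexE => /and3P[_ n1 n2] a.
apply/negP; rewrite covers2E => /and3P[/eqP e1 /eqP e2 /eqP e3]; subst.
by case/negP: n1; apply: (stable_le sA a).
Qed.

Lemma not_convex_covers A b : A b -> ~~ convex A b -> exists2 b', A b' & covers b b'.
Proof.
case: b => z [k x] a; rewrite convexE a /= negb_and !negbK => /orP[h|h].
  by exists (z, (k.+1, x)) => //; rewrite coversE !eqxx.
by exists (z, (k, x.+1)) => //; rewrite coversE !eqxx orbT.
Qed.

Lemma stable_covers A b b' : stable A -> A b' -> covers b b' -> A b.
Proof.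
case: b b' => z [k x] [z' [k' x']] sA a.
rewrite coversE => /andP[/eqP e /orP[]/andP[/eqP e1 /eqP e2]]; subst;
  by apply: (stable_le sA a).
Qed.

(** Diagonal neighbours cannot be removed together without the two boxes between
    them, which have the same two colours; a set of removed boxes that has only
    one box of a colour therefore contains no diagonal neighbours. *)
Lemma covers2_between A s b b' : stable A -> {subset s <= A} ->
  stable [pred x | A x & x \notin s] -> b \in s -> b' \in s -> covers2 b b' ->
  exists c c', [/\ c \in s, c' \in s, G0_color c = G0_color b,
    G0_color c' = G0_color b' & (c != b) && (c' != b')].
Proof.
case: b b' => z [k x] [z' [k' x']] sA ss st bs b's.
rewrite covers2E => /and3P[/eqP e1 /eqP e2 /eqP e3]; subst z' k' x'.
have a : A (z, (k.+1, x.+1)) by exact: ss.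
exists (z, (k.+1, x)), (z, (k, x.+1)); split=> //.
- apply/negPn/negP => h; have := (st z k x).1; rewrite /= bs h andbF andbT.
  by rewrite (stable_le sA a) // => /(_ isT).
- apply/negPn/negP => h; have := (st z k x).2; rewrite /= bs h andbF andbT.
  by rewrite (stable_le sA a) // => /(_ isT).
- by apply/andP; split; apply/eqP => -[]; lia.
Qed.

Lemma covers2_color b b' : covers2 b b' -> G0_color b' = G0_color b + 1.
Proof. by move=> /eqP e; rewrite -lcolor_box e lcolor_shift lcolor_box. Qed.

End States.

(** * Removing boxes one by one *)

(** The coefficients gam and M are arbitrary, since the same computation serves
    to remove boxes with the coefficients of E and to add them with those of F. *)
Section Removal.
Variables (C : fieldType) (gam : G0_box -> C) (M : G0_box -> G0_box -> C).
Hypothesis M_neq0 : forall x y, M x y != 0.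
Implicit Types x y b : G0_box.
Implicit Types (la : {fset G0_box}) (s : seq G0_box).

Definition weight la b : C := gam b * \prod_(x <- (la `\ b)%fset) M x b.

Definition rweight la b : C := if convex (mem la) b then weight la b else 0.

Fixpoint word la s : C :=
  if s is b :: s' then rweight la b * word (la `\ b)%fset s' else 1.

(** The pair x, y with x removed first: x is missing when y is weighed, which
    divides by M x y; the order is inadmissible if y covers x. *)
Definition tfac x y : C := if covers x y then 0 else (M x y)^-1.

Fixpoint pairs s : C :=
  if s is b :: s' then \prod_(y <- s') tfac b y * pairs s' else 1.

Lemma fset_rem_mem la b : mem (la `\ b)%fset =1 [pred x | mem la x & x != b].
Proof. by move=> x; rewrite /= in_fsetD1 andbC. Qed.

Lemma weight_rem la x b : x \in la -> x != b ->
  weight (la `\ x)%fset b = weight la b / M x b.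
Proof.
move=> xla xb; have e : ((la `\ x) `\ b = (la `\ b) `\ x)%fset.
  by apply/fsetP => z; rewrite !inE andbCA.
rewrite /weight e [in RHS](big_fsetD1 x) /=; last by rewrite !inE xb.
by rewrite -mulrA [M x b * _]mulrC mulfK.
Qed.

Lemma stable_rem la b : stable (mem la) -> convex (mem la) b ->
  stable (mem (la `\ b)%fset).
Proof.
move=> st cb; apply: (eq_stable (fun x => esym (fset_rem_mem la b x))).
by apply/convexP => //; apply: convex_mem.
Qed.

(** Removing b divides the weight of every other box y by M b y. If b is not
    removable at its turn, a box that covers it is removed later, and the factor
    of that pair is 0. *)
Lemma wordE la s : uniq s -> {subset s <= la} -> stable (mem la) ->
  stable [pred x | (x \in la) && (x \notin s)] ->
  word la s = \prod_(y <- s) weight la y * pairs s.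
Proof.
elim: s la => [|b s ih] la /=; first by rewrite big_nil mulr1.
case/andP=> bs us sub st sts; have bla : b \in la by apply: sub; rewrite inE eqxx.
have subs y : y \in s -> y \in la by move=> ys; apply: sub; rewrite inE ys orbT.
rewrite /rweight; case: ifPn => [cb|ncb].
  have st' := stable_rem st cb; rewrite ih //; last first.
  - apply: eq_stable sts => x /=; rewrite !inE negb_or; case: (x \in la); rewrite ?andbF //=.
    by rewrite andbT.
  - by move=> y ys; rewrite in_fsetD1 subs // andbT; apply: contraNneq bs => <-.
  rewrite big_cons; set w := weight la b.
  suff -> : \prod_(y <- s) weight (la `\ b)%fset y =
      \prod_(y <- s) weight la y * \prod_(y <- s) tfac b y by ring.
  rewrite -big_split; apply: eq_big_seq => y ys /=.
  rewrite weight_rem //; last by apply: contraNneq bs => ->.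
  by rewrite /tfac (negbTE (convex_not_covers cb (subs _ ys))).
have [y yla cby] := not_convex_covers bla ncb.
have ys : y \in s.
  apply/negPn/negP => yns; have yb : y != b.
    by apply: contraTneq cby => ->; have := covers_irr b; rewrite negb_or => /andP[].
  have sy : [pred x | (x \in la) && (x \notin b :: s)] y.
    by rewrite /= inE negb_or yb yns !andbT; exact: yla.
  by have := stable_covers sts sy cby; rewrite /= inE eqxx andbF.
rewrite (big_rem y ys (F := fun y => tfac b y)) /= /tfac cby.
by rewrite !mul0r mulr0.
Qed.

Lemma word_eq0 la s : stable (mem la) -> word la s != 0 ->
  [/\ uniq s, {subset s <= la} & stable [pred x | (x \in la) && (x \notin s)]].
Proof.
elim: s la => [|b s ih] la st /=.
  by move=> _; split=> //; apply: eq_stable st => x; rewrite /= andbT.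
rewrite mulf_eq0 negb_or /rweight; case: ifP => [cb|]; last by rewrite eqxx.
case/andP=> _ /(ih _ (stable_rem st cb))[us sub sts].
have bla : b \in la := convex_mem cb.
split.
- by rewrite us andbT; apply/negP => /sub; rewrite in_fsetD1 eqxx.
- by move=> x; rewrite inE => /orP[/eqP -> //|/sub]; rewrite in_fsetD1 => /andP[].
- apply: eq_stable sts => x /=; rewrite !inE negb_or; case: (x \in la); rewrite ?andbF //=.
  by rewrite andbT.
Qed.

End Removal.

(** * Weights of boxes *)

Section Weights.
Variables (C : fieldType) (q1 q2 q3 u : C).
Hypothesis hq : q1 * q2 * q3 = 1.
Hypothesis u0 : u != 0.
Implicit Types (b x y : G0_box) (P : lattice) (i j : 'Z_2).

Definition lpos P : C :=
  (if P.1 then q3^-1 else u) * q1 ^ (- P.2.2) * q2 ^ (- P.2.1).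

Hypothesis lpos_inj : injective lpos.

Definition bpos b : C := lpos (lbox b).

(** The structure functions g and the signs of the relations. *)
Definition gval i j (a b : C) : C :=
  if i == j then a - q2 * b else (a - q1 * b) * (a - q3 * b).

Definition sign i j : C := if i == j then 1 else -1.

Lemma q1_neq0 : q1 != 0.
Proof.
by have := oner_neq0 C; rewrite -hq; apply: contraNneq => ->; rewrite !mul0r.
Qed.
Lemma q2_neq0 : q2 != 0.
Proof.
by have := oner_neq0 C; rewrite -hq; apply: contraNneq => ->; rewrite mulr0 mul0r.
Qed.
Lemma q3_neq0 : q3 != 0.
Proof.
by have := oner_neq0 C; rewrite -hq; apply: contraNneq => ->; rewrite mulr0.
Qed.

Lemma lpos_neq0 P : lpos P != 0.
Proof.
rewrite /lpos !mulf_neq0 ?expfz_neq0 ?q1_neq0 ?q2_neq0 //.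
by case: P.1; rewrite ?invr_neq0 ?q3_neq0.
Qed.

Lemma bpos_neq0 b : bpos b != 0. Proof. exact: lpos_neq0. Qed.

Lemma bpos_inj : injective bpos.
Proof. by move=> x y /lpos_inj/lbox_inj. Qed.

Lemma lpos_shift P dy dx :
  lpos (lshift P dy dx) = lpos P * q1 ^ (- dx) * q2 ^ (- dy).
Proof.
rewrite /lpos /= !opprD !expfzDr ?q1_neq0 ?q2_neq0 //; ring.
Qed.

Lemma q3E : q3 = q1^-1 * q2^-1.
Proof.
apply: (mulfI (x := q1 * q2)); first by rewrite mulf_neq0 ?q1_neq0 ?q2_neq0.
by rewrite hq; field; rewrite q1_neq0 q2_neq0.
Qed.

Lemma q3VE : q3^-1 = q1 * q2.
Proof. by rewrite q3E invfM !invrK. Qed.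

(** ** The factors of the l-weights *)

Definition Afact b i : factored C :=
  Factored (if i == G0_color b then q2^-1 else (q1 * q3)^-1)
    (map lpos (Azeros b i)) (map lpos (Apoles b i)).

Lemma Afact_same b : Afact b (G0_color b) =
  Factored q2^-1 [:: q2 * bpos b] [:: q2^-1 * bpos b].
Proof.
rewrite /Afact /Azeros /Apoles eqxx /= !lpos_shift -!/(bpos b).
by rewrite !oppr0 opprK expr0z !mulr1 expr1z exprN1 ![bpos b * _]mulrC.
Qed.

Lemma Afact_diff b i : i != G0_color b -> Afact b i =
  Factored (q1 * q3)^-1 [:: q1 * bpos b; q3 * bpos b]
    [:: q1^-1 * bpos b; q3^-1 * bpos b].
Proof.
move=> /negbTE n; rewrite /Afact /Azeros /Apoles n /= !lpos_shift -!/(bpos b).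
rewrite !oppr0 !opprK !expr0z !mulr1 !expr1z !exprN1 q3VE q3E.
by congr Factored; do ?congr cons; ring.
Qed.

Definition ell x b : C := flead (Afact x (G0_color b)) (bpos b).

Lemma Afact_scal_neq0 b i : fscal (Afact b i) != 0.
Proof. by rewrite /=; case: (i == _); rewrite invr_eq0 ?mulf_neq0 ?q1_neq0 ?q2_neq0 ?q3_neq0. Qed.

Lemma ell_neq0 x b : ell x b != 0.
Proof. by rewrite flead_neq0 // Afact_scal_neq0. Qed.

Definition gbox x y : C := gval (G0_color x) (G0_color y) (bpos x) (bpos y).
Definition sbox x y : C := sign (G0_color x) (G0_color y).

Lemma sboxC x y : sbox x y = sbox y x.
Proof. by rewrite /sbox /sign eq_sym. Qed.

Lemma sbox2 x y : sbox x y * sbox x y = 1.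
Proof. by rewrite /sbox /sign; case: eqP => _; ring. Qed.

Lemma diffprod_cons (p x : C) s : p != x -> diffprod p (x :: s) = (p - x) * diffprod p s.
Proof. by move=> n; rewrite /diffprod big_cons eq_sym n. Qed.

Lemma diffprod_nil (p : C) : diffprod p [::] = 1.
Proof. by rewrite /diffprod big_nil. Qed.

(** The factor A_x^-1 at b is a quotient of structure functions. *)
Lemma ellE x b : gbox b x != 0 -> gbox x b != 0 ->
  ell x b = - sbox x b * gbox b x / gbox x b.
Proof.
have n1 := q1_neq0; have n2 := q2_neq0; have n3 := q3_neq0.
rewrite /gbox /gval /sbox /sign /ell [G0_color b == _]eq_sym.
case: (eqVneq (G0_color x) (G0_color b)) => [e|n].
  rewrite -e Afact_same /flead /=; set p := bpos b; set r := bpos x => a c.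
  have a' : p != q2 * r by rewrite -subr_eq0.
  have c' : p != q2^-1 * r.
    by apply: contraNneq c => ->; rewrite mulrA divff // mul1r subrr.
  have c'' : p * q2 - r != 0 by rewrite mulrC -opprB oppr_eq0.
  rewrite !diffprod_cons // !diffprod_nil; by field; rewrite c n2 c''.
rewrite Afact_diff; last by rewrite eq_sym.
rewrite /flead /=; set p := bpos b; set r := bpos x.
rewrite !mulf_eq0 !negb_or => /andP[a1 a3] /andP[c1 c3].
have a1' : p != q1 * r by rewrite -subr_eq0.
have a3' : p != q3 * r by rewrite -subr_eq0.
have c1' : p != q1^-1 * r.
  by apply: contraNneq c1 => ->; rewrite mulrA divff // mul1r subrr.
have c3' : p != q3^-1 * r.
  by apply: contraNneq c3 => ->; rewrite mulrA divff // mul1r subrr.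
have c1'' : p * q1 - r != 0 by rewrite mulrC -opprB oppr_eq0.
have c3'' : p * q3 - r != 0 by rewrite mulrC -opprB oppr_eq0.
rewrite !diffprod_cons // !diffprod_nil; field.
by rewrite ?n1 ?n3 ?c1 ?c3 ?c1'' ?c3''.
Qed.

(** By injectivity g vanishes exactly when the positions differ by the factor q2
    (equal colours), or q1 or q3 (different colours); the parity of the steps
    excludes the other cases on the right. *)
Lemma gbox_eq0 x y : (gbox x y == 0) = covers x y || covers2 y x.
Proof.
rewrite /gbox /gval; have eqp dy dx c : c * bpos y = lpos (lshift (lbox y) dy dx) ->
    (bpos x - c * bpos y == 0) = (lbox x == lshift (lbox y) dy dx).
  by move=> ->; rewrite subr_eq0 (inj_eq lpos_inj).
have e1 : (bpos x - q1 * bpos y == 0) = (lbox x == lshift (lbox y) 0 (-1)).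
  by apply: eqp; rewrite lpos_shift opprK oppr0 expr0z mulr1 expr1z mulrC.
have e2 : (bpos x - q2 * bpos y == 0) = (lbox x == lshift (lbox y) (-1) 0).
  by apply: eqp; rewrite lpos_shift opprK oppr0 expr0z mulr1 expr1z mulrC.
have e3 : (bpos x - q3 * bpos y == 0) = (lbox x == lshift (lbox y) 1 1).
  by apply: eqp; rewrite lpos_shift !exprN1 q3E -/(bpos y); ring.
have neq dy dx : odd `|dx|%N != (G0_color y != G0_color x) ->
    (lbox y == lshift (lbox x) dy dx) = false.
  apply: contraNF => /eqP e; rewrite -[G0_color y]lcolor_box e lcolor_shift lcolor_box.
  by case: (odd _); rewrite ?Z2_add1_neq ?addr0 ?eqxx.
rewrite /covers /covers2.
have e4 : (lbox x == lshift (lbox y) 1 1) = (lbox y == lshift (lbox x) (-1) (-1)).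
  by rewrite eq_sym lshift_eq.
rewrite e4; have [e|n] := eqVneq (G0_color x) (G0_color y).
  rewrite e2 [lbox x == _]eq_sym lshift_eq opprK oppr0.
  by rewrite [_ == lshift _ 0 1]neq ?[_ == lshift _ (-1) _]neq ?e ?eqxx ?orbF.
have n' : G0_color y != G0_color x by rewrite eq_sym.
rewrite mulf_eq0 e1 e3 e4 [_ == lshift _ 1 0]neq ?n' //=.
by rewrite [lbox x == _]eq_sym lshift_eq opprK oppr0.
Qed.

Lemma gbox_self x : gbox x x != 0.
Proof.
by rewrite gbox_eq0; apply: covers_irr.
Qed.

Lemma gbox_neq0 x y : (gbox x y != 0) || (gbox y x != 0).
Proof.
rewrite !gbox_eq0 -negb_and; apply/negP => /andP[/covers_asym] /negP; exact.
Qed.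

Lemma ell_self x : ell x x = -1.
Proof.
rewrite ellE ?gbox_self // /sbox /sign eqxx mulN1r.
by rewrite mulNr divff ?gbox_self.
Qed.

(** ** Exchange of two removals *)

Section Exchange.
Variables (gam : G0_box -> C) (M : G0_box -> G0_box -> C).
Hypothesis M_neq0 : forall x y, M x y != 0.
Hypothesis M_exchange : forall x y, x != y -> gbox x y != 0 -> gbox y x != 0 ->
  M y x * gbox y x = - sbox x y * gbox x y * M x y.
Implicit Types (la : {fset G0_box}).

Local Notation word := (word gam M).
Local Notation weight := (weight gam M).
Local Notation tfac := (tfac M).

(** Where a structure function vanishes, so does the factor of the order that is
    not admissible. *)
Lemma tfac_exchange x y : x != y -> ~~ covers2 x y -> ~~ covers2 y x ->
  sbox x y * gbox x y * tfac y x + gbox y x * tfac x y = 0.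
Proof.
move=> xy n1 n2; rewrite /tfac.
have h1 := gbox_eq0 x y; have h2 := gbox_eq0 y x.
rewrite (negbTE n1) orbF in h2; rewrite (negbTE n2) orbF in h1.
case: ifP h2 => [cyx /eqP e2|cyx /negbT g2].
  by rewrite e2 mulr0 mul0r addr0.
case: ifP h1 => [cxy /eqP e1|cxy /negbT g1].
  by rewrite e1 !mulr0 mul0r addr0.
have := M_exchange xy g1 g2; have m1 := M_neq0 x y; have m2 := M_neq0 y x => e.
apply: (mulfI (x := M x y * M y x)); first by rewrite mulf_neq0.
rewrite mulr0; transitivity (sbox x y * gbox x y * M x y + M y x * gbox y x).
  by field; rewrite m1 m2.
by rewrite e; ring.
Qed.

(** Two boxes whose removal leaves a state are not diagonal neighbours, since the
    two boxes between those would have to be removed as well. *)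
Lemma word_quadratic la x y : stable (mem la) -> 
  sbox x y * gbox x y * word la [:: y; x] + gbox y x * word la [:: x; y] = 0.
Proof.
move=> st.
have key : uniq [:: x; y] -> {subset [:: x; y] <= la} ->
    stable [pred z | (z \in la) && (z \notin [:: x; y])] ->
    sbox x y * gbox x y * word la [:: y; x] + gbox y x * word la [:: x; y] = 0.
  move=> u1 s1 st1; have xy : x != y by move: u1; rewrite /= inE andbT.
  have xla : x \in la by apply: s1; rewrite !inE eqxx.
  have yla : y \in la by apply: s1; rewrite !inE eqxx orbT.
  have nc a b : a \in [:: x; y] -> b \in [:: x; y] -> ~~ covers2 a b.
    move=> ha hb; apply/negP => c2.
    have [c [c' [cs c's e1 e2 /andP[ca c'b]]]] := covers2_between st s1 st1 ha hb c2.
    have ab : G0_color b != G0_color a by rewrite (covers2_color c2) Z2_add1_neq.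
    have cb : c = b.
      apply/eqP; move: ca ha hb cs ab; rewrite !inE.
      by move=> ca /orP[]/eqP ea /orP[]/eqP eb /orP[]/eqP ec; subst;
        rewrite ?eqxx // in ca *.
    by rewrite -e1 cb eqxx in ab.
  rewrite !(wordE gam M_neq0) //.
  - rewrite /= !big_cons !big_nil !mulr1.
    have := tfac_exchange xy (nc _ _ _ _) (nc _ _ _ _); rewrite !inE !eqxx orbT => /(_ isT isT isT isT) e.
    transitivity (weight la x * weight la y *
      (sbox x y * gbox x y * tfac y x + gbox y x * tfac x y)); first ring.
    by rewrite e mulr0.
  - by move: u1; rewrite /= !inE !andbT eq_sym.
  - by move=> z; rewrite !inE orbC -in_fset2 => h; apply: s1; move: h; rewrite !inE.
  - by apply: eq_stable st1 => z; rewrite /= !inE orbC.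
have [w1|/(word_eq0 st)[u1 s1 st1]] := eqVneq (word la [:: y; x]) 0.
  have [w2|/(word_eq0 st)[u1 s1 st1]] := eqVneq (word la [:: x; y]) 0.
    by rewrite w1 w2 !mulr0 addr0.
  exact: key.
apply: key.
- by move: u1; rewrite /= !inE !andbT eq_sym.
- by move=> z h; apply: s1; move: h; rewrite !inE orbC.
- by apply: eq_stable st1 => z; rewrite /= !inE orbC.
Qed.

End Exchange.

End Weights.

(** * The Serre relations *)

Section SerreIdentity.
Variable C : fieldType.

(** The pairs of a word of four letters. *)
Definition pairprod (T : nat -> nat -> C) (a b c d : nat) : C :=
  T a b * T a c * T a d * T b c * T b d * T c d.

(** The coefficients of the iterated commutator, for the letter 0 of colour i + 1
    and a, b, c of colour i; the words list the removals in the order in which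
    the operators act. *)
Definition serre_word (q2 : C) (W : nat -> nat -> nat -> nat -> C) (a b c : nat) : C :=
  W 0%N c b a - q2 * W c 0%N b a - W b 0%N c a + q2 * W b c 0%N a
  - q2^-1 * (W a 0%N c b - q2 * W a c 0%N b - W a b 0%N c + q2 * W a b c 0%N).

Definition sum_perm3 (V : zmodType) (f : nat -> nat -> nat -> V) : V :=
  f 1%N 2%N 3%N + f 1%N 3%N 2%N + f 2%N 1%N 3%N + f 2%N 3%N 1%N
  + f 3%N 1%N 2%N + f 3%N 2%N 1%N.

(** The Serre combination for the weights g(a, b), cleared of denominators, with
    s = q1 + q3 and t = q1 q3 = 1 / q2. The weight of the letter 0 and another
    one is u or v, according to their order, and Wk collects the words in which
    k letters come after 0. *)
Lemma serre_polynomial (t s w x1 x2 x3 : C) :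
  let u x := w ^+ 2 - s * w * x + t * x ^+ 2 in
  let v x := x ^+ 2 - s * x * w + t * w ^+ 2 in
  let g a b := t * a - b in
  let G a b c := g a b * g a c * g b c in
  let W3 a b c := G a b c * (u a * u b * u c) in
  let W2 a b c := G a b c * (v a * u b * u c) in
  let W1 a b c := G a b c * (v a * v b * u c) in
  let W0 a b c := G a b c * (v a * v b * v c) in
  let S a b c := t * W3 a b c - (1 + t + t ^+ 2) * W2 a b c 
     + (1 + t + t ^+ 2) * W1 a b c - t * W0 a b c in
  S x1 x2 x3 - S x1 x3 x2 - S x2 x1 x3 + S x2 x3 x1 + S x3 x1 x2 - S x3 x2 x1 = 0.
Proof. move=> u v g G W3 W2 W1 W0 S; rewrite /S /W0 /W1 /W2 /W3 /G /g /u /v. ring. Qed.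

(** Each pair enters every word exactly once, in one of its two orders, so the
    proportionality factors k come out of the sum. *)
Lemma serre_weights (q1 q2 q3 x1 x2 x3 w k12 k13 k23 k1 k2 k3 : C)
    (T : nat -> nat -> C) : q1 * q2 * q3 = 1 -> q2 != 0 ->
  T 1%N 2%N = k12 * (x1 - q2 * x2) -> T 2%N 1%N = - k12 * (x2 - q2 * x1) ->
  T 1%N 3%N = k13 * (x1 - q2 * x3) -> T 3%N 1%N = - k13 * (x3 - q2 * x1) ->
  T 2%N 3%N = k23 * (x2 - q2 * x3) -> T 3%N 2%N = - k23 * (x3 - q2 * x2) ->
  T 0%N 1%N = k1 * ((w - q1 * x1) * (w - q3 * x1)) ->
  T 1%N 0%N = k1 * ((x1 - q1 * w) * (x1 - q3 * w)) ->
  T 0%N 2%N = k2 * ((w - q1 * x2) * (w - q3 * x2)) ->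
  T 2%N 0%N = k2 * ((x2 - q1 * w) * (x2 - q3 * w)) ->
  T 0%N 3%N = k3 * ((w - q1 * x3) * (w - q3 * x3)) ->
  T 3%N 0%N = k3 * ((x3 - q1 * w) * (x3 - q3 * w)) ->
  sum_perm3 (serre_word q2 (pairprod T)) = 0.
Proof.
move=> hq q20 e12 e21 e13 e31 e23 e32 e01 e10 e02 e20 e03 e30.
pose t := q1 * q3; pose s := q1 + q3.
have t0 : t != 0.
  by apply: contraNneq (oner_neq0 C) => e; rewrite -hq mulrAC -/t e mul0r.
have q2t : q2 = t^-1 by apply: (mulIf t0); rewrite mulVf // -hq /t; ring.
have gt a b : a - q2 * b = q2 * (t * a - b) by rewrite q2t; field.
have ut a : (w - q1 * a) * (w - q3 * a) = w ^+ 2 - s * w * a + t * a ^+ 2.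
  by rewrite /s /t; ring.
have vt a : (a - q1 * w) * (a - q3 * w) = a ^+ 2 - s * a * w + t * w ^+ 2.
  by rewrite /s /t; ring.
have := serre_polynomial t s w x1 x2 x3.
rewrite /sum_perm3 /serre_word /pairprod e12 e21 e13 e31 e23 e32.
rewrite e01 e10 e02 e20 e03 e30 !gt !ut !vt q2t /=.
move: (t * x1 - x2) (t * x2 - x1) (t * x1 - x3) (t * x3 - x1) (t * x2 - x3)
  (t * x3 - x2) => g12 g21 g13 g31 g23 g32.
move: (_ + t * x1 ^+ 2) (_ + t * x2 ^+ 2) (_ + t * x3 ^+ 2) => u1 u2 u3.
move: (x1 ^+ 2 - _ + _) (x2 ^+ 2 - _ + _) (x3 ^+ 2 - _ + _) => v1 v2 v3.
move=> e; rewrite -[RHS](mulr0 (k12 * k13 * k23 * k1 * k2 * k3 * t ^- 4)) -e.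
by field; rewrite t0 oner_neq0.
Qed.

End SerreIdentity.

(** ** Serre relations for the weights of removals *)

Section SerreWords.
Variables (C : fieldType) (q1 q2 q3 u : C).
Hypothesis hq : q1 * q2 * q3 = 1.

Hypothesis lpos_inj : injective (lpos q1 q2 q3 u).
Variables (gam : G0_box -> C) (M : G0_box -> G0_box -> C).
Hypothesis M_neq0 : forall x y, M x y != 0.
Hypothesis M_exchange : forall x y, x != y ->
  gbox q1 q2 q3 u x y != 0 -> gbox q1 q2 q3 u y x != 0 ->
  M y x * gbox q1 q2 q3 u y x = - sbox C x y * gbox q1 q2 q3 u x y * M x y.

Local Notation word := (word gam M).
Local Notation weight := (weight gam M).
Local Notation tfac := (tfac M).
Local Notation gbox := (gbox q1 q2 q3 u).
Local Notation sbox := (sbox C).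

(** The exchange relation determines one order of a pair from the other, unless
    its coefficient vanishes; both structure functions cannot vanish. *)
Lemma tfac_prop x y : x != y -> ~~ covers2 x y -> ~~ covers2 y x ->
  exists k, tfac x y = k * gbox x y /\ tfac y x = - sbox x y * k * gbox y x.
Proof.
move=> xy n1 n2; have e := tfac_exchange hq lpos_inj M_neq0 M_exchange xy n1 n2.
have s2 := sbox2 C x y; have /orP[g0|g0] := gbox_neq0 hq lpos_inj x y.
  exists (tfac x y / gbox x y); split; first by rewrite divfK.
  apply: (mulfI g0); apply: (mulfI (x := sbox x y)).
    by apply: contraNneq (oner_neq0 C) => h; rewrite -s2 h mul0r.
  rewrite mulrA; move: e => /eqP; rewrite addr_eq0 => /eqP ->.
  have -> : sbox x y * (gbox x y * (- sbox x y * (tfac x y / gbox x y) * gbox y x))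
     = - (sbox x y * sbox x y) * (gbox x y / gbox x y) * tfac x y * gbox y x by ring.
  by rewrite s2 divff //; ring.
exists (- sbox x y * tfac y x / gbox y x); split.
  apply: (mulfI g0); move: e => /eqP; rewrite addrC addr_eq0 => /eqP ->.
  have -> : gbox y x * (- sbox x y * tfac y x / gbox y x * gbox x y) =
     - (gbox y x / gbox y x * sbox x y * gbox x y * tfac y x) by ring.
  by rewrite divff // mul1r.
rewrite -mulrA divfK // mulrA; have -> : - sbox x y * - sbox x y = sbox x y * sbox x y.
  by ring.
by rewrite s2 mul1r.
Qed.

(** A nonzero word removes four different boxes and leaves a state, which does
    not depend on the order; for other boxes all words vanish. Diagonal
    neighbours do not occur: one of them has the colour of x 0, and with the
    boxes between them there would be two boxes of that colour. *)
Lemma serre_words (la : {fset G0_box}) (x : nat -> G0_box) :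
  stable (mem la) ->
  G0_color (x 2%N) = G0_color (x 1%N) -> G0_color (x 3%N) = G0_color (x 1%N) ->
  G0_color (x 0%N) = G0_color (x 1%N) + 1 ->
  sum_perm3 (serre_word q2
    (fun a b c d => word la [:: x a; x b; x c; x d])) = 0.
Proof.
move=> st c2 c3 c0.
pose s := [:: x 1%N; x 2%N; x 3%N; x 0%N].
have eqW a b c d : perm_eq [:: a; b; c; d] [:: 1%N; 2%N; 3%N; 0%N] ->
    perm_eq [:: x a; x b; x c; x d] s.
  by move=> p; have := perm_map x p.
have [us|nus] := boolP (uniq s); last first.
  have z a b c d : perm_eq [:: a; b; c; d] [:: 1%N; 2%N; 3%N; 0%N] ->
      word la [:: x a; x b; x c; x d] = 0.
    move=> /eqW p; apply/eqP/negPn/negP => /(word_eq0 st)[us _ _].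
    by rewrite -(perm_uniq p) us in nus.
  by rewrite /sum_perm3 /serre_word !z //; ring.
have [[ss sst]|ns] := pselect ({subset s <= la} /\
    stable [pred z | (z \in la) && (z \notin s)]); last first.
  have z a b c d : perm_eq [:: a; b; c; d] [:: 1%N; 2%N; 3%N; 0%N] ->
      word la [:: x a; x b; x c; x d] = 0.
    move=> /eqW p; apply/eqP/negPn/negP => /(word_eq0 st)[_ ss sst]; apply: ns; split.
      by move=> z; rewrite -(perm_mem p); apply: ss.
    by apply: eq_stable sst => z /=; rewrite (perm_mem p).
  by rewrite /sum_perm3 /serre_word !z //; ring.
pose K := \prod_(y <- s) weight la y.
have wE a b c d : perm_eq [:: a; b; c; d] [:: 1%N; 2%N; 3%N; 0%N] ->
    word la [:: x a; x b; x c; x d] =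
    K * pairprod (fun i j => tfac (x i) (x j)) a b c d.
  move=> /eqW p; rewrite (wordE gam M_neq0) //.
  - rewrite (perm_big _ p); congr (_ * _).
    by rewrite /pairprod /= !big_cons !big_nil; ring.
  - by rewrite (perm_uniq p).
  - by move=> z; rewrite (perm_mem p); apply: ss.
  - by apply: eq_stable sst => z /=; rewrite (perm_mem p).
have nc2 a b : a \in s -> b \in s -> ~~ covers2 a b.
  move=> ha hb; apply/negP => c2ab.
  have [c [c' [cs c's e1 e2 /andP[ca c'b]]]] := covers2_between st ss sst ha hb c2ab.
  have ab := covers2_color c2ab.
  have only y z : y \in s -> z \in s -> G0_color y = G0_color (x 0%N) ->
      G0_color z = G0_color (x 0%N) -> y = z.
    have n01 : G0_color (x 1%N) != G0_color (x 0%N).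
      by rewrite c0 eq_sym Z2_add1_neq.
    have h0 y' : y' \in s -> G0_color y' = G0_color (x 0%N) -> y' = x 0%N.
      rewrite !inE => /or4P[]/eqP -> // /eqP; rewrite ?c2 ?c3 (negbTE n01) //.
    by move=> hy hz ey ez; rewrite (h0 y) // (h0 z).
  have [e|n] := eqVneq (G0_color a) (G0_color (x 0%N)).
    by move: ca; rewrite (only c a) ?eqxx // e1.
  have eb : G0_color b = G0_color (x 0%N) by rewrite ab; apply/esym/Z2_neq; rewrite eq_sym.
  by move: c'b; rewrite (only c' b) ?eqxx // e2.
have [[n12 n13 n10] [n23 n20] n30] : [/\ [/\ x 1%N != x 2%N, x 1%N != x 3%N
    & x 1%N != x 0%N], x 2%N != x 3%N /\ x 2%N != x 0%N & x 3%N != x 0%N].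
  move: us; rewrite /= !inE !negb_or !andbT.
  by case/and3P => /and3P[-> -> ->] /andP[-> ->] ->.
have mem1 : x 1%N \in s by rewrite !inE eqxx.
have mem2 : x 2%N \in s by rewrite !inE eqxx ?orbT.
have mem3 : x 3%N \in s by rewrite !inE eqxx ?orbT.
have mem0 : x 0%N \in s by rewrite !inE eqxx ?orbT.
have n01 : (G0_color (x 0%N) == G0_color (x 1%N)) = false.
  by rewrite c0 Z2_add1_neq.
have [k12 [a12 a21]] := tfac_prop n12 (nc2 _ _ mem1 mem2) (nc2 _ _ mem2 mem1).
have [k13 [a13 a31]] := tfac_prop n13 (nc2 _ _ mem1 mem3) (nc2 _ _ mem3 mem1).
have [k23 [a23 a32]] := tfac_prop n23 (nc2 _ _ mem2 mem3) (nc2 _ _ mem3 mem2).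
have [k1 [a10 a01]] := tfac_prop n10 (nc2 _ _ mem1 mem0) (nc2 _ _ mem0 mem1).
have [k2 [a20 a02]] := tfac_prop n20 (nc2 _ _ mem2 mem0) (nc2 _ _ mem0 mem2).
have [k3 [a30 a03]] := tfac_prop n30 (nc2 _ _ mem3 mem0) (nc2 _ _ mem0 mem3).
have := @serre_weights _ q1 q2 q3 (bpos q1 q2 q3 u (x 1%N)) (bpos q1 q2 q3 u (x 2%N))
  (bpos q1 q2 q3 u (x 3%N)) (bpos q1 q2 q3 u (x 0%N)) k12 k13 k23 k1 k2 k3
  (fun i j => tfac (x i) (x j)) hq (q2_neq0 hq).
have sw : sbox (x 1%N) (x 0%N) = -1 /\ sbox (x 2%N) (x 0%N) = -1 /\
    sbox (x 3%N) (x 0%N) = -1.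
  by rewrite /sbox /sign c2 c3 ![G0_color _ == G0_color (x 0%N)]eq_sym n01.
have ss' : sbox (x 1%N) (x 2%N) = 1 /\ sbox (x 1%N) (x 3%N) = 1 /\
    sbox (x 2%N) (x 3%N) = 1.
  by rewrite /sbox /sign c2 c3 eqxx.
move: sw ss' => [s1 [s2 s3]] [s12 [s13 s23]].
rewrite s1 in a01; rewrite s2 in a02; rewrite s3 in a03.
rewrite s12 in a21; rewrite s13 in a31; rewrite s23 in a32.
rewrite a12 a21 a13 a31 a23 a32 a10 a01 a20 a02 a30 a03.
rewrite /gbox /gval c2 c3 eqxx n01 [G0_color (x 1%N) == _]eq_sym n01.
rewrite opprK !mul1r !mulN1r => /(_ erefl erefl erefl erefl erefl erefl).
move=> /(_ erefl erefl erefl erefl erefl erefl) e.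
rewrite /sum_perm3 /serre_word !wE //.
rewrite -[RHS](mulr0 K) -e /sum_perm3 /serre_word; ring.
Qed.

End SerreWords.

(** * Operators on the space of states *)

Lemma malgU_scale (C : nzRingType) (K : choiceType) (c : C) (k : K) :
  << c *g k >> = c *: << k >> :> {malg C[K]}.
Proof.
apply/malgP => k'; rewrite mcoeffZ !mcoeffU.
by case: (k == k'); rewrite ?mulr1n ?mulr0n ?mulr1 ?mulr0.
Qed.

(** In the later parts the space of states enters only through the vectors vec la
    and the linear extension lin of maps defined on states. *)
Section StateSpace.
Variable C : fieldType.

Definition space : lmodType C := {malg C[set_type G0_states]}.

(** Total in la, with the value 0 off the states. *)
Definition vec (la : {fset G0_box}) : space :=
  if insub la is Some l then << l >> else 0.

Implicit Types (la : {fset G0_box}) (v w : space) (f : {fset G0_box} -> space).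

Lemma vec_val (l : set_type G0_states) : vec (val l) = << l >>.
Proof. by rewrite /vec valK. Qed.

Lemma vec_out la : ~ stable (mem la) -> vec la = 0.
Proof.
move=> h; rewrite /vec insubF //; apply/negP => /set_mem /G0_statesP; exact: h.
Qed.

Lemma vec_in la : stable (mem la) -> exists2 l : set_type G0_states, val l = la & vec la = << l >>.
Proof.
move=> /G0_statesP /mem_set h.
by exists (Sub la h); rewrite ?SubK // -[la in vec la](SubK (set_type G0_states) h) vec_val.
Qed.

Lemma val_stable (l : set_type G0_states) : stable (mem (val l)).
Proof. by apply/G0_statesP/set_mem/(valP l). Qed.

Definition lin f (v : space) : space := \sum_(l <- msupp v) v@_l *: f (val l).

Lemma linEw f v (D : {fset (set_type G0_states)}) : (msupp v `<=` D)%fset ->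
  lin f v = \sum_(l <- D) v@_l *: f (val l).
Proof.
move=> sD; rewrite /lin (big_fset_incl _ sD) // => l _ /mcoeff_outdom ->.
by rewrite scale0r.
Qed.

Lemma lin_is_linear f : linear (lin f).
Proof.
move=> c v w; pose D := (msupp v `|` msupp w `|` msupp (c *: v + w))%fset.
rewrite !(@linEw _ _ D); last first.
- by apply/fsubsetP => l; rewrite !inE => ->; rewrite ?orbT.
- by apply/fsubsetP => l; rewrite !inE => ->; rewrite ?orbT.
- by apply/fsubsetP => l; rewrite !inE => ->; rewrite ?orbT.
rewrite scaler_sumr -big_split; apply: eq_bigr => l _ /=.
by rewrite mcoeffD mcoeffZ scalerDl scalerA.
Qed.

HB.instance Definition _ f :=
  GRing.isLinear.Build C space space *:%R (lin f) (lin_is_linear f).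

Lemma lin_vec f la : stable (mem la) -> lin f (vec la) = f la.
Proof.
by case/vec_in => l <- ->; rewrite /lin msuppU oner_eq0 big_seq_fset1 mcoeffUU scale1r.
Qed.

Lemma vec_expand v : v = \sum_(l <- msupp v) v@_l *: vec (val l).
Proof.
rewrite {1}[v]monalgE; apply: eq_bigr => l _; rewrite vec_val.
exact: malgU_scale.
Qed.

Lemma linear_ext (f g : {linear space -> space}) :
  (forall la, stable (mem la) -> f (vec la) = g (vec la)) -> f =1 g.
Proof.
move=> e v; rewrite [v]vec_expand !raddf_sum; apply: eq_bigr => l _ /=.
by rewrite !linearZ e //; apply: val_stable.
Qed.

End StateSpace.

(** ** Modes of a current *)

(** An exhaustion of the boxes by finite sets: a mode of a current is a sum over
    infinitely many boxes, all but finitely many of which act by 0 on a given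
    vector. *)
Definition boxrange (n : nat) : seq G0_box :=
  [seq (zk.1, (zk.2, x)) | zk <- [seq (z, k) | z <- [:: false; true], k <- iota 0 n],
     x <- iota 0 n].

Lemma mem_boxrange n z k x : ((z, (k, x)) \in boxrange n) = (k < n)%N && (x < n)%N.
Proof.
apply/allpairsP/andP => [[[[z' k'] x']] [/allpairsP[[z'' k'']]]|[lk lx]] /=.
  by rewrite !mem_iota /= => -[_ h [-> ->]] h' [_ -> ->].
exists ((z, k), x); rewrite mem_iota; split=> //.
by rewrite /= !mem_cat; case: (z); rewrite map_f ?orbT ?mem_iota.
Qed.

Lemma boxrange_uniq n : uniq (boxrange n).
Proof.
apply: allpairs_uniq; rewrite ?iota_uniq //.
  apply: allpairs_uniq; rewrite ?iota_uniq //.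
  by move=> [a b] [a' b'] _ _ [-> ->].
by move=> [[z k] x] [[z' k'] x'] _ _ /= [-> -> ->].
Qed.

Definition boxrank (la : seq G0_box) : nat := \max_(b <- la) (b.2.1 + b.2.2).+1.

Lemma boxrank_sub (la : seq G0_box) : {subset la <= boxrange (boxrank la)}.
Proof.
move=> [z [k x]] bla; rewrite mem_boxrange.
have : (k + x < boxrank la)%N.
  by rewrite /boxrank (big_rem _ bla) /= leq_max ltnSn.
by move=> h; rewrite !(leq_ltn_trans _ h) ?leq_addl ?leq_addr.
Qed.

Lemma boxrange_le m n : (m <= n)%N -> {subset boxrange m <= boxrange n}.
Proof.
move=> le [z [k x]]; rewrite !mem_boxrange => /andP[a b].
by rewrite !(leq_trans _ le).
Qed.

Section Modes.
Variables (C : fieldType) (V : lmodType C) (vec : {fset G0_box} -> V).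
Variable lin : ({fset G0_box} -> V) -> {linear V -> V}.
Hypothesis lin_vec : forall f la, stable (mem la) -> lin f (vec la) = f la.
Hypothesis vec_out : forall la, ~ stable (mem la) -> vec la = 0.
Implicit Types (la : {fset G0_box}) (v w : V).

Inductive bounded (n : nat) : V -> Prop :=
| bounded0 : bounded n 0
| bounded_step c la v : stable (mem la) -> {subset la <= boxrange n} ->
    bounded n v -> bounded n (c *: vec la + v).

Lemma boundedD n v w : bounded n v -> bounded n w -> bounded n (v + w).
Proof.
move=> bv bw; elim: bv => [|c la v' st h _ ih]; first by rewrite add0r.
by rewrite -addrA; apply: bounded_step.
Qed.

Lemma boundedZ n a v : bounded n v -> bounded n (a *: v).
Proof.
elim=> [|c la v' st h _ ih]; first by rewrite scaler0; apply: bounded0.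
by rewrite scalerDr scalerA; apply: bounded_step.
Qed.

Lemma bounded_vec n c la : ~ stable (mem la) \/ {subset la <= boxrange n} ->
  bounded n (c *: vec la).
Proof.
have [st|ns] := pselect (stable (mem la)).
  case=> // h; rewrite -[X in bounded _ X]addr0.
  by apply: bounded_step => //; apply: bounded0.
by move=> _; rewrite vec_out // scaler0; apply: bounded0.
Qed.

(** What adding and removing boxes have in common: the size of a state grows by
    at most one, and boxes far from the state act by 0. *)
Definition local (X : G0_box -> {linear V -> V}) : Prop :=
  forall n la b, stable (mem la) -> {subset la <= boxrange n} ->
    bounded n.+1 (X b (vec la)) /\ (b \notin boxrange n.+1 -> X b (vec la) = 0).

Lemma local_bounded X n v b : local X -> bounded n v -> bounded n.+1 (X b v).
Proof.
move=> lX; elim=> [|c la v' st h _ ih]; first by rewrite linear0; apply: bounded0.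
rewrite linearD linearZ; apply: boundedD => //; apply: boundedZ.
exact: (lX _ _ _ st h).1.
Qed.

Variable pos : G0_box -> C.

Definition modeop (X : G0_box -> {linear V -> V}) (i : 'Z_2) (k : int) : {linear V -> V} :=
  lin (fun la => \sum_(b <- boxrange (boxrank la).+1 | G0_color b == i)
    pos b ^ k *: X b (vec la)).

(** By linearity the sum may be taken over any range that contains the relevant
    boxes of every state in v. *)
Lemma modeopE X i k n N v : local X -> bounded n v -> (n < N)%N ->
  modeop X i k v = \sum_(b <- boxrange N | G0_color b == i) pos b ^ k *: X b v.
Proof.
move=> lX bv lt; elim: bv => [|c la w st h _ ih].
  by rewrite linear0 big1 // => b _; rewrite linear0 scaler0.
transitivity (c *: modeop X i k (vec la) + modeop X i k w).
  exact: linearP.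
have -> : modeop X i k (vec la) = \sum_(b <- boxrange (boxrank la).+1 |
    G0_color b == i) pos b ^ k *: X b (vec la) by exact: lin_vec.
rewrite ih scaler_sumr.
rewrite [RHS](eq_bigr (fun b => c *: (pos b ^ k *: X b (vec la)) +
    pos b ^ k *: X b w)); last first.
  by move=> b _; rewrite linearP scalerDr !scalerA mulrC.
rewrite [RHS]big_split /=; congr (_ + _).
have wid m K : (boxrank la < m \/ n < m)%N -> (m <= K)%N ->
   \sum_(b <- boxrange m | G0_color b == i) c *: (pos b ^ k *: X b (vec la)) =
   \sum_(b <- boxrange K | G0_color b == i) c *: (pos b ^ k *: X b (vec la)).
  move=> ltm leK.
  rewrite [RHS](bigID (mem (boxrange m))) /= [X in _ + X]big1 => [|b /andP[_ nb]].
    rewrite addr0 -big_filter -[RHS]big_filter; apply: perm_big.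
    apply: uniq_perm; rewrite ?filter_uniq ?boxrange_uniq // => b.
    rewrite !mem_filter; case: (G0_color b == i) => //=.
    case bm: (b \in boxrange m) => //=; apply/esym.
    exact: (boxrange_le leK bm).
  suff -> : X b (vec la) = 0 by rewrite !scaler0.
  case: ltm => ltm.
    apply: (lX _ _ _ st (@boxrank_sub la)).2; apply: contra nb.
    exact: boxrange_le.
  by apply: (lX _ _ _ st h).2; apply: contra nb; apply: boxrange_le.
pose K := maxn (boxrank la).+1 N.
transitivity (\sum_(b <- boxrange K | G0_color b == i) c *: (pos b ^ k *: X b (vec la))).
  by apply: wid; [left | exact: leq_maxl].
by apply/esym; apply: wid; [right | exact: leq_maxr].
Qed.

End Modes.

(** * Relations between modes of a current *)

Section ModeRelations.
Variables (C : fieldType) (V : lmodType C).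
Implicit Types (v w : V) (O : nat -> {linear V -> V}).

(** ** Quadratic relations *)

Definition eval2 (P : {poly {poly C}}) (x y : C) : C := P.[x%:P].[y].

Definition pms2 (P : {poly {poly C}}) (t : int -> int -> V) (m n : int) : V :=
  \sum_(a < size P) \sum_(b < size P`_a) P`_a`_b *: t (m + a%:Z) (n + b%:Z).

Lemma eq_pms2 P (t t' : int -> int -> V) m n : (forall m n, t m n = t' m n) ->
  pms2 P t m n = pms2 P t' m n.
Proof. by move=> e; apply: eq_bigr => a _; apply: eq_bigr => b _; rewrite e. Qed.

Lemma pms2_sum (J : Type) (r : seq J) (Q : pred J) P (t : J -> int -> int -> V) m n :
  pms2 P (fun m n => \sum_(k <- r | Q k) t k m n) m n =
  \sum_(k <- r | Q k) pms2 P (t k) m n.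
Proof.
rewrite /pms2 exchange_big; apply: eq_bigr => a _ /=.
rewrite exchange_big; apply: eq_bigr => b _ /=.
by rewrite scaler_sumr.
Qed.

Lemma pms2_mode P (x y : C) (v : V) m n : x != 0 -> y != 0 ->
  pms2 P (fun m n => (x ^ m * y ^ n) *: v) m n =
  (x ^ m * y ^ n * eval2 P x y) *: v.
Proof.
move=> x0 y0; rewrite /eval2 [P.[_]]horner_coef horner_sum mulr_sumr scaler_suml.
apply: eq_bigr => a _; rewrite -rmorphXn /= hornerM hornerC horner_coef mulr_suml.
rewrite mulr_sumr scaler_suml; apply: eq_bigr => b _.
rewrite scalerA.
rewrite (expfzDr m a%:Z x0) (expfzDr n b%:Z y0).
apply: (congr1 (fun z => z *: v)).
rewrite -!exprnP.
ring.
Qed.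

(** The variable of the first index acts on the series s, that of the second by
    its value y. *)
Lemma pms2_pact P (s : int -> C) (y : C) (v : V) m n : y != 0 ->
  pms2 P (fun m n => (s m * y ^ n) *: v) m n =
  (y ^ n * pact (map_poly (fun p => p.[y]) P) s m) *: v.
Proof.
move=> y0; rewrite (pact_widen (N := size P)) ?size_poly // mulr_sumr scaler_suml.
apply: eq_bigr => a _; rewrite coef_map_id0 ?horner0 // horner_coef.
rewrite mulr_suml mulr_sumr scaler_suml; apply: eq_bigr => b _.
rewrite scalerA (expfzDr n b%:Z y0); apply: (congr1 (fun z => z *: v)); rewrite -exprnP; ring.
Qed.

(** On the vectors of bd n the mode is a finite sum over the boxes of any larger
    range. *)
Variables (I : eqType) (col : I -> 'Z_2) (range : nat -> seq I) (pos : I -> C).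
Hypothesis pos_neq0 : forall b, pos b != 0.
Variable X : I -> {linear V -> V}.
Variable bd : nat -> V -> Prop.
Hypothesis bd0 : forall n, bd n 0.
Hypothesis bdD : forall n v w, bd n v -> bd n w -> bd n (v + w).
Hypothesis bdZ : forall n c v, bd n v -> bd n (c *: v).
Hypothesis X_bd : forall n v b, bd n v -> bd n.+1 (X b v).
Variable mode : 'Z_2 -> int -> {linear V -> V}.
Hypothesis modeE : forall i k n N v, bd n v -> (n < N)%N ->
  mode i k v = \sum_(b <- range N | col b == i) pos b ^ k *: X b v.

Lemma modes2 i j m n k N v : bd k v -> (k.+1 < N)%N ->
  mode i m (mode j n v) =
  \sum_(y <- range N | col y == j) \sum_(x <- range N | col x == i)
    (pos x ^ m * pos y ^ n) *: X x (X y v).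
Proof.
move=> bv lt; rewrite (modeE j n bv (N := N)) ?(ltn_trans _ lt) //.
rewrite linear_sum; apply: eq_bigr => y _; rewrite linearZ /=.
rewrite (modeE i m (X_bd y bv) (N := N)) // scaler_sumr.
by apply: eq_bigr => x _; rewrite scalerA mulrC.
Qed.

(** On the pair of boxes x, y a polynomial in the two shifts of indices acts by
    its value at the positions. *)
Lemma modes_quadratic P Q (c : C) i j m n k v : bd k v ->
  (forall x y, col x = i -> col y = j ->
    (c * eval2 P (pos x) (pos y)) *: X x (X y v) +
    eval2 Q (pos x) (pos y) *: X y (X x v) = 0) ->
  c *: pms2 P (fun m n => mode i m (mode j n v)) m n +
  pms2 Q (fun m n => mode j n (mode i m v)) m n = 0.
Proof.
move=> bv h.
rewrite (eq_pms2 _ _ _ (fun m n => modes2 i j m n bv (ltnSn _))).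
have e m' n' : mode j n' (mode i m' v) =
    \sum_(y <- range k.+2 | col y == j) \sum_(x <- range k.+2 | col x == i)
    (pos x ^ m' * pos y ^ n') *: X y (X x v).
  rewrite (modes2 j i n' m' bv (ltnSn _)).
  rewrite exchange_big.
  apply: eq_bigr => y _; apply: eq_bigr => x _.
  by rewrite [_ ^ n' * _]mulrC.
rewrite (eq_pms2 _ _ _ e) !pms2_sum scaler_sumr -big_split /=.
apply: big1 => y /eqP cy; rewrite !pms2_sum scaler_sumr -big_split /=.
apply: big1 => x /eqP cx; rewrite !pms2_mode //.
have := congr1 (fun z => (pos x ^ m * pos y ^ n) *: z) (h x y cx cy).
rewrite scaler0 scalerDr !scalerA => <-.
by congr (_ *: _ + _); ring.
Qed.

(** ** Serre relations *)

Definition opword O (s : seq nat) v : V := foldr (fun i w => O i w) v s.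

(** The terms of the iterated commutator as words in the indices of the four
    operators, of which the index 0 stands for the one of the other colour. *)
Definition serre_list1 (q2 : C) (a b c : nat) : seq (C * seq nat) :=
  [:: (1, [:: a; b; c; 0%N]); (- q2, [:: a; b; 0%N; c]); (-1, [:: a; c; 0%N; b]);
      (q2, [:: a; 0%N; c; b]); (- q2^-1, [:: b; c; 0%N; a]); (q2^-1 * q2, [:: b; 0%N; c; a]);
      (q2^-1, [:: c; 0%N; b; a]); (- (q2^-1 * q2), [:: 0%N; c; b; a])].

Definition serre_list (q2 : C) : seq (C * seq nat) :=
  serre_list1 q2 1 2 3 ++ serre_list1 q2 1 3 2 ++ serre_list1 q2 2 1 3 ++
  serre_list1 q2 2 3 1 ++ serre_list1 q2 3 1 2 ++ serre_list1 q2 3 2 1.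

Definition opserre q2 O v : V := \sum_(t <- serre_list q2) t.1 *: opword O t.2 v.

Definition ocomm (p : C) (f g : V -> V) (v : V) : V := f (g v) - p *: g (f v).

Lemma ocomm_serre q2 O a b c v :
  ocomm q2^-1 (O a) (ocomm 1 (O b) (ocomm q2 (O c) (O 0%N))) v =
  \sum_(t <- serre_list1 q2 a b c) t.1 *: opword O t.2 v.
Proof.
rewrite /ocomm /serre_list1 !big_cons big_nil /=.
rewrite !(linearB, linearZ) /= !(scalerBr, scalerA, scale1r).
by rewrite !opprK !(scalerDr, scalerN, scaleNr, scalerA) !scale1r addr0 -!addrA.
Qed.

(** A permutation of three letters is the triple of its values. *)
Lemma sum_S3 (W : zmodType) (F : 'I_3 -> 'I_3 -> 'I_3 -> W) :
  \sum_(p : 'S_3) F (p 0) (p 1) (p 2%:R) =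
  F 0 1 2%:R + F 0 2%:R 1 + F 1 0 2%:R + F 1 2%:R 0 + F 2%:R 0 1 + F 2%:R 1 0.
Proof.
pose h (p : 'S_3) : 'I_3 * 'I_3 * 'I_3 := (p 0, p 1, p 2%:R).
have I3 (P : 'I_3 -> Prop) : P 0 -> P 1 -> P 2%:R -> forall i, P i.
  move=> P0 P1 P2 [[|[|[|m]]] lt] //; [move: P0 | move: P1 | move: P2];
  by congr P; apply/val_inj.
have hinj : injective h.
  by move=> p p' [e0 e1 e2]; apply/permP; apply: I3.
pose G (t : 'I_3 * 'I_3 * 'I_3) := F t.1.1 t.1.2 t.2.
pose U := [set t : 'I_3 * 'I_3 * 'I_3 | uniq [:: t.1.1; t.1.2; t.2]].
have imh : [set h p | p in [set: 'S_3]] = U.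
  apply/eqP; rewrite finset.eqEsubset; apply/andP; split; apply/fintype.subsetP => t.
    case/imsetP => p _ ->; rewrite inE /= !inE !(inj_eq perm_inj).
    by [].
  case: t => [[a b] c]; rewrite inE => /= u.
  pose f (i : 'I_3) := tnth [tuple a; b; c] i.
  have finj : injective f by apply/tuple_uniqP.
  apply/imsetP; exists (perm finj); first by rewrite inE.
  rewrite /h !permE /f.
  by rewrite !(tnth_nth a).
transitivity (\sum_(t in U) G t).
  rewrite -imh big_imset /=; last by move=> p p' _ _; apply: hinj.
  by apply: eq_bigl => p; rewrite inE.
transitivity (\sum_(a : 'I_3) \sum_(b : 'I_3) \sum_(c : 'I_3)
    if uniq [:: a; b; c] then F a b c else 0).
  rewrite !pair_big big_mkcond; apply: eq_bigr => -[[a b] c] _.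
  by rewrite inE.
rewrite !big_ord_recl !big_ord0 /=.
have e2 : lift ord0 (lift ord0 ord0) = 2%:R :> 'I_3 by apply/val_inj.
have e1 : lift ord0 ord0 = 1 :> 'I_3 by apply/val_inj.
have e0 : ord0 = 0 :> 'I_3 by apply/val_inj.
by rewrite e2 e1 e0 !(add0r, addr0) -!addrA.
Qed.

Definition upd O (i : nat) (T : {linear V -> V}) : nat -> {linear V -> V} :=
  fun j => if j == i then T else O j.

Lemma opword_notin O i T s v : i \notin s -> opword (upd O i T) s v = opword O s v.
Proof.
elim: s => //= j s ih; rewrite inE negb_or => /andP[n ns].
by rewrite ih // /upd eq_sym (negbTE n).
Qed.

Lemma opword_linear (J : Type) (r : seq J) (Q : pred J) (c : J -> C)
    (T : J -> {linear V -> V}) (S : {linear V -> V}) O i s v :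
  (forall w, S w = \sum_(k <- r | Q k) c k *: T k w) ->
  i \in s -> uniq s ->
  opword (upd O i S) s v = \sum_(k <- r | Q k) c k *: opword (upd O i (T k)) s v.
Proof.
move=> hS; elim: s => //= j s ih; rewrite inE => /orP[/eqP <-|ins] /andP[ns us].
  rewrite {1}/upd eqxx hS; apply: eq_bigr => k _.
  by rewrite /upd eqxx -/(upd O i _) !opword_notin.
have ji : (j == i) = false by apply: contraNF ns => /eqP ->.
rewrite ih // {1}/upd ji linear_sum; apply: eq_bigr => k _.
by rewrite linearZ /upd ji.
Qed.

Lemma serre_list_uniq q2 t : t \in serre_list q2 ->
  uniq t.2 /\ (forall i, (i \in t.2) = (i < 4)%N) /\ size t.2 = 4%N.
Proof.
have e : all (fun s => perm_eq s (iota 0 4)) [seq t.2 | t <- serre_list q2] by [].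
move=> /(map_f snd) /(allP e) p; split; first by rewrite (perm_uniq p).
split=> [i|]; last by rewrite (perm_size p).
by rewrite (perm_mem p) mem_iota.
Qed.

Lemma opserre_linear q2 (J : Type) (r : seq J) (Q : pred J) (c : J -> C)
    (T : J -> {linear V -> V}) (S : {linear V -> V}) O i v :
  (forall w, S w = \sum_(k <- r | Q k) c k *: T k w) -> (i < 4)%N ->
  opserre q2 (upd O i S) v = \sum_(k <- r | Q k) c k *: opserre q2 (upd O i (T k)) v.
Proof.
move=> hS lt; rewrite /opserre.
transitivity (\sum_(t <- serre_list q2) \sum_(k <- r | Q k)
    c k *: (t.1 *: opword (upd O i (T k)) t.2 v)).
  apply: eq_big_seq => t /serre_list_uniq[us [h _]].
  rewrite (opword_linear _ _ hS) ?h // scaler_sumr.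
  by apply: eq_bigr => k _; rewrite !scalerA mulrC.
by rewrite exchange_big; apply: eq_bigr => k _; rewrite scaler_sumr.
Qed.

Lemma eq_opserre q2 O O' v : (forall i, (i < 4)%N -> O i =1 O' i) ->
  opserre q2 O v = opserre q2 O' v.
Proof.
move=> e; apply: eq_big_seq => t /serre_list_uniq[us [h _]]; congr (_ *: _).
have {h} : all (fun i => i < 4)%N t.2 by apply/allP => i; rewrite h.
by elim: t.2 => //= i s ih /andP[lt /ih ->]; rewrite e.
Qed.

Definition asg (T0 T1 T2 T3 : {linear V -> V}) (a : nat) : {linear V -> V} :=
  if a == 0%N then T0 else if a == 1%N then T1 else if a == 2%N then T2 else T3.

Definition lincomb (r : seq I) (c : I -> C) v : V := \sum_(b <- r) c b *: X b v.

Lemma lincomb_is_linear r c : linear (lincomb r c).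
Proof.
move=> a v w; rewrite /lincomb scaler_sumr -big_split; apply: eq_bigr => b _ /=.
by rewrite linearP scalerDr !scalerA mulrC.
Qed.

HB.instance Definition _ r c :=
  GRing.isLinear.Build C V V *:%R (lincomb r c) (lincomb_is_linear r c).

Lemma bd_lincomb n r c v : bd n v -> bd n.+1 (lincomb r c v).
Proof.
move=> bv; rewrite /lincomb; elim: r => [|b r ih]; first by rewrite big_nil.
by rewrite big_cons; apply: bdD => //; apply/bdZ/X_bd.
Qed.

(** The Serre combination is linear in each of its four operators, so each mode
    may be replaced by the sum of its boxes. *)
Lemma modes_serre q2 (i j : 'Z_2) (k : nat -> int) n v : bd n v ->
  (forall x : nat -> I, col (x 1%N) = i -> col (x 2%N) = i -> col (x 3%N) = i ->
     col (x 0%N) = j -> opserre q2 (fun a => X (x a)) v = 0) ->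
  opserre q2 (fun a => mode (if a == 0%N then j else i) (k a)) v = 0.
Proof.
move=> bv h; set O := fun a => _.
pose cl (a : nat) := if a == 0%N then j else i.
(* Four operators enlarge the range by at most four. *)
pose r (a : nat) := [seq b <- range (n + 5) | col b == cl a].
pose cf (a : nat) (b : I) := pos b ^ k a.
pose ON (a : nat) : {linear V -> V} := lincomb (r a) (cf a).
have OE a m w : bd m w -> (m < n + 5)%N -> O a w = ON a w.
  by move=> bw lt; rewrite /O (modeE _ _ bw lt) /ON /= /lincomb big_filter.
have wE s : (size s < 5)%N -> opword O s v = opword ON s v /\
    bd (n + size s) (opword ON s v).
  elim: s => [|a s ih] /= lt; first by rewrite addn0.
  have [e b] := ih (ltnW lt); rewrite e.
  rewrite (OE _ _ _ b) ?addnS ?ltn_add2l; last by lia.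
  by split=> //; apply: bd_lincomb.
have -> : opserre q2 O v = opserre q2 ON v.
  apply: eq_big_seq => t /serre_list_uniq[us [_ sz]].
  by rewrite (wE _ _).1 // sz.
pose F T0 T1 T2 T3 := opserre q2 (asg T0 T1 T2 T3) v.
have L0 T0 T1 T2 T3 (S : {linear V -> V}) :
    F S T1 T2 T3 = opserre q2 (upd (asg T0 T1 T2 T3) 0 S) v.
  by apply: eq_opserre => -[|[|[|[|]]]].
have L1 T0 T1 T2 T3 (S : {linear V -> V}) :
    F T0 S T2 T3 = opserre q2 (upd (asg T0 T1 T2 T3) 1 S) v.
  by apply: eq_opserre => -[|[|[|[|]]]].
have L2 T0 T1 T2 T3 (S : {linear V -> V}) :
    F T0 T1 S T3 = opserre q2 (upd (asg T0 T1 T2 T3) 2 S) v.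
  by apply: eq_opserre => -[|[|[|[|]]]].
have L3 T0 T1 T2 T3 (S : {linear V -> V}) :
    F T0 T1 T2 S = opserre q2 (upd (asg T0 T1 T2 T3) 3 S) v.
  by apply: eq_opserre => -[|[|[|[|]]]].
have lin a T : (a < 4)%N -> opserre q2 (upd T a (ON a)) v =
    \sum_(b <- r a | true) cf a b *: opserre q2 (upd T a (X b)) v.
  by move=> lt; apply: opserre_linear.
have vanish a b (G : V) : (b \in r a -> G = 0) -> b \in r a -> cf a b *: G = 0.
  by move=> hG /hG ->; rewrite scaler0.
transitivity (F (ON 0%N) (ON 1%N) (ON 2%N) (ON 3%N)).
  by apply: eq_opserre => -[|[|[|[|]]]].
have colr a b : b \in r a -> col b = cl a by rewrite mem_filter => /andP[/eqP].
rewrite (L0 (ON 0%N)) lin // big_seq big1 // => b0 h0; apply: (vanish _ _ _ _ h0) => _.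
rewrite -L0 (L1 _ (ON 0%N)) lin // big_seq big1 // => b1 h1; apply: (vanish _ _ _ _ h1) => _.
rewrite -L1 (L2 _ _ (ON 0%N)) lin // big_seq big1 // => b2 h2; apply: (vanish _ _ _ _ h2) => _.
rewrite -L2 (L3 _ _ _ (ON 0%N)) lin // big_seq big1 // => b3 h3; apply: (vanish _ _ _ _ h3) => _.
rewrite -L3 -[RHS](h (fun a => nth b3 [:: b0; b1; b2] a)) /=.
- by apply: eq_opserre => -[|[|[|[|]]]].
- exact: colr h1.
- exact: colr h2.
- exact: colr h3.
- exact: colr h0.
Qed.

End ModeRelations.

(** * Operators that remove or add a box *)

Section BoxOperators.
Variables (C : fieldType) (V : lmodType C) (vec : {fset G0_box} -> V).
Variable lin : ({fset G0_box} -> V) -> {linear V -> V}.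
Hypothesis lin_vec : forall f la, stable (mem la) -> lin f (vec la) = f la.
Hypothesis vec_out : forall la, ~ stable (mem la) -> vec la = 0.
Variables (gam : G0_box -> C) (M : G0_box -> G0_box -> C).
Implicit Types (la : {fset G0_box}) (s t : seq G0_box).

#[local] Arguments word : simpl never.
Local Notation word := (word gam M).
Local Notation rweight := (rweight gam M).

Definition remop b : {linear V -> V} := lin (fun la => rweight la b *: vec (la `\ b)%fset).

(** The matrix coefficients are those of remop, transposed. *)
Definition addop b : {linear V -> V} := lin (fun la =>
  (if b \in la then 0 else rweight (b |` la)%fset b) *: vec (b |` la)%fset).

Lemma remop_vec la b : stable (mem la) ->
  remop b (vec la) = rweight la b *: vec (la `\ b)%fset.
Proof. by move=> st; rewrite /remop lin_vec. Qed.

Lemma addop_vec la b : stable (mem la) -> addop b (vec la) =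
  (if b \in la then 0 else rweight (b |` la)%fset b) *: vec (b |` la)%fset.
Proof. by move=> st; rewrite /addop lin_vec. Qed.

Lemma remop_local : local vec remop.
Proof.
move=> n la b st h; rewrite /= remop_vec //; split.
  apply: (bounded_vec vec_out); right => x /fsetD1P[_ /h]; exact: boxrange_le.
move=> nb; rewrite /rweight ifN ?scale0r //; apply/negP => /convex_mem /h.
by move/(boxrange_le (leqnSn n)); rewrite (negbTE nb).
Qed.

Lemma add_stable_range la b n : stable (mem (b |` la)%fset) -> b \notin la ->
  {subset la <= boxrange n} -> b \in boxrange n.+1.
Proof.
case: b => z [k x] st nb h; rewrite mem_boxrange !ltnS; apply/andP; split.
  case: k st nb => // k st nb; have := (st z k x).1; rewrite /= !inE eqxx.
  case/(_ isT)/orP => [/eqP[]|/h]; first by lia.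
  by rewrite mem_boxrange => /andP[].
case: x st nb => // x st nb; have := (st z k x).2; rewrite /= !inE eqxx.
case/(_ isT)/orP => [/eqP[]|/h]; first by lia.
by rewrite mem_boxrange => /andP[].
Qed.

Lemma addop_local : local vec addop.
Proof.
move=> n la b st h; rewrite /= addop_vec //.
have [bla|nb] := boolP (b \in la).
  by rewrite scale0r; split=> //; apply: bounded0.
have key : ~ stable (mem (b |` la)%fset) \/ b \in boxrange n.+1.
  have [st'|] := pselect (stable (mem (b |` la)%fset)); last by left.
  by right; apply: (add_stable_range st').
split.
  apply: (bounded_vec vec_out); case: key => [ns|br]; [by left | right => x].
  by case/fset1UP => [->//|/h]; apply: boxrange_le.
by case: key => [ns _|-> //]; rewrite vec_out // scaler0.
Qed.

(** ** Words in these operators *)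

Definition remall la s : {fset G0_box} := [fset x in la | x \notin s]%fset.
Definition addall la s : {fset G0_box} := (la `|` [fset x in s])%fset.

Lemma in_remall la s x : (x \in remall la s) = (x \in la) && (x \notin s).
Proof. by rewrite !inE. Qed.

Lemma in_addall la s x : (x \in addall la s) = (x \in la) || (x \in s).
Proof. by rewrite !inE. Qed.

Lemma remall_cons la b s : remall la (b :: s) = (remall la s `\ b)%fset.
Proof.
by apply/fsetP => x; rewrite in_remall in_fsetD1 in_remall inE negb_or andbCA.
Qed.

Lemma remall_rem la b s : remall (la `\ b)%fset s = (remall la s `\ b)%fset.
Proof.
by apply/fsetP => x; rewrite in_remall !in_fsetD1 in_remall andbA.
Qed.

Lemma word_cons la b s : word la (b :: s) = rweight la b * word (la `\ b)%fset s.
Proof. by []. Qed.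

Lemma word_cat la s t : word la (s ++ t) = word la s * word (remall la s) t.
Proof.
elim: s la => [|b s ih] la.
  rewrite [word la [::]]/(1) mul1r; congr (word _ t); apply/fsetP => x.
  by rewrite in_remall andbT.
by rewrite cat_cons 2!word_cons ih remall_rem -remall_cons mulrA.
Qed.

Lemma word_remall la s : stable (mem la) -> ~ stable (mem (remall la s)) ->
  word la s = 0.
Proof.
move=> st ns; apply/eqP/negPn/negP => /(word_eq0 st)[_ _ h]; apply: ns.
by apply: eq_stable h => x; rewrite /= in_remall.
Qed.

Lemma word1 la b : word la [:: b] = rweight la b.
Proof. exact: mulr1. Qed.

Lemma remop_word la (x : nat -> G0_box) (s : seq nat) : stable (mem la) ->
  opword (fun a => remop (x a)) s (vec la) =
  word la (rev (map x s)) *: vec (remall la (map x s)).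
Proof.
move=> st; elim: s => [|a s ih] /=.
  rewrite scale1r; congr vec; apply/fsetP => y; by rewrite in_remall andbT.
rewrite ih rev_cons -cats1 word_cat linearZ /=.
have er : remall la (rev (map x s)) = remall la (map x s).
  by apply/fsetP => y; rewrite !in_remall mem_rev.
have [st'|ns] := pselect (stable (mem (remall la (map x s)))).
  by rewrite (remop_vec _ st') scalerA remall_cons er word1.
by rewrite word_remall ?er // mul0r !scale0r.
Qed.

(** Adding boxes one by one is read backwards: it has the coefficient of removing
    them from the final state in the opposite order. *)
Lemma addop_word la (x : nat -> G0_box) (s : seq nat) : stable (mem la) ->
  opword (fun a => addop (x a)) s (vec la) =
  if uniq (map x s) && all [predC la] (map x s)
  then word (addall la (map x s)) (map x s) *: vec (addall la (map x s)) else 0.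
Proof.
move=> st; elim: s => [|a s ih] /=.
  rewrite scale1r; congr vec; apply/fsetP => y; by rewrite in_addall orbF.
rewrite ih; set t := map x s; have [/andP[ut at_]|nu] := boolP (uniq t && all _ t);
  last first.
  rewrite linear0; case: ifP => // /andP[/andP[_ u] /andP[_ al]].
  by rewrite u al in nu.
rewrite ut at_ !andbT linearZ /=.
have [st'|ns] := pselect (stable (mem (addall la t))); last first.
  rewrite vec_out // linear0 scaler0; case: ifP => // /andP[nt nla].
  have [st2|] := pselect (stable (mem (addall la (x a :: t)))); last first.
    by move=> ns2; rewrite vec_out ?scaler0.
  rewrite word_cons -[rweight _ _]word1 word_remall ?mul0r ?scale0r //.
  suff -> : remall (addall la (x a :: t)) [:: x a] = addall la t by [].
  apply/fsetP => y; rewrite in_remall !in_addall !inE; case: eqP => [->|_] /=.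
    by rewrite andbF; apply/esym/negbTE/norP; split.
  by rewrite andbT.
rewrite (addop_vec _ st') in_addall.
have ea : (x a |` addall la t)%fset = addall la (x a :: t).
  by apply/fsetP => y; rewrite !(inE, in_addall) orbCA.
rewrite ea scalerA; case: ifPn.
  by case/orP => h; rewrite mulr0 scale0r ifF //; apply/negP => /andP[n1 n2];
     [rewrite h in n2 | rewrite h in n1].
rewrite negb_or => /andP[n1 n2]; rewrite n2 n1 /= word_cons mulrC.
congr ((_ * word _ _) *: _); apply/fsetP => y.
rewrite in_fsetD1 !in_addall !inE; case: eqP => [->|_] //=.
by rewrite (negbTE n1) (negbTE n2).
Qed.

(** ** Relations between these operators *)

Variables (q1 q2 q3 u : C).
Hypothesis hq : q1 * q2 * q3 = 1.
Hypothesis lpos_inj : injective (lpos q1 q2 q3 u).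
Hypothesis M_neq0 : forall x y, M x y != 0.
Hypothesis M_exchange : forall x y, x != y ->
  gbox q1 q2 q3 u x y != 0 -> gbox q1 q2 q3 u y x != 0 ->
  M y x * gbox q1 q2 q3 u y x = - sbox C x y * gbox q1 q2 q3 u x y * M x y.

Local Notation gbox := (gbox q1 q2 q3 u).
Local Notation sbox := (sbox C).

Lemma eq_remall la s t : s =i t -> remall la s = remall la t.
Proof. by move=> e; apply/fsetP => x; rewrite !in_remall e. Qed.

Lemma eq_addall la s t : s =i t -> addall la s = addall la t.
Proof. by move=> e; apply/fsetP => x; rewrite !in_addall e. Qed.

Lemma remop_quadratic la x y : stable (mem la) ->
  (sbox x y * gbox x y) *: remop x (remop y (vec la)) +
  gbox y x *: remop y (remop x (vec la)) = 0.
Proof.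
move=> st; pose xs (a : nat) := if a == 0%N then x else y.
have := remop_word xs [:: 0; 1]%N st; rewrite /= -/(remop x) => ->.
have := remop_word xs [:: 1; 0]%N st; rewrite /= -/(remop y) => ->.
rewrite (eq_remall _ (_ : [:: y; x] =i [:: x; y])); last first.
  by move=> z; rewrite !inE orbC.
rewrite !scalerA -scalerDl.
by rewrite (word_quadratic hq lpos_inj gam M_neq0 M_exchange x y st) scale0r.
Qed.

Lemma addop_quadratic la x y : stable (mem la) ->
  (sbox x y * gbox y x) *: addop x (addop y (vec la)) +
  gbox x y *: addop y (addop x (vec la)) = 0.
Proof.
move=> st; pose xs (a : nat) := if a == 0%N then x else y.
have := addop_word xs [:: 0; 1]%N st; rewrite /= -/(addop x) => ->.
have := addop_word xs [:: 1; 0]%N st; rewrite /= -/(addop y) => ->.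
rewrite !inE !andbT eq_sym [(y \notin la) && _]andbC; case: ifP => _; last first.
  by rewrite !scaler0 addr0.
rewrite (eq_addall _ (_ : [:: y; x] =i [:: x; y])); last first.
  by move=> z; rewrite !inE orbC.
have [st'|ns] := pselect (stable (mem (addall la [:: x; y]))); last first.
  by rewrite vec_out // !scaler0 addr0.
rewrite !scalerA -scalerDl sboxC.
by rewrite (word_quadratic hq lpos_inj gam M_neq0 M_exchange y x st') scale0r.
Qed.

(** Both readings of a word give the same relation, up to sign. *)
Lemma serre_list_rev (w : seq nat -> C) :
  \sum_(t <- serre_list q2) t.1 * w (rev t.2) =
  sum_perm3 (serre_word q2 (fun a b c d => w [:: a; b; c; d])).
Proof.
rewrite /serre_list !big_cat /= !big_cons !big_nil /rev /sum_perm3 /serre_word /=.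
ring.
Qed.

Lemma serre_list_sum (w : seq nat -> C) :
  \sum_(t <- serre_list q2) t.1 * w t.2 =
  - sum_perm3 (serre_word q2 (fun a b c d => w [:: a; b; c; d])).
Proof.
have n2 := q2_neq0 hq; rewrite /sum_perm3 /serre_word.
rewrite /serre_list !big_cat /= !big_cons !big_nil /=.
by field.
Qed.

Lemma remop_serre la (x : nat -> G0_box) : stable (mem la) ->
  G0_color (x 2%N) = G0_color (x 1%N) -> G0_color (x 3%N) = G0_color (x 1%N) ->
  G0_color (x 0%N) = G0_color (x 1%N) + 1 ->
  opserre q2 (fun a => remop (x a)) (vec la) = 0.
Proof.
move=> st c2 c3 c0; pose s := map x (iota 0 4).
have -> : opserre q2 (fun a => remop (x a)) (vec la) =
    (\sum_(t <- serre_list q2) t.1 * word la (rev (map x t.2))) *: vec (remall la s).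
  rewrite scaler_suml; apply: eq_big_seq => t ht.
  have [_ [h _]] := serre_list_uniq ht.
  rewrite (remop_word _ _ st) scalerA (eq_remall _ (_ : map x t.2 =i s)) //.
  by apply: eq_mem_map => i; rewrite h mem_iota.
have e := serre_words hq lpos_inj gam M_neq0 M_exchange st c2 c3 c0.
have := serre_list_rev (fun r => word la (map x r)); rewrite e.
by under eq_bigr => t _ do rewrite map_rev; move=> ->; rewrite scale0r.
Qed.

Lemma addop_serre la (x : nat -> G0_box) : stable (mem la) ->
  G0_color (x 2%N) = G0_color (x 1%N) -> G0_color (x 3%N) = G0_color (x 1%N) ->
  G0_color (x 0%N) = G0_color (x 1%N) + 1 ->
  opserre q2 (fun a => addop (x a)) (vec la) = 0.
Proof.
move=> st c2 c3 c0; pose s := map x (iota 0 4).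
have perm_t (t : C * seq nat) : t \in serre_list q2 -> perm_eq (map x t.2) s.
  move=> /serre_list_uniq[us [h _]]; apply: perm_map; apply: uniq_perm => // i.
  by rewrite h mem_iota.
have [ok|nok] := boolP (uniq s && all [predC la] s); last first.
  rewrite /opserre big_seq big1 // => t ht.
  have p := perm_t t ht; rewrite (addop_word _ _ st) (perm_uniq p) (perm_all _ p).
  by rewrite (negbTE nok) scaler0.
have [st'|ns] := pselect (stable (mem (addall la s))); last first.
  rewrite /opserre big_seq big1 // => t ht; have p := perm_t t ht.
  rewrite (addop_word _ _ st) (eq_addall _ (perm_mem p)) vec_out //.
  by rewrite !scaler0 if_same scaler0.
have -> : opserre q2 (fun a => addop (x a)) (vec la) =
    (\sum_(t <- serre_list q2) t.1 * word (addall la s) (map x t.2)) *: vec (addall la s).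
  rewrite scaler_suml; apply: eq_big_seq => t ht; have p := perm_t t ht.
  rewrite (addop_word _ _ st) (perm_uniq p) (perm_all _ p) ok scalerA.
  by rewrite (eq_addall _ (perm_mem p)).
have e := serre_words hq lpos_inj gam M_neq0 M_exchange st' c2 c3 c0.
have := serre_list_sum (fun r => word (addall la s) (map x r)); rewrite e oppr0.
by move=> ->; rewrite scale0r.
Qed.

End BoxOperators.

(** * The l-weights of states *)

Section LWeights.
Variables (C : fieldType) (q1 q2 q3 u : C).
Hypothesis hq : q1 * q2 * q3 = 1.
Hypothesis lpos_inj : injective (lpos q1 q2 q3 u).
Hypothesis u0 : u != 0.

Local Notation lpos := (lpos q1 q2 q3 u).
Local Notation bpos := (bpos q1 q2 q3 u).
Local Notation Afact := (Afact q1 q2 q3 u).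
Local Notation ell := (ell q1 q2 q3 u).
Local Notation gbox := (gbox q1 q2 q3 u).
Local Notation sbox := (sbox C).

Variable psc : 'Z_2 -> C.
Hypothesis psc_neq0 : forall i, psc i != 0.
Hypothesis psc_balanced : forall i,
  psc i * (psc i * lpos (i == 0, (-1, -1)) / lpos (i != 0, (0, 0))) = 1.

Implicit Types (b x y : G0_box) (i j : 'Z_2) (s : seq G0_box) (la : {fset G0_box}).

Definition Psifact i : factored C :=
  Factored (psc i) (map lpos (Psizeros i)) (map lpos (Psipoles i)).

Definition phifact s i : factored C :=
  fmul (Psifact i) (fprod (fun b => Afact b i) s).

Lemma phifact_zeros s i : fzeros (phifact s i) = map lpos (phizeros s i).
Proof.
rewrite /phifact /fmul /= fprod_zeros /phizeros /= map_flatten.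
by congr (_ :: flatten _); rewrite -map_comp.
Qed.

Lemma phifact_poles s i : fpoles (phifact s i) = map lpos (phipoles s i).
Proof.
rewrite /phifact /fmul /= fprod_poles /phipoles /= map_flatten.
by congr (_ :: flatten _); rewrite -map_comp.
Qed.

Lemma count_lpos (N : seq lattice) P : count_mem (lpos P) (map lpos N) = count_mem P N.
Proof. by rewrite count_map; apply: eq_count => Q /=; rewrite inj_eq. Qed.

Lemma phifact_ord s i P : ford (phifact s i) (lpos P) = phiorder s i P.
Proof.
by rewrite /ford phifact_zeros phifact_poles !count_lpos.
Qed.

Lemma Afact_ord b i P : ford (Afact b i) (lpos P) = boxorder b i P.
Proof. by rewrite /ford /= !count_lpos. Qed.

Lemma phifact_lead s i p :
  flead (phifact s i) p = flead (Psifact i) p * \prod_(b <- s) flead (Afact b i) p.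
Proof. by rewrite fleadM fprod_lead. Qed.

Lemma phifact_scal s i :
  fscal (phifact s i) = psc i * \prod_(b <- s) fscal (Afact b i).
Proof. by rewrite /= fprod_scal. Qed.

Lemma phifact_scal_neq0 s i : fscal (phifact s i) != 0.
Proof.
rewrite phifact_scal mulf_neq0 // prodf_seq_neq0; apply/allP => b _.
exact: Afact_scal_neq0.
Qed.

Lemma Afact_val0 b i : fscal (Afact b i) *
  (fscal (Afact b i) * \prod_(x <- fzeros (Afact b i)) x / \prod_(x <- fpoles (Afact b i)) x) = 1.
Proof.
have n1 := q1_neq0 hq; have n2 := q2_neq0 hq; have n3 := q3_neq0 hq.
have nb := bpos_neq0 hq u0 b.
have [->|n] := eqVneq i (G0_color b).
  rewrite Afact_same //= !big_cons !big_nil; field.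
  by rewrite ?n2 ?nb ?oner_neq0.
rewrite Afact_diff //= !big_cons !big_nil; field.
by rewrite ?n1 ?n3 ?nb ?oner_neq0.
Qed.

(** The product of the values at infinity and at 0: phi is balanced. *)
Lemma phifact_val0 s i : fscal (phifact s i) * (fscal (phifact s i) *
   \prod_(x <- fzeros (phifact s i)) x / \prod_(x <- fpoles (phifact s i)) x) = 1.
Proof.
pose F (f : factored C) := fscal f * (fscal f * \prod_(x <- fzeros f) x / \prod_(x <- fpoles f) x).
have FM f g : F (fmul f g) = F f * F g.
  by rewrite /F /= !big_cat /= invfM; ring.
rewrite -/(F _) FM [F (Psifact i)](_ : _ = 1) ?mul1r; last first.
  by rewrite /F /= !big_cons !big_nil !mulr1 psc_balanced.
elim: s => [|b s ih]; first by rewrite /F /= !big_nil divr1 !mulr1.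
by rewrite /= FM ih mulr1; apply: Afact_val0.
Qed.

Lemma phifact_size s i : size (fzeros (phifact s i)) = size (fpoles (phifact s i)).
Proof.
rewrite phifact_zeros phifact_poles !size_map !size_cat /=; congr _.+1.
elim: s => //= b s ih; rewrite !size_cat ih; congr (_ + _)%N.
by rewrite /Azeros /Apoles; case: ifP.
Qed.

Definition boundary la b := convex (mem la) b || concave (mem la) b.

Lemma boundary_range la b : stable (mem la) -> boundary la b ->
  b \in boxrange (boxrank la).+2.
Proof.
move=> st; case/orP => [/convex_mem /(@boxrank_sub la)|cb].
  by apply: boxrange_le; rewrite -addn2 leq_addr.
have nb := concave_notin cb; apply: (boxrange_le (leqnSn _)).
apply: (add_stable_range _ nb (@boxrank_sub la)).
apply: (eq_stable (A := [pred x | (x == b) || mem la x])).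
  by move=> x; rewrite /= !inE.
by apply/concaveP.
Qed.

(** A concave box exceeds the range of la by at most one; the larger range serves
    for products of two modes as well. *)
Definition polelist la i : seq G0_box :=
  [seq b <- boxrange (boxrank la).+2 | (G0_color b == i) && boundary la b].

(** The expansion is written down as a constant plus polar parts, so that the
    difference of the two expansions is visible. *)
Definition eigen (dir : bool) la i : int -> C :=
  simple_series dir (fscal (phifact la i))
    [seq (bpos b, flead (phifact la i) (bpos b)) | b <- polelist la i].

(** Poles away from the boundary would contradict the count of orders. *)
Lemma phifact_simple la i : stable (mem la) ->
  fval (phifact la i) = (fscal (phifact la i))%:P%:F +
    \sum_(p <- map bpos (polelist la i))
      (flead (phifact la i) p)%:P%:F / ('X - p%:P)%:F /\
  fscal (phifact la i) * \prod_(x <- fzeros (phifact la i)) x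
    / \prod_(x <- fpoles (phifact la i)) x
  = fscal (phifact la i)
    - \sum_(p <- map bpos (polelist la i)) flead (phifact la i) p / p.
Proof.
move=> st; have ul := fset_uniq la.
have inL p : p \in map bpos (polelist la i) -> ford (phifact la i) p = -1.
  case/mapP => b; rewrite mem_filter => /andP[/andP[/eqP <- bd] _] ->.
  rewrite phifact_ord -lcolor_box; apply/(phiorder_boundary _ st ul).2.
  by exists b.
have notinL p : p \notin map bpos (polelist la i) -> 0 <= ford (phifact la i) p.
  move=> np; have [[P eP]|nP] := pselect (exists P, p = lpos P); last first.
    rewrite /ford [X in _ - X%:Z](_ : _ = 0%N) ?subr0 //.
    apply/count_memPn; rewrite phifact_poles; apply/mapP => -[P _ e].
    by apply: nP; exists P.
  move: np; rewrite eP phifact_ord => np.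
  have [ci|nci] := eqVneq (lcolor P) i; last by rewrite phiorder_color.
  have [h1 h2] := phiorder_boundary P st ul; rewrite -ci.
  suff : phiorder la (lcolor P) P <> -1 by move: h1; lia.
  move=> /h2[b eb bd]; case/negP: np; apply/mapP; exists b; last by rewrite -eb.
  by rewrite mem_filter boundary_range // andbT -ci -eb lcolor_box eqxx.
have uL : uniq (map bpos (polelist la i)).
  rewrite map_inj_uniq ?filter_uniq ?boxrange_uniq //; exact: bpos_inj.
have [h1 h2] := fval_partial_fractions (phifact_size la i) uL inL notinL.
have z0 P : 0 \notin map lpos P.
  by apply/mapP => -[Q _ e]; have := lpos_neq0 hq u0 Q; rewrite -e eqxx.
split; first exact: h1.
by apply: h2; rewrite ?phifact_zeros ?phifact_poles.
Qed.

Lemma eigen_expansion dir la i : stable (mem la) ->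
  expansion dir (fval (phifact la i)) (eigen dir la i).
Proof.
move=> st; rewrite (phifact_simple i st).1.
have := @expansion_simple C dir (fscal (phifact la i))
    [seq (bpos b, flead (phifact la i) (bpos b)) | b <- polelist la i].
rewrite !big_map; apply => pr /mapP[b _ ->]; exact: bpos_neq0.
Qed.

Lemma eigen0 la i : stable (mem la) -> eigen true la i 0 = fscal (phifact la i) /\
  eigen false la i 0 = (fscal (phifact la i))^-1.
Proof.
move=> st; rewrite /eigen; have [-> ->] := simple_series0 (fscal (phifact la i))
  [seq (bpos b, flead (phifact la i) (bpos b)) | b <- polelist la i].
split=> //; have := (phifact_simple i st).2; rewrite !big_map /= => <-.
apply: (mulfI (phifact_scal_neq0 la i)); rewrite phifact_val0.
by rewrite divff ?phifact_scal_neq0.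
Qed.

Lemma eigen_out dir la i m : (if dir then m < 0 else 0 < m) -> eigen dir la i m = 0.
Proof. exact: simple_series_out. Qed.

Lemma eigen_diff la i m : eigen true la i m - eigen false la i m =
  \sum_(b <- polelist la i) flead (phifact la i) (bpos b) / bpos b * bpos b ^ m.
Proof.
rewrite simple_series_diff ?big_map // => pr /mapP[b _ ->]; exact: bpos_neq0.
Qed.

(** ** Matrix coefficients *)

Variable kap : C.
(** The coefficient of removing b is a residue of the l-weight of the boxes below
    b, that of adding b a value of the product over the boxes above b: so a box x
    enters exactly one of the two, according to its place. *)
Definition gamE b : C := kap * (flead (Psifact (G0_color b)) (bpos b) / bpos b).
Definition ME x b : C := if (x < b)%O then ell x b else 1.
Definition gamF b : C := 1.
Definition MF x b : C := if (b < x)%O then ell x b else 1.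

Lemma ME_neq0 x b : ME x b != 0.
Proof. by rewrite /ME; case: ifP => _; rewrite ?oner_neq0 // ell_neq0. Qed.

Lemma MF_neq0 x b : MF x b != 0.
Proof. by rewrite /MF; case: ifP => _; rewrite ?oner_neq0 // ell_neq0. Qed.

Lemma MEF x b : x != b -> ME x b * MF x b = ell x b.
Proof.
rewrite /ME /MF; case: (ltgtP x b) => [lt|lt|->]; rewrite ?mulr1 ?mul1r ?eqxx //.
Qed.

Lemma ell_exchange x y : gbox x y != 0 -> gbox y x != 0 -> ell x y * ell y x = 1.
Proof.
move=> g1 g2; rewrite !ellE // [sbox y x]sboxC.
have -> : - sbox x y * gbox y x / gbox x y * (- sbox x y * gbox x y / gbox y x) =
   (sbox x y * sbox x y) * (gbox y x / gbox y x) * (gbox x y / gbox x y) by ring.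
by rewrite sbox2 !divff // !mulr1.
Qed.

Lemma ell_g x y : gbox x y != 0 -> gbox y x != 0 ->
  ell x y * gbox x y = - sbox x y * gbox y x.
Proof. by move=> g1 g2; rewrite ellE // divfK. Qed.

Lemma ME_exchange x y : x != y -> gbox x y != 0 -> gbox y x != 0 ->
  ME y x * gbox y x = - sbox x y * gbox x y * ME x y.
Proof.
move=> xy g1 g2; rewrite /ME; case: (ltgtP x y) => [lt|lt|e]; last by rewrite e eqxx in xy.
  rewrite mul1r -mulrA [gbox x y * _]mulrC ell_g // mulrA mulrNN.
  by rewrite sbox2 mul1r.
by rewrite mulr1 ell_g // sboxC.
Qed.

Lemma MF_exchange x y : x != y -> gbox x y != 0 -> gbox y x != 0 ->
  MF y x * gbox y x = - sbox x y * gbox x y * MF x y.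
Proof.
move=> xy g1 g2; rewrite /MF; case: (ltgtP x y) => [lt|lt|e]; last by rewrite e eqxx in xy.
  by rewrite mulr1 ell_g // sboxC.
rewrite mul1r -mulrA [gbox x y * _]mulrC ell_g // mulrA mulrNN.
by rewrite sbox2 mul1r.
Qed.

Lemma weightEF la b :
  weight gamE ME la b * weight gamF MF la b =
  gamE b * \prod_(x <- (la `\ b)%fset) ell x b.
Proof.
rewrite /weight /gamF mul1r -mulrA -big_split; congr (_ * _).
by apply: eq_big_seq => x; rewrite in_fsetD1 => /andP[xb _]; apply: MEF.
Qed.

(** The product of the two coefficients contains every box once and is therefore
    the residue of the full l-weight, except that for b in la the factor of b
    itself, which is -1, has to be removed. *)
Lemma weightEF_convex la b : b \in la ->
  weight gamE ME la b * weight gamF MF la b =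
  - (kap * (flead (phifact la (G0_color b)) (bpos b) / bpos b)).
Proof.
move=> bla; rewrite weightEF phifact_lead (big_fsetD1 b bla) /=.
rewrite -/(ell b b) ell_self // /gamE.
rewrite (eq_bigr (fun x => ell x b)) //; ring.
Qed.

Lemma weightEF_concave la b : b \notin la ->
  weight gamE ME (b |` la)%fset b * weight gamF MF (b |` la)%fset b =
  kap * (flead (phifact la (G0_color b)) (bpos b) / bpos b).
Proof.
move=> bla; rewrite weightEF phifact_lead fsetU1K // /gamE.
rewrite [in RHS](eq_bigr (fun x => ell x b)) //; ring.
Qed.

(** Two removable boxes do not cover each other, so the exchange relation of the
    factors has no vanishing terms. *)
Lemma ME_MF la b b' : stable (mem la) -> convex (mem la) b -> convex (mem la) b' ->
  b != b' -> ME b' b * MF b b' = 1.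
Proof.
move=> st cb cb' nbb; rewrite /ME /MF; case: ifP => _; last by rewrite mulr1.
have h x y : convex (mem la) x -> convex (mem la) y -> gbox x y != 0.
  move=> cx cy; rewrite (gbox_eq0 hq lpos_inj) negb_or.
  rewrite (convex_not_covers cx (convex_mem cy)).
  exact: (convex_not_covers2 st cy (convex_mem cx)).
by apply: ell_exchange; apply: h.
Qed.

Lemma weightE_lead la b : b \in la -> weight gamE ME la b =
  kap * (flead (phifact [seq x <- la | (x < b)%O] (G0_color b)) (bpos b) / bpos b).
Proof.
move=> bla; rewrite phifact_lead /weight /gamE.
have -> : \prod_(x <- (la `\ b)%fset) ME x b =
    \prod_(x <- [seq x <- la | (x < b)%O]) ell x b.
  rewrite big_filter [RHS]big_mkcond [RHS](big_fsetD1 b bla) /= ltxx mul1r.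
  by apply: eq_bigr => x _.
rewrite /ell; ring.
Qed.

Lemma weightF_lead la b : b \notin la -> weight gamF MF (b |` la)%fset b =
  flead (fprod (fun x => Afact x (G0_color b)) [seq x <- la | (b < x)%O]) (bpos b).
Proof.
move=> bla; rewrite fprod_lead /weight /gamF mul1r fsetU1K // big_filter.
by rewrite [RHS]big_mkcond; apply: eq_bigr => x _.
Qed.

(** ** Commutation with K *)

(** The structure function g(z, y) as a polynomial in z, and g(y, z) for
    Hpoly. *)
Definition Gpoly i j (y : C) : {poly C} :=
  if i == j then 'X - (q2 * y)%:P else ('X - (q1 * y)%:P) * ('X - (q3 * y)%:P).
Definition Hpoly i j (y : C) : {poly C} :=
  if i == j then y%:P - q2 *: 'X else (y%:P - q1 *: 'X) * (y%:P - q3 *: 'X).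

Lemma Afact_GH b i :
  (sign C i (G0_color b) *: Gpoly i (G0_color b) (bpos b))%:F =
  (- Hpoly (G0_color b) i (bpos b))%:F * fval (Afact b i).
Proof.
have n1 := q1_neq0 hq; have n2 := q2_neq0 hq; have n3 := q3_neq0 hq.
set p := bpos b; have key (P Q R : {poly C}) : Q != 0 -> P * Q = R ->
    P%:F = R%:F / Q%:F.
  by move=> Q0 <-; rewrite tofracM mulfK // tofrac_neq0.
rewrite /fval mulrA -tofracM -tofracM; apply: key; first exact: polyroots_neq0.
rewrite /sign /Gpoly /Hpoly [G0_color b == i]eq_sym.
have [->|n] := eqVneq i (G0_color b).
  rewrite Afact_same //= /polyroots !big_cons !big_nil !mulr1 -/p scale1r.
  have -> : - (p%:P - q2 *: 'X) = q2%:P * ('X - (q2^-1 * p)%:P).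
    by rewrite opprB mulrBr -polyCM mulrA divff // mul1r mul_polyC.
  have e : q2%:P * q2^-1%:P = 1 :> {poly C} by rewrite -polyCM divff.
  transitivity ((q2%:P * q2^-1%:P) * ('X - (q2 * p)%:P) * ('X - (q2^-1 * p)%:P)).
    by rewrite e mul1r.
  by rewrite !mulrA; ring.
rewrite Afact_diff //= /polyroots !big_cons !big_nil !mulr1 -/p scaleN1r.
have h c : c != 0 -> p%:P - c *: 'X = - c%:P * ('X - (c^-1 * p)%:P).
  by move=> c0; rewrite mulNr mulrBr -polyCM mulrA divff // mul1r mul_polyC opprB.
rewrite !h //.
have e : q1%:P * q3%:P * (q1 * q3)^-1%:P = 1 :> {poly C}.
  by rewrite -!polyCM divff ?mulf_neq0.
set X1 := 'X - (q1 * p)%:P; set X3 := 'X - (q3 * p)%:P.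
set Y1 := 'X - _; set Y3 := 'X - _.
transitivity (- (q1%:P * q3%:P * (q1 * q3)^-1%:P) * (X1 * X3 * (Y1 * Y3))).
  by rewrite e mulN1r mulNr.
by ring.
Qed.

Lemma phifact_rem la b i : b \in la ->
  fval (phifact la i) = fval (Afact b i) * fval (phifact (la `\ b)%fset i).
Proof.
move=> bla; rewrite !fvalM !fprod_val (big_fsetD1 b bla) /=.
by rewrite mulrCA.
Qed.

Lemma eigen_rem dir la b i m : stable (mem la) -> convex (mem la) b ->
  sign C i (G0_color b) * pact (Gpoly i (G0_color b) (bpos b)) (eigen dir (la `\ b)%fset i) m +
  pact (Hpoly (G0_color b) i (bpos b)) (eigen dir la i) m = 0.
Proof.
move=> st cb; have st' := stable_rem st cb.
have e : (sign C i (G0_color b) *: Gpoly i (G0_color b) (bpos b))%:F *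
    fval (phifact (la `\ b)%fset i) =
    (- Hpoly (G0_color b) i (bpos b))%:F * fval (phifact la i).
  by rewrite Afact_GH (phifact_rem _ (convex_mem cb)); apply/esym/mulrA.
have := expansion_mul (eigen_expansion dir i st') (eigen_expansion dir i st) e m.
by rewrite pactZ pactN => ->; rewrite addNr.
Qed.

End LWeights.

(** * Modules over presented algebras *)

Section FreeEval.
Variables (C : fieldType) (G : choiceType) (V : lmodType C).
Variable rho : G -> {linear V -> V}.
Local Notation FA := (free_alg C G).
Implicit Types (x y : FA) (v w : V).

Definition wact (s : seq G) v : V := foldr (fun g w => rho g w) v s.

Lemma wact_is_linear s : linear (wact s).
Proof.
move=> c v w; elim: s => [//|g s ih].
by rewrite /wact /= in ih *; rewrite ih linearP.
Qed.

HB.instance Definition _ s := GRing.isLinear.Build C V V *:%R (wact s) (wact_is_linear s).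

Definition feval x v : V := \sum_(m <- msupp x) x@_m *: wact m v.

Lemma fevalEw (D : {fset {fmonom G}}) x v : (msupp x `<=` D)%fset ->
  feval x v = \sum_(m <- D) x@_m *: wact m v.
Proof.
move=> sD; rewrite /feval (big_fset_incl _ sD) // => m _ /mcoeff_outdom ->.
by rewrite scale0r.
Qed.

Lemma feval_is_linear x : linear (feval x).
Proof.
move=> c v w; rewrite /feval scaler_sumr -big_split; apply: eq_bigr => m _ /=.
by rewrite linearP scalerDr !scalerA mulrC.
Qed.

HB.instance Definition _ x := GRing.isLinear.Build C V V *:%R (feval x) (feval_is_linear x).

Lemma fevalP c x y v : feval (c *: x + y) v = c *: feval x v + feval y v.
Proof.
pose D := (msupp x `|` msupp y `|` msupp (c *: x + y))%fset.
rewrite !(@fevalEw D); last first.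
- by apply/fsubsetP => l; rewrite !inE => ->; rewrite ?orbT.
- by apply/fsubsetP => l; rewrite !inE => ->; rewrite ?orbT.
- by apply/fsubsetP => l; rewrite !inE => ->; rewrite ?orbT.
rewrite scaler_sumr -big_split; apply: eq_bigr => l _ /=.
by rewrite mcoeffD mcoeffZ scalerDl scalerA.
Qed.

Lemma feval0 v : feval 0 v = 0.
Proof. by rewrite /feval msupp0 big_seq_fset0. Qed.

Lemma fevalZ c x v : feval (c *: x) v = c *: feval x v.
Proof. by rewrite -[c *: x]addr0 fevalP feval0 addr0. Qed.

Lemma fevalD x y v : feval (x + y) v = feval x v + feval y v.
Proof. by rewrite -{1}[x]scale1r fevalP scale1r. Qed.

Lemma fevalB x y v : feval (x - y) v = feval x v - feval y v.
Proof. by rewrite fevalD -[- y]scaleN1r fevalZ scaleN1r. Qed.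

Lemma feval_sum (I : Type) (r : seq I) (Q : pred I) (F : I -> FA) v :
  feval (\sum_(i <- r | Q i) F i) v = \sum_(i <- r | Q i) feval (F i) v.
Proof. by apply: (big_morph (feval^~ v)) => [x y|]; rewrite ?fevalD ?feval0. Qed.

Lemma fevalU c (m : {fmonom G}) v : feval << c *g m >> v = c *: wact m v.
Proof.
by rewrite (fevalEw v msuppU_le) big_seq_fset1 mcoeffUU.
Qed.

Lemma feval_gen g v : feval (free_gen C g) v = rho g v.
Proof. by rewrite fevalU scale1r /wact fmU. Qed.

Lemma feval1 v : feval 1 v = v.
Proof. by rewrite [1](_ : _ = << 1 *g mone >>) // fevalU scale1r /wact fm1. Qed.

Lemma fevalM x y v : feval (x * y) v = feval x (feval y v).
Proof.
rewrite malgME feval_sum [in RHS]/feval; apply: eq_bigr => m _.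
rewrite feval_sum linear_sum scaler_sumr; apply: eq_bigr => m' _ /=.
by rewrite fevalU linearZ scalerA /= /wact fmM foldr_cat.
Qed.

Variable X : FA -> Prop.
Hypothesis X_vanish : forall x, X x -> forall v, feval x v = 0.

Lemma feval_ideal x v : ideal_of X x -> feval x v = 0.
Proof.
elim=> [|y z _ iy _ iz|y z w Xz]; first exact: feval0.
  by rewrite fevalD iy iz addr0.
rewrite !fevalM (X_vanish Xz); exact: (linear0 (feval y)).
Qed.

Definition pres_act (x : presented X) v : V := feval (repr x) v.

Lemma pres_act_pi x v : pres_act (presented_pi X x) v = feval x v.
Proof.
apply/eqP; rewrite -subr_eq0 -fevalB; apply/eqP/feval_ideal.
exact: presented_reprP.
Qed.

Lemma pres_actDl (x y : presented X) v : pres_act (x + y) v = pres_act x v + pres_act y v.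
Proof.
by rewrite -[x]presented_piK -[y]presented_piK -presented_piD !pres_act_pi fevalD.
Qed.

Lemma pres_actZl c (x : presented X) v : pres_act (c *: x) v = c *: pres_act x v.
Proof.
rewrite -[x]presented_piK [c *: _]presented_piZ.
by rewrite !pres_act_pi fevalZ.
Qed.

Lemma pres_act1 v : pres_act 1 v = v.
Proof. by rewrite [1](erefl : _ = presented_pi X 1) pres_act_pi feval1. Qed.

Lemma pres_actM (x y : presented X) v : pres_act (x * y) v = pres_act x (pres_act y v).
Proof.
rewrite -[x]presented_piK -[y]presented_piK [_ * _]presented_piM.
by rewrite !pres_act_pi fevalM.
Qed.

(** ** Power series that act by scalars *)

Lemma feval_series_pow (U : nat -> FA) (a : nat -> C^o) v m n :
  (forall r, feval (U r) v = a r *: v) ->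
  feval (series_pow U m n) v = (series_pow a m n : C) *: v.
Proof.
move=> h; elim: m n => [|m ih] n.
  rewrite /series_pow /=; case: (n == 0)%N; first by rewrite feval1 scale1r.
  by rewrite feval0 scale0r.
rewrite -[series_pow U m.+1 n]/(\sum_(r < n.+1) U r * series_pow U m (n - r)%N).
rewrite -[series_pow a m.+1 n]/(\sum_(r < n.+1) a r * series_pow a m (n - r)%N).
rewrite feval_sum scaler_suml; apply: eq_bigr => r _.
by rewrite fevalM ih linearZ /= h scalerA mulrC.
Qed.

Lemma feval_series_exp (U : nat -> FA) (a : nat -> C^o) v n :
  (forall r, feval (U r) v = a r *: v) ->
  feval (series_exp U n) v = (series_exp a n : C) *: v.
Proof.
move=> h; rewrite /series_exp feval_sum scaler_suml; apply: eq_bigr => m _.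
by rewrite fevalZ (feval_series_pow _ _ h) scalerA.
Qed.

Lemma feval_pms2 P (T : int -> int -> FA) m n v :
  feval (poly_mul_series2 P T m n) v = pms2 P (fun m n => feval (T m n) v) m n.
Proof.
rewrite /poly_mul_series2 feval_sum; apply: eq_bigr => a _.
by rewrite feval_sum; apply: eq_bigr => b _; rewrite fevalZ.
Qed.

Lemma feval_quadratic c P T Q U (t t' : int -> int -> V) m n v :
  (forall m n, feval (T m n) v = t m n) -> (forall m n, feval (U m n) v = t' m n) ->
  feval (c *: poly_mul_series2 P T m n + poly_mul_series2 Q U m n) v =
  c *: pms2 P t m n + pms2 Q t' m n.
Proof.
by move=> e e'; rewrite fevalD fevalZ !feval_pms2 (eq_pms2 _ _ _ e) (eq_pms2 _ _ _ e').
Qed.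

Lemma feval_pcomm p x y v : feval (pcomm p x y) v = ocomm p (feval x) (feval y) v.
Proof. by rewrite /pcomm fevalB fevalZ !fevalM. Qed.

End FreeEval.

(** * Separation of states by their l-weights *)

(** Unique factorization: cancelled zeros and poles do not affect the orders. *)
Lemma fval_ord (C : fieldType) (F G : factored C) p :
  fscal F != 0 -> fscal G != 0 -> fval F = fval G -> ford F p = ford G p.
Proof.
move=> F0 G0 /eqP; rewrite /fval eqr_div ?tofrac_neq0 ?polyroots_neq0 //.
rewrite -!tofracM tofrac_eq -!mulrA -!polyroots_cat => /eqP e.
have es : fscal F = fscal G.
  have := congr1 lead_coef e.
  by rewrite !lead_coefM !lead_coefC !(monicP (polyroots_monic _)) !mulr1.
have e' : polyroots (fzeros F ++ fpoles G) = polyroots (fzeros G ++ fpoles F).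
  by apply: (mulfI (_ : (fscal F)%:P != 0)); rewrite ?polyC_eq0 // e es.
have /seq.permP /(_ (pred1 p)) := prod_XsubC_eq e'.
by rewrite /ford !count_cat; lia.
Qed.

(** The order at (y, x) sees the corner (y + 1, x + 1) of the diagram and
    otherwise only positions on lower antidiagonals, so the orders determine
    the diagram one antidiagonal at a time. *)
Lemma order_at_inj (e e' : int -> int -> bool) :
  (forall y x : int, (y < 0) || (x < 0) -> e y x = e' y x) ->
  (forall y x, order_at e y x = order_at e' y x) ->
  forall y x, e y x = e' y x.
Proof.
move=> neg h; suff H (n : nat) y x : y + x < n%:Z -> e y x = e' y x.
  by move=> y x; apply: (H `|y + x|.+1); lia.
elim: n y x => [|n ih] y x lt; first by apply: neg; lia.
have := h (y - 1) (x - 1); rewrite /order_at !subrK.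
rewrite (ih y (x - 1)) ?(ih (y - 1) x) ?(ih (y - 1 - 1) (x - 1 - 1)); try lia.
rewrite (ih (y - 1 - 1) (x - 1)) ?(ih (y - 1) (x - 1 - 1)); try lia.
by move=> /addrI /oppr_inj; case: (e y x); case: (e' y x).
Qed.

Lemma phiorder_inj (la la' : {fset G0_box}) :
  (forall i P, phiorder la i P = phiorder la' i P) -> la = la'.
Proof.
move=> h; apply/fsetP => -[z [k x]].
have e : forall y x' : int, ext (mem la) z y x' = ext (mem la') z y x'.
  apply: order_at_inj => y x'; first by move=> lt; rewrite /ext !orbA lt.
  by rewrite -!phiorder_ext ?fset_uniq // h.
by have := e k%:Z x%:Z; rewrite !ext_nat.
Qed.

Section Separation.
Variables (C : fieldType) (q1 q2 q3 u : C) (psc : 'Z_2 -> C).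
Hypothesis hq : q1 * q2 * q3 = 1.
Hypothesis u0 : u != 0.
Hypothesis lpos_inj : injective (lpos q1 q2 q3 u).
Hypothesis psc_neq0 : forall i, psc i != 0.

(** Expansions determine the rational functions, these their orders at all lattice
    points, and these the state. *)
Lemma eigen_inj (la la' : {fset G0_box}) :
  stable (mem la) -> stable (mem la') ->
  (forall i, eigen q1 q2 q3 u psc true la i =1 eigen q1 q2 q3 u psc true la' i) ->
  la = la'.
Proof.
move=> st st' h; apply: phiorder_inj => i P.
rewrite -!(phifact_ord lpos_inj psc).
apply: fval_ord; rewrite ?phifact_scal_neq0 //.
have e1 := eigen_expansion hq lpos_inj u0 psc true i st.
have e2 := eigen_expansion hq lpos_inj u0 psc true i st'.
exact: expansion_inj e1 e2 (h i).
Qed.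

End Separation.

Lemma inv_outer (C : fieldType) (a b c : C) : a * b * c = 1 -> (a * c)^-1 = b.
Proof.
move=> h; have h' : b * (a * c) = 1 by rewrite mulrCA mulrA.
have n : a * c != 0 by apply: contra_eq_neq h' => ->; rewrite mulr0 eq_sym oner_eq0.
by rewrite -[LHS]mul1r -h' -mulrA divff // mulr1.
Qed.

(** * Irreducibility from separated weights *)

(** A box that is not removable is covered by another one, and going up must come
    to an end. *)
Lemma exists_convex (la : {fset G0_box}) : la != fset0 ->
  exists b, convex (mem la) b.
Proof.
case/fset0Pn => b bla; set A := mem la.
suff H (n : nat) (x : G0_box) : A x -> (boxrank la <= x.2.1 + x.2.2 + n)%N ->
    exists b, convex A b by apply: (H (boxrank la) b bla); apply: leq_addl.
elim: n x => [|n ih] x ax le.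
  have /= := boxrank_sub ax; case: x ax le => z [k y] ax le.
  have lt : (k + y < boxrank la)%N.
    by rewrite /boxrank (big_rem _ ax) /= leq_max ltnSn.
  by move: le; rewrite addn0 leqNgt lt.
have [cv|ncv] := boolP (convex A x); first by exists x.
have [y ay] := not_convex_covers ax ncv; case: x y ax le ncv ay => z [k x] [z' [k' x']].
move=> ax le ncv ay; rewrite coversE => /andP[_ h]; apply: (ih _ ay) => /=.
by move: le => /=; case/orP: h => /andP[/eqP -> /eqP ->]; lia.
Qed.

(** The argument only needs diagonal operators that separate the states and, for
    each colour, one operator that removes and one that adds boxes. *)
Section Simple.
Variables (C : fieldType) (V : lmodType C) (vec : {fset G0_box} -> V).
Variables (I : Type) (L : I -> {linear V -> V}) (e : I -> {fset G0_box} -> C).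
Hypothesis L_vec : forall t la, stable (mem la) -> L t (vec la) = e t la *: vec la.
Hypothesis e_inj : forall la la', stable (mem la) -> stable (mem la') ->
  (forall t, e t la = e t la') -> la = la'.
Variable W : V -> Prop.
Hypothesis W0 : W 0.
Hypothesis WD : forall v w, W v -> W w -> W (v + w).
Hypothesis WZ : forall c v, W v -> W (c *: v).
Hypothesis WL : forall t v, W v -> W (L t v).
Implicit Types (la : {fset G0_box}) (v w : V).

(** An operator that separates la0 from one of the other states can be corrected
    by a scalar to kill this state; it then rescales the component of la0. *)
Lemma weight_component (T : Type) (s : seq T) (F : T -> {fset G0_box}) (P : pred T)
    (c : T -> C) la0 c0 : stable (mem la0) ->
  (forall x, P x -> stable (mem (F x)) /\ F x <> la0) ->
  W (c0 *: vec la0 + \sum_(x <- s | P x) c x *: vec (F x)) -> W (c0 *: vec la0).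
Proof.
move=> st0; elim: s c c0 => [|x s ih] c c0 h; first by rewrite big_nil addr0.
rewrite big_cons; case: ifP => [Px|_]; last exact: ih.
have [stx nx] := h x Px.
have [t nt] : exists t, e t la0 <> e t (F x).
  apply: contrapT => n; apply/nx/esym/e_inj => // t.
  by apply: contrapT => m; apply: n; exists t.
set v := (X in W X) => Wv.
have d0 : e t la0 - e t (F x) != 0 by rewrite subr_eq0; apply/eqP.
have: W (L t v + (- e t (F x)) *: v) by apply: WD; [apply: WL | apply: WZ].
have -> : L t v + (- e t (F x)) *: v = ((e t la0 - e t (F x)) * c0) *: vec la0 +
    \sum_(y <- s | P y) ((e t (F y) - e t (F x)) * c y) *: vec (F y).
  have key a la : stable (mem la) -> L t (a *: vec la) - e t (F x) *: (a *: vec la) =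
      ((e t la - e t (F x)) * a) *: vec la.
    by move=> st; rewrite linearZ /= L_vec // !scalerA -scalerBl mulrBl mulrC.
  rewrite /v linearD scaleNr scalerDr opprD addrACA key //; congr (_ + _).
  rewrite linearD scalerDr opprD addrACA key // subrr mul0r scale0r add0r.
  rewrite linear_sum scaler_sumr -sumrB; apply: eq_bigr => y Py.
  by apply: key; have [] := h y Py.
move/(ih _ _ h) => /(WZ (e t la0 - e t (F x))^-1).
by rewrite scalerA mulrA mulVf // mul1r.
Qed.

Lemma weight_component_sum (T : eqType) (s : seq T) (F : T -> {fset G0_box})
    (c : T -> C) x0 : uniq s -> x0 \in s ->
  (forall x, x \in s -> stable (mem (F x))) -> {in s &, injective F} ->
  W (\sum_(x <- s) c x *: vec (F x)) -> W (c x0 *: vec (F x0)).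
Proof.
move=> us xs st inj; rewrite (bigD1_seq x0) //= big_seq_cond.
apply: weight_component; first exact: st.
move=> x /andP[xs' nx]; split; first exact: st.
by move=> eF; move/eqP: nx; apply; apply: inj.
Qed.

Hypothesis vec_span : forall v, exists (s : seq {fset G0_box}) (c : {fset G0_box} -> C),
  [/\ uniq s, forall la, la \in s -> stable (mem la) & v = \sum_(la <- s) c la *: vec la].

Variables (cE cF : {fset G0_box} -> G0_box -> C).
Hypothesis cE_neq0 : forall la b, cE la b != 0.
Hypothesis cF_neq0 : forall la b, cF la b != 0.
Variables (Em Fm : 'Z_2 -> {linear V -> V}) (sE sF : {fset G0_box} -> 'Z_2 -> seq G0_box).
Hypothesis Em_vec : forall i la, stable (mem la) ->
  Em i (vec la) = \sum_(b <- sE la i) cE la b *: vec (la `\ b)%fset.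
Hypothesis Fm_vec : forall i la, stable (mem la) ->
  Fm i (vec la) = \sum_(b <- sF la i) cF la b *: vec (b |` la)%fset.
Hypothesis sE_uniq : forall la i, uniq (sE la i).
Hypothesis sF_uniq : forall la i, uniq (sF la i).
Hypothesis sE_mem : forall la i b, stable (mem la) ->
  (b \in sE la i) = (G0_color b == i) && convex (mem la) b.
Hypothesis sF_mem : forall la i b, stable (mem la) ->
  (b \in sF la i) = (G0_color b == i) && concave (mem la) b.
Hypothesis WE : forall i v, W v -> W (Em i v).
Hypothesis WF : forall i v, W v -> W (Fm i v).

Lemma lower_state la b : stable (mem la) -> convex (mem la) b ->
  W (vec la) -> W (vec (la `\ b)%fset).
Proof.
move=> st cb /(WE (G0_color b)); rewrite Em_vec //.
move/(@weight_component_sum _ _ _ _ b (sE_uniq _ _)) => h.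
rewrite -[vec _](scale1r) -(mulVf (cE_neq0 la b)) -scalerA; apply: WZ; apply: h.
- by rewrite sE_mem // eqxx.
- by move=> x; rewrite sE_mem // => /andP[_]; apply: stable_rem.
move=> x y; rewrite !sE_mem // => /andP[_ /convex_mem cx] /andP[_ cy] /fsetP /(_ x).
rewrite !inE eqxx /= [x \in la]cx andbT => /esym/negbT; rewrite negbK.
exact: eqP.
Qed.

(** The mirror image of the previous lemma; the components are separated because
    different boxes lead to different states. *)
Lemma raise_state la b : stable (mem la) -> stable (mem (b |` la)%fset) -> b \notin la ->
  W (vec la) -> W (vec (b |` la)%fset).
Proof.
move=> st st' nb /(WF (G0_color b)); rewrite Fm_vec //.
have ccP x : concave (mem la) x -> stable (mem (x |` la)%fset).
  move=> cx; have nx : ~~ (mem la) x := concave_notin cx.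
  by apply: eq_stable (elimT (concaveP st nx) cx) => y; rewrite /= !inE.
have cb : concave (mem la) b.
  by apply/concaveP => //; apply: eq_stable st' => y; rewrite /= !inE.
move/(@weight_component_sum _ _ _ _ b (sF_uniq _ _)) => h.
rewrite -[vec _](scale1r) -(mulVf (cF_neq0 la b)) -scalerA; apply: WZ; apply: h.
- by rewrite sF_mem // eqxx.
- by move=> x; rewrite sF_mem // => /andP[_]; apply: ccP.
move=> x y; rewrite !sF_mem // => /andP[_ /concave_notin cx] /andP[_ cy] /fsetP /(_ x).
have cx' : (x \in la) = false by apply/negbTE.
by rewrite !inE eqxx /= cx' orbF => /esym/eqP.
Qed.

Lemma lower_to_vacuum la : stable (mem la) -> W (vec la) -> W (vec fset0).
Proof.
have [n] := ubnP #|` la|; elim: n la => // n ih la lt st Wla.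
have [e0|/exists_convex[b cb]] := eqVneq la fset0; first by rewrite -e0.
apply: (ih (la `\ b)%fset); [|exact: stable_rem|exact: lower_state].
by move: lt; rewrite (cardfsD1 b) [b \in la](convex_mem cb).
Qed.

Lemma raise_from_vacuum la : W (vec fset0) -> stable (mem la) -> W (vec la).
Proof.
move=> W00; have [n] := ubnP #|` la|; elim: n la => // n ih la lt st.
have [->//|/exists_convex[b cb]] := eqVneq la fset0.
have bla : b \in la := convex_mem cb.
rewrite -(fsetD1K bla); apply: raise_state; rewrite ?fsetD1K ?in_fsetD1 ?eqxx //.
  exact: stable_rem.
apply: ih; last exact: stable_rem.
by move: lt; rewrite (cardfsD1 b) bla.
Qed.

Lemma simple_span v0 : W v0 -> v0 <> 0 -> forall v, W v.
Proof.
move=> Wv n0; have [s [c [us st e0]]] := vec_span v0.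
have [la las cla] : exists2 la, la \in s & c la != 0.
  apply: contrapT => n; apply: n0; rewrite e0 big_seq big1 // => la las.
  have [->|cn] := eqVneq (c la) 0; first by rewrite scale0r.
  by case: n; exists la.
have Wla : W (vec la).
  have := @weight_component_sum _ s id c la us las st.
  rewrite -e0 => /(_ (fun x y _ _ => id) Wv) /(WZ (c la)^-1).
  by rewrite scalerA mulVf // scale1r.
have Wall la' := raise_from_vacuum (la := la') (lower_to_vacuum (st _ las) Wla).
move=> v; have [s' [c' [_ st' ->]]] := vec_span v.
rewrite big_seq; elim/big_ind: _ => // la' l's; apply: WZ; apply: Wall.
exact: st'.
Qed.

End Simple.

(** * The representation of the toroidal algebra *)

Lemma Z2_case (i : 'Z_2) : i = 0 \/ i = 1.
Proof. by case: i => [[|[|]]] // h; [left | right]; apply/val_inj. Qed.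

Lemma sgnE (R : realType) (i j : 'Z_2) : sgn R i j = sign R[i] i j.
Proof.
rewrite /sgn /sign; have [->|->] := Z2_case i; have [->|->] := Z2_case j.
- by rewrite eqxx expr0.
- by rewrite expr1.
- by rewrite expr1.
- by rewrite eqxx expr2 mulrNN mulr1.
Qed.

Section Representation.
Variables (R : realType) (logq logd : R[i]).
Local Notation C := R[i].
Local Notation q := (q logq).
Local Notation q1 := (q1 logq logd).
Local Notation q2 := (q2 logq).
Local Notation q3 := (q3 logq logd).
Variables (u : C) (psc : 'Z_2 -> C).
Hypothesis hq : q1 * q2 * q3 = 1.
Hypothesis qq : q - q^-1 != 0.
Hypothesis u0 : u != 0.
Hypothesis lpos_inj : injective (lpos q1 q2 q3 u).
Hypothesis psc_neq0 : forall i, psc i != 0.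
Hypothesis psc_balanced : forall i, psc i * (psc i *
  lpos q1 q2 q3 u (i == 0, (-1, -1)) / lpos q1 q2 q3 u (i != 0, (0, 0))) = 1.

Local Notation bpos := (bpos q1 q2 q3 u).
Local Notation phifact := (phifact q1 q2 q3 u psc).
Local Notation eigen := (eigen q1 q2 q3 u psc).
Local Notation kap := (q - q^-1)^-1.
Local Notation gamE := (gamE q1 q2 q3 u psc kap).
Local Notation gamF := (@gamF C).
Local Notation ME := (ME q1 q2 q3 u).
Local Notation MF := (MF q1 q2 q3 u).

Variables (V : lmodType C) (vec : {fset G0_box} -> V).
Variable lin : ({fset G0_box} -> V) -> {linear V -> V}.
Hypothesis lin_vec : forall f la, stable (mem la) -> lin f (vec la) = f la.
Hypothesis vec_out : forall la, ~ stable (mem la) -> vec la = 0.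
Hypothesis vec_ext : forall f g : {linear V -> V},
  (forall la, stable (mem la) -> f (vec la) = g (vec la)) -> f =1 g.
Implicit Types (la : {fset G0_box}) (v w : V) (i j : 'Z_2) (b x y : G0_box).

Local Notation Eop := (remop vec lin gamE ME).
Local Notation Fop := (addop vec lin gamF MF).

Definition diag (h : {fset G0_box} -> C) : {linear V -> V} :=
  lin (fun la => h la *: vec la).

Lemma diag_vec h la : stable (mem la) -> diag h (vec la) = h la *: vec la.
Proof. by move=> st; rewrite /diag lin_vec. Qed.

(** The series whose logarithm gives the eigenvalues of H starts with 1. *)
Definition eigen1 (dir : bool) la i (n : nat) : C :=
  eigen dir la i (if dir then n%:Z else - n%:Z) / eigen dir la i 0.

Definition Hval la i (r : int) : C :=
  match r with
  | Posz n => kap * slog (eigen1 true la i) n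
  | Negz n => - (kap * slog (eigen1 false la i) n.+1)
  end.

Definition rho (g : toroidal_gen) : {linear V -> V} :=
  match g with
  | GenE i k => modeop vec lin bpos Eop i k
  | GenF i k => modeop vec lin bpos Fop i k
  | GenH i r _ => diag (fun la => Hval la i r)
  | GenK i => diag (fun la => eigen true la i 0)
  | GenKV i => diag (fun la => eigen false la i 0)
  | GenT => lin vec
  | GenTV => lin vec
  end.

Local Notation ev := (feval rho).
Local Notation Emode := (modeop vec lin bpos Eop).
Local Notation Fmode := (modeop vec lin bpos Fop).

Lemma ev_E i k v : ev (fE R i k) v = Emode i k v.
Proof. exact: feval_gen. Qed.

Lemma ev_F i k v : ev (fF R i k) v = Fmode i k v.
Proof. exact: feval_gen. Qed.

Lemma lin_id v : lin vec v = v.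
Proof. by apply: (vec_ext (g := idfun)) => la st; rewrite lin_vec. Qed.

Lemma eigen_pos_neq0 dir la i : stable (mem la) -> eigen dir la i 0 != 0.
Proof.
move=> st; have [e1 e2] := eigen0 hq lpos_inj u0 psc_neq0 psc_balanced i st.
have n := phifact_scal_neq0 u hq psc_neq0 la i.
by case: dir; rewrite ?e1 ?e2 ?invr_neq0.
Qed.

Lemma eigen1_0 dir la i : stable (mem la) -> eigen1 dir la i 0 = 1.
Proof.
move=> st; rewrite /eigen1 (_ : (if dir then _ else _) = 0); last by case: dir.
by rewrite divff ?eigen_pos_neq0.
Qed.

(** The exponential of the H series gives back the expansion divided by its first
    coefficient, which is the eigenvalue of K or of its inverse. *)
Lemma ev_K dir la i m : stable (mem la) ->
  ev (fKseries logq dir i m) (vec la) = eigen dir la i m *: vec la.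
Proof.
move=> st; rewrite /fKseries; case: dir.
  case: ifP => m0; last first.
    by rewrite feval0 eigen_out ?scale0r //; rewrite ltNge m0.
  rewrite fevalM (feval_series_exp (a := slog (eigen1 true la i))); last first.
    case=> [|r]; first by rewrite fevalZ feval0 scaler0 /slog /= scale0r.
    rewrite fevalZ feval_gen /= diag_vec // /Hval scalerA mulrA divff // mul1r //.
  rewrite series_expK ?eigen1_0 // linearZ /= feval_gen /= diag_vec // scalerA.
  rewrite /eigen1 divfK ?eigen_pos_neq0 //.
  by rewrite gez0_abs.
case: ifP => m0; last first.
  by rewrite feval0 eigen_out ?scale0r //; rewrite ltNge m0.
rewrite fevalM (feval_series_exp (a := slog (eigen1 false la i))); last first.
  case=> [|r]; first by rewrite fevalZ feval0 scaler0 /slog /= scale0r.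
  rewrite fevalZ feval_gen /= diag_vec // /Hval scalerA mulNr mulrN opprK.
  by rewrite mulrA divff // mul1r.
rewrite series_expK ?eigen1_0 // linearZ /= feval_gen /= diag_vec // scalerA.
rewrite /eigen1 divfK ?eigen_pos_neq0 //.
by rewrite lez0_abs // opprK.
Qed.

Lemma ev_eq0 (x : free_alg C toroidal_gen) : (forall la, stable (mem la) -> ev x (vec la) = 0) ->
  forall v, ev x v = 0.
Proof.
move=> h v; rewrite -(feval0 rho v).
by apply: (vec_ext (f := feval rho x) (g := feval rho 0)) => la st /=; rewrite h // feval0.
Qed.

Lemma ev_K_E dir la i m b : stable (mem la) ->
  ev (fKseries logq dir i m) (Eop b (vec la)) =
  eigen dir (la `\ b)%fset i m *: Eop b (vec la).
Proof.
move=> st; rewrite (remop_vec lin_vec _ _ _ st) linearZ /=.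
have [st'|ns] := pselect (stable (mem (la `\ b)%fset)).
  by rewrite ev_K // !scalerA mulrC.
by rewrite (vec_out ns) linear0 !scaler0.
Qed.

Lemma ev_K_F dir la i m b : stable (mem la) ->
  ev (fKseries logq dir i m) (Fop b (vec la)) =
  eigen dir (b |` la)%fset i m *: Fop b (vec la).
Proof.
move=> st; rewrite (addop_vec lin_vec _ _ _ st) linearZ /=.
have [st'|ns] := pselect (stable (mem (b |` la)%fset)).
  by rewrite ev_K // !scalerA mulrC.
by rewrite (vec_out ns) linear0 !scaler0.
Qed.

Lemma E_local : local vec Eop. Proof. exact: remop_local. Qed.
Lemma F_local : local vec Fop. Proof. exact: addop_local. Qed.

Lemma vec_bounded la : stable (mem la) -> bounded vec (boxrank la) (vec la).
Proof.
move=> st; rewrite -[vec la]scale1r; apply: (bounded_vec vec_out); right.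
exact: boxrank_sub.
Qed.

Lemma Emode_vec la i k N : stable (mem la) -> (boxrank la < N)%N ->
  Emode i k (vec la) =
  \sum_(b <- boxrange N | G0_color b == i) bpos b ^ k *: Eop b (vec la).
Proof.
by move=> st lt; rewrite (modeopE lin_vec _ _ _ E_local (vec_bounded st) lt).
Qed.

Lemma Fmode_vec la i k N : stable (mem la) -> (boxrank la < N)%N ->
  Fmode i k (vec la) =
  \sum_(b <- boxrange N | G0_color b == i) bpos b ^ k *: Fop b (vec la).
Proof.
by move=> st lt; rewrite (modeopE lin_vec _ _ _ F_local (vec_bounded st) lt).
Qed.

(** ** Evaluation of the structure polynomials *)

Local Notation zv := ('X : {poly {poly C}}).
Local Notation wv := ('X%:P : {poly {poly C}}).

Lemma eval2_g i j (a b : C) : eval2 (gpoly logq logd i j zv wv) a b = gval q1 q2 q3 i j a b.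
Proof. by rewrite /eval2 /gpoly /gval; case: ifP => _; rewrite !hornerE. Qed.

Lemma eval2_g' i j (a b : C) : eval2 (gpoly logq logd j i wv zv) a b = gval q1 q2 q3 j i b a.
Proof. by rewrite /eval2 /gpoly /gval; case: ifP => _; rewrite !hornerE. Qed.

Lemma map_g i j (b : C) : map_poly (fun p => p.[b]) (gpoly logq logd i j zv wv) =
  Gpoly q1 q2 q3 i j b.
Proof.
rewrite -[map_poly _]/(map_poly (horner_eval b)) /gpoly /Gpoly.
have h c : map_poly (horner_eval b) (zv - c%:P%:P * wv) = 'X - (c * b)%:P.
  by rewrite rmorphB rmorphM /= map_polyX !map_polyC /= /horner_eval hornerC hornerX polyCM.
by case: ifP => _; [rewrite h | rewrite rmorphM /= !h].
Qed.

Lemma map_g' i j (b : C) : map_poly (fun p => p.[b]) (gpoly logq logd j i wv zv) =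
  Hpoly q1 q2 q3 j i b.
Proof.
rewrite -[map_poly _]/(map_poly (horner_eval b)) /gpoly /Hpoly.
have h c : map_poly (horner_eval b) (wv - c%:P%:P * zv) = b%:P - c *: 'X.
  rewrite rmorphB rmorphM /= map_polyX !map_polyC /= /horner_eval hornerC hornerX.
  by rewrite mul_polyC.
by case: ifP => _; [rewrite h | rewrite rmorphM /= !h].
Qed.

(** ** The relations *)

Lemma rel_KE_ok dir i j m n la : stable (mem la) ->
  ev (sgn R i j *: poly_mul_series2 (gpoly logq logd i j zv wv)
        (fun m n => fKseries logq dir i m * fE R j n) m n
      + poly_mul_series2 (gpoly logq logd j i wv zv)
        (fun m n => fE R j n * fKseries logq dir i m) m n) (vec la) = 0.
Proof.
move=> st; set N := (boxrank la).+1.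
have e1 m' n' : ev (fKseries logq dir i m' * fE R j n') (vec la) =
    \sum_(b <- boxrange N | G0_color b == j)
      (eigen dir (la `\ b)%fset i m' * bpos b ^ n') *: Eop b (vec la).
  rewrite fevalM ev_E (Emode_vec _ _ st (ltnSn _)) linear_sum; apply: eq_bigr => b _.
  by rewrite linearZ /= ev_K_E // scalerA mulrC.
have e2 m' n' : ev (fE R j n' * fKseries logq dir i m') (vec la) =
    \sum_(b <- boxrange N | G0_color b == j)
      (eigen dir la i m' * bpos b ^ n') *: Eop b (vec la).
  rewrite fevalM ev_K // linearZ /= ev_E (Emode_vec _ _ st (ltnSn _)) scaler_sumr.
  by apply: eq_bigr => b _; rewrite scalerA.
apply: etrans (feval_quadratic _ _ _ _ _ e1 e2) _; rewrite !pms2_sum scaler_sumr -big_split /=.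
apply: big1 => b /eqP cb; have b0 := bpos_neq0 hq u0 b.
rewrite !(pms2_pact _ _ _ _ _ b0) map_g map_g' scalerA -scalerDl.
have [cv|ncv] := boolP (convex (mem la) b); last first.
  by rewrite (remop_vec lin_vec _ _ _ st) /rweight (negbTE ncv) !scale0r scaler0.
have e := eigen_rem hq lpos_inj u0 psc dir i m st cv.
rewrite cb in e; rewrite sgnE mulrCA -mulrDr.
by rewrite e mulr0 scale0r.
Qed.

Lemma rel_KF_ok dir i j m n la : stable (mem la) ->
  ev (sgn R i j *: poly_mul_series2 (gpoly logq logd j i wv zv)
        (fun m n => fKseries logq dir i m * fF R j n) m n
      + poly_mul_series2 (gpoly logq logd i j zv wv)
        (fun m n => fF R j n * fKseries logq dir i m) m n) (vec la) = 0.
Proof.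
move=> st; set N := (boxrank la).+1.
have e1 m' n' : ev (fKseries logq dir i m' * fF R j n') (vec la) =
    \sum_(b <- boxrange N | G0_color b == j)
      (eigen dir (b |` la)%fset i m' * bpos b ^ n') *: Fop b (vec la).
  rewrite fevalM ev_F (Fmode_vec _ _ st (ltnSn _)) linear_sum; apply: eq_bigr => b _.
  by rewrite linearZ /= ev_K_F // scalerA mulrC.
have e2 m' n' : ev (fF R j n' * fKseries logq dir i m') (vec la) =
    \sum_(b <- boxrange N | G0_color b == j)
      (eigen dir la i m' * bpos b ^ n') *: Fop b (vec la).
  rewrite fevalM ev_K // linearZ /= ev_F (Fmode_vec _ _ st (ltnSn _)) scaler_sumr.
  by apply: eq_bigr => b _; rewrite scalerA.
apply: etrans (feval_quadratic _ _ _ _ _ e1 e2) _; rewrite !pms2_sum scaler_sumr -big_split /=.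
apply: big1 => b /eqP cb; have b0 := bpos_neq0 hq u0 b.
rewrite !(pms2_pact _ _ _ _ _ b0) map_g map_g' scalerA -scalerDl.
rewrite (addop_vec lin_vec _ _ _ st); case: ifPn => [_|bla].
  by rewrite scale0r scaler0.
rewrite /rweight; case: ifP => [cv|_]; last by rewrite scale0r scaler0.
have [st'|ns] := pselect (stable (mem (b |` la)%fset)); last first.
  by rewrite (vec_out ns) !scaler0.
have e := eigen_rem hq lpos_inj u0 psc dir i m st' cv.
rewrite fsetU1K // cb in e; rewrite sgnE mulrCA -mulrDr.
have s2 : sign C i j * sign C i j = 1 by rewrite /sign; case: ifP => _; ring.
rewrite [X in _ * X](_ : _ = 0) ?mulr0 ?scale0r //.
apply: (mulfI (x := sign C i j)).
  by apply: contraNneq (oner_neq0 C) => h; rewrite -s2 h mul0r.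
by rewrite mulr0 mulrDr mulrA s2 mul1r addrC.
Qed.

Lemma bd_E n v b : bounded vec n v -> bounded vec n.+1 (Eop b v).
Proof. by apply: local_bounded; apply: E_local. Qed.
Lemma bd_F n v b : bounded vec n v -> bounded vec n.+1 (Fop b v).
Proof. by apply: local_bounded; apply: F_local. Qed.

Lemma EmodeE i k n N v : bounded vec n v -> (n < N)%N ->
  Emode i k v = \sum_(b <- boxrange N | G0_color b == i) bpos b ^ k *: Eop b v.
Proof. exact: (modeopE lin_vec _ _ _ E_local). Qed.

Lemma FmodeE i k n N v : bounded vec n v -> (n < N)%N ->
  Fmode i k v = \sum_(b <- boxrange N | G0_color b == i) bpos b ^ k *: Fop b v.
Proof. exact: (modeopE lin_vec _ _ _ F_local). Qed.

Lemma rel_EE_ok i j m n la : stable (mem la) ->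
  ev (sgn R i j *: poly_mul_series2 (gpoly logq logd i j zv wv)
        (fun m n => fE R i m * fE R j n) m n
      + poly_mul_series2 (gpoly logq logd j i wv zv)
        (fun m n => fE R j n * fE R i m) m n) (vec la) = 0.
Proof.
move=> st.
have e1 m' n' : ev (fE R i m' * fE R j n') (vec la) = Emode i m' (Emode j n' (vec la)).
  by rewrite fevalM !ev_E.
have e2 m' n' : ev (fE R j n' * fE R i m') (vec la) = Emode j n' (Emode i m' (vec la)).
  by rewrite fevalM !ev_E.
apply: etrans (feval_quadratic _ _ _ _ _ e1 e2) _.
apply: (@modes_quadratic _ _ _ _ _ _ (bpos_neq0 hq u0) _ _ bd_E _ EmodeE
  (gpoly logq logd i j zv wv) (gpoly logq logd j i wv zv) (sgn R i j) i j m n _ _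
  (vec_bounded st)) => x y cx cy.
rewrite eval2_g eval2_g' sgnE -cx -cy.
have ex := @ME_exchange _ _ _ _ u hq.
exact: (remop_quadratic lin_vec _ hq lpos_inj (ME_neq0 _ hq) ex x y st).
Qed.

Lemma rel_FF_ok i j m n la : stable (mem la) ->
  ev (sgn R i j *: poly_mul_series2 (gpoly logq logd j i wv zv)
        (fun m n => fF R i m * fF R j n) m n
      + poly_mul_series2 (gpoly logq logd i j zv wv)
        (fun m n => fF R j n * fF R i m) m n) (vec la) = 0.
Proof.
move=> st.
have e1 m' n' : ev (fF R i m' * fF R j n') (vec la) = Fmode i m' (Fmode j n' (vec la)).
  by rewrite fevalM !ev_F.
have e2 m' n' : ev (fF R j n' * fF R i m') (vec la) = Fmode j n' (Fmode i m' (vec la)).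
  by rewrite fevalM !ev_F.
apply: etrans (feval_quadratic _ _ _ _ _ e1 e2) _.
apply: (@modes_quadratic _ _ _ _ _ _ (bpos_neq0 hq u0) _ _ bd_F _ FmodeE
  (gpoly logq logd j i wv zv) (gpoly logq logd i j zv wv) (sgn R i j) i j m n _ _
  (vec_bounded st)) => x y cx cy.
rewrite eval2_g eval2_g' sgnE -cx -cy.
have ex := @MF_exchange _ _ _ _ u hq.
exact: (addop_quadratic lin_vec vec_out _ hq lpos_inj (MF_neq0 _ hq) ex x y st).
Qed.

Lemma ev_serre (X : 'Z_2 -> int -> free_alg C toroidal_gen)
    (mX : 'Z_2 -> int -> {linear V -> V}) i (k : 'I_3 -> int) l v :
  (forall i k v, ev (X i k) v = mX i k v) ->
  ev (serre logq X i k l) v = 6%:R^-1 *: opserre q2 (fun a =>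
    mX (if a == 0%N then i + 1 else i)
       (nth l [:: l; k 0; k 1; k 2%:R] a)) v.
Proof.
move=> hX; rewrite /serre fevalZ; congr (_ *: _); set O := fun a => _.
have e (p : 'S_3) : ev (pcomm (q ^- 2) (X i (k (p 0))) (pcomm 1 (X i (k (p 1)))
      (pcomm (q ^+ 2) (X i (k (p 2%:R))) (X (i + 1) l)))) v =
    ocomm q2^-1 (mX i (k (p 0))) (ocomm 1 (mX i (k (p 1)))
      (ocomm q2 (mX i (k (p 2%:R))) (mX (i + 1) l))) v.
  rewrite feval_pcomm /ocomm !feval_pcomm /ocomm !feval_pcomm /ocomm.
  by rewrite !hX.
rewrite feval_sum (eq_bigr _ (fun p _ => e p)).
rewrite (sum_S3 (fun a a' c => ocomm q2^-1 (mX i (k a)) (ocomm 1 (mX i (k a'))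
      (ocomm q2 (mX i (k c)) (mX (i + 1) l))) v)).
rewrite /opserre /serre_list !big_cat /= -!ocomm_serre /O /=.
by rewrite !addrA.
Qed.

Lemma Emodes_serre i (k : nat -> int) la : stable (mem la) ->
  opserre q2 (fun a => Emode (if a == 0%N then i + 1 else i) (k a)) (vec la) = 0.
Proof.
move=> st; apply: (modes_serre (@bounded0 _ _ vec) (@boundedD _ _ vec)
  (@boundedZ _ _ vec) bd_E EmodeE k (vec_bounded st)) => x c1 c2 c3 c0.
have ex := @ME_exchange _ _ _ _ u hq.
by apply: (remop_serre lin_vec _ hq lpos_inj (ME_neq0 _ hq) ex st); rewrite ?c1.
Qed.

Lemma Fmodes_serre i (k : nat -> int) la : stable (mem la) ->
  opserre q2 (fun a => Fmode (if a == 0%N then i + 1 else i) (k a)) (vec la) = 0.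
Proof.
move=> st; apply: (modes_serre (@bounded0 _ _ vec) (@boundedD _ _ vec)
  (@boundedZ _ _ vec) bd_F FmodeE k (vec_bounded st)) => x c1 c2 c3 c0.
have ex := @MF_exchange _ _ _ _ u hq.
by apply: (addop_serre lin_vec vec_out _ hq lpos_inj (MF_neq0 _ hq) ex st); rewrite ?c1.
Qed.

(** ** The relation between E and F *)

(** If both sides are nonzero, all states involved are stable by intersection and
    union, and removing b' from the larger state changes the coefficient of E by
    ME b' b, while removing b changes that of F by MF b b'. *)
Lemma EF_commute la b b' : stable (mem la) -> b != b' ->
  Eop b (Fop b' (vec la)) = Fop b' (Eop b (vec la)).
Proof.
move=> st nbb; rewrite (addop_vec lin_vec _ _ _ st) (remop_vec lin_vec _ _ _ st).
rewrite !linearZ /=; have [b'la|nb'la] := boolP (b' \in la).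
  have [st'|ns] := pselect (stable (mem (la `\ b)%fset)); last first.
    by rewrite (vec_out ns) linear0 scaler0 scale0r.
  rewrite (addop_vec lin_vec _ _ _ st') in_fsetD1 b'la andbT eq_sym nbb.
  by rewrite !scale0r scaler0.
have [bla|nbla] := boolP (b \in la); last first.
  have r0 : rweight gamE ME la b = 0.
    by rewrite /rweight ifN //; apply: contra nbla => /convex_mem.
  rewrite r0 scale0r; have [st'|ns] := pselect (stable (mem (b' |` la)%fset)); last first.
    by rewrite (vec_out ns) linear0 scaler0.
  have r1 : rweight gamE ME (b' |` la)%fset b = 0.
    rewrite /rweight ifN //; apply/negP => /convex_mem h.
    have : b \in (b' |` la)%fset := h.
    by rewrite in_fset1U (negbTE nbb) (negbTE nbla).
  by rewrite (remop_vec lin_vec _ _ _ st') r1 scale0r scaler0.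
set sg := (b' |` la)%fset; set ta := (la `\ b)%fset.
have esb : (sg `\ b)%fset = (b' |` ta)%fset.
  apply/fsetP => x; rewrite !inE; case: (x =P b) => [->|] //=.
  by rewrite (negbTE nbb).
have b'ta : b' \notin ta by rewrite in_fsetD1 negb_and nb'la orbT.
have mset (A B : {fset G0_box}) : A = B -> stable (mem A) -> stable (mem B) by move->.
have [stt|nst] := pselect (stable (mem (b' |` ta)%fset)); last first.
  transitivity (0 : V).
    have [st'|ns] := pselect (stable (mem sg)); last first.
      by rewrite (vec_out ns) linear0 scaler0.
    by rewrite (remop_vec lin_vec _ _ _ st') esb (vec_out nst) !scaler0.
  have [st'|ns] := pselect (stable (mem ta)); last first.
    by rewrite (vec_out ns) linear0 scaler0.
  by rewrite (addop_vec lin_vec _ _ _ st') (vec_out nst) !scaler0.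
have st1 : stable (mem sg).
  apply: (eq_stable _ (stableU st stt)) => x; rewrite /= !inE.
  by case: (x == b); case: (x == b'); case: (x \in la).
have st2 : stable (mem ta).
  apply: (eq_stable _ (stableI st stt)) => x; rewrite /= !inE.
  case: (x =P b') => [->|_]; first by rewrite (negbTE nb'la) andbF.
  by case: (x == b); case: (x \in la).
have cvP (A : {fset G0_box}) c : stable (mem A) -> c \in A ->
    stable (mem (A `\ c)%fset) -> convex (mem A) c.
  move=> sA cA sAc; apply/convexP => //.
  by apply: eq_stable sAc => x; rewrite /= in_fsetD1 andbC.
have esb' : (sg `\ b')%fset = la by rewrite fsetU1K.
have etb' : ((b' |` ta) `\ b')%fset = ta by rewrite fsetU1K.
have b'sg : b' \in sg by rewrite !inE eqxx.
have bsg : b \in sg by rewrite !inE bla orbT.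
have c1 : convex (mem sg) b' by apply: cvP; rewrite ?esb'.
have c2 : convex (mem sg) b by apply: cvP; rewrite ?esb.
have c3 : convex (mem la) b by apply: cvP.
have c4 : convex (mem (b' |` ta)%fset) b'.
  by apply: cvP; rewrite ?etb' // !inE eqxx.
rewrite (remop_vec lin_vec _ _ _ st1) (addop_vec lin_vec _ _ _ st2) esb.
rewrite (negbTE b'ta) !scalerA; congr (_ *: _).
rewrite /rweight c1 c2 c3 c4.
have mef := ME_MF hq lpos_inj st1 c2 c1 nbb.
have w1 := weight_rem gamE (ME_neq0 u hq) b'sg (_ : b' != b).
have w2 := weight_rem gamF (MF_neq0 u hq) bsg nbb.
rewrite esb' in w1; rewrite esb in w2.
rewrite w2 w1 1?eq_sym //.
have m1 : ME b' b != 0 := ME_neq0 u hq b' b.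
have m2 : MF b b' != 0 := MF_neq0 u hq b b'.
have -> : MF b b' = (ME b' b)^-1.
  by apply: (mulfI m1); rewrite mef divff.
by rewrite invrK; field.
Qed.

(** Removing and adding b again, or the reverse, is only possible at a convex, or
    a concave, box b: these are the poles of the l-weight. *)
Lemma EF_diagonal la b : stable (mem la) ->
  Eop b (Fop b (vec la)) - Fop b (Eop b (vec la)) =
  (if boundary la b then kap * (flead (phifact la (G0_color b)) (bpos b) / bpos b)
   else 0) *: vec la.
Proof.
move=> st; rewrite (addop_vec lin_vec _ _ _ st) (remop_vec lin_vec _ _ _ st).
rewrite [X in X - _]linearZ [X in _ - X]linearZ /=; have [bla|nbla] := boolP (b \in la).
  rewrite scale0r sub0r /boundary; have -> : concave (mem la) b = false.
    by apply/negP => /concave_notin /negP; apply.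
  rewrite orbF /rweight; case: ifPn => [cv|_]; last by rewrite !scale0r oppr0.
  have st' := stable_rem st cv.
  rewrite (addop_vec lin_vec _ _ _ st') in_fsetD1 eqxx /= fsetD1K // /rweight cv.
  by rewrite scalerA -scaleNr (weightEF_convex hq lpos_inj) ?opprK.
have r0 : rweight gamE ME la b = 0.
  by rewrite /rweight ifN //; apply: contra nbla => /convex_mem.
rewrite r0 scale0r subr0 /boundary.
have -> : convex (mem la) b = false by apply: contraNF nbla => /convex_mem.
rewrite /=; have [st'|ns] := pselect (stable (mem (b |` la)%fset)); last first.
  rewrite (vec_out ns) linear0 scaler0; case: ifPn => [cc|]; last by rewrite scale0r.
  case: ns; apply: (eq_stable (A := [pred x | (x == b) || mem la x])).
    by move=> x; rewrite /= !inE.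
  by apply/concaveP.
have cc : concave (mem la) b.
  by apply/concaveP => //; apply: eq_stable st' => x; rewrite /= !inE.
have cv : convex (mem (b |` la)%fset) b.
  apply/convexP => //=; first by rewrite !inE eqxx.
  apply: eq_stable st => x; rewrite /= !inE; case: (x =P b) => [->|_] /=.
    by rewrite (negbTE nbla).
  by rewrite andbT.
rewrite cc (remop_vec lin_vec _ _ _ st') /rweight cv fsetU1K // scalerA mulrC.
by rewrite weightEF_concave.
Qed.

(** Only a = b survives among the pairs of boxes, and then the colours agree. *)
Lemma EF_modes i j m n la : stable (mem la) ->
  ev (pcomm 1 (fE R i m) (fF R j n)) (vec la) =
  ((i == j)%:R * (kap * \sum_(b <- polelist la i)
    flead (phifact la i) (bpos b) / bpos b * bpos b ^ (m + n))) *: vec la.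
Proof.
move=> st; rewrite feval_pcomm /ocomm scale1r !ev_E !ev_F.
set N := (boxrank la).+2.
rewrite (Fmode_vec _ _ st (leqnSn _ : (boxrank la < N)%N)) (Emode_vec _ _ st (leqnSn _ : (boxrank la < N)%N)).
rewrite !linear_sum /= sumrN.
have eE b : Emode i m (bpos b ^ n *: Fop b (vec la)) =
    \sum_(a <- boxrange N | G0_color a == i) (bpos a ^ m * bpos b ^ n) *: Eop a (Fop b (vec la)).
  rewrite linearZ /= (EmodeE _ _ (bd_F b (vec_bounded st)) (ltnSn _)) scaler_sumr.
  by apply: eq_bigr => a _; rewrite scalerA mulrC.
have eF a : Fmode j n (bpos a ^ m *: Eop a (vec la)) =
    \sum_(b <- boxrange N | G0_color b == j) (bpos a ^ m * bpos b ^ n) *: Fop b (Eop a (vec la)).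
  rewrite linearZ /= (FmodeE _ _ (bd_E a (vec_bounded st)) (ltnSn _)) scaler_sumr.
  by apply: eq_bigr => b _; rewrite scalerA.
pose dg a := if boundary la a
  then kap * (flead (phifact la (G0_color a)) (bpos a) / bpos a) else 0.
have key a : a \in boxrange N -> G0_color a = i ->
    \sum_(b <- boxrange N | G0_color b == j)
       (bpos a ^ m * bpos b ^ n) *: Eop a (Fop b (vec la)) -
    \sum_(b <- boxrange N | G0_color b == j)
       (bpos a ^ m * bpos b ^ n) *: Fop b (Eop a (vec la)) =
    ((i == j)%:R * (bpos a ^ (m + n) * dg a)) *: vec la.
  move=> aN ca; rewrite -sumrB.
  have off b : b != a -> (bpos a ^ m * bpos b ^ n) *: Eop a (Fop b (vec la)) -
      (bpos a ^ m * bpos b ^ n) *: Fop b (Eop a (vec la)) = 0.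
    by move=> nab; rewrite EF_commute ?subrr // eq_sym.
  have [eij|nij] := eqVneq i j; last first.
    rewrite mul0r scale0r big1 // => b /eqP cb; apply: off.
    by apply: contraNneq nij => eba; rewrite -ca -cb eba.
  rewrite big_mkcond (bigD1_seq a) ?boxrange_uniq //= -eij ca eqxx.
  rewrite big1 ?addr0 => [|b nb]; last by case: ifP => // _; apply: off.
  rewrite -scalerBr EF_diagonal // scalerA mul1r expfzDr //.
  exact: bpos_neq0.
refine (etrans (congr2 (fun w w' : V => w - w') (eq_bigr _ (fun b _ => eE b))
  (eq_bigr _ (fun a _ => eF a))) _).
rewrite exchange_big /= -sumrB big_seq_cond.
rewrite (eq_bigr (fun a => ((i == j)%:R * (bpos a ^ (m + n) * dg a)) *: vec la));
  last by move=> a /andP[aN /eqP ca]; exact: key.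
rewrite -big_seq_cond -scaler_suml; congr (_ *: _).
rewrite -mulr_sumr; congr (_ * _); rewrite mulr_sumr /polelist big_filter.
rewrite big_mkcondr; apply: eq_bigr => b /eqP cb; rewrite /dg cb.
case: ifP => _; last by rewrite mulr0.
by rewrite mulrCA; congr (_ * _); exact: mulrC.
Qed.

Lemma KK_modes i c m la : stable (mem la) ->
  ev (c *: (fKseries logq true i m - fKseries logq false i m)) (vec la) =
  (c * \sum_(b <- polelist la i)
    flead (phifact la i) (bpos b) / bpos b * bpos b ^ m) *: vec la.
Proof.
move=> st; refine (etrans (fevalZ _ _ _ _) _); rewrite -[RHS]scalerA.
congr (_ *: _); refine (etrans (fevalB _ _ _ _) _).
refine (etrans (congr2 (fun w w' : V => w - w') (ev_K true i m st)
  (ev_K false i m st)) _).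
refine (etrans (esym (scalerBl _ _ _)) _); congr (_ *: _).
exact: eigen_diff.
Qed.

Lemma rel_EF_ok i j m n la : stable (mem la) ->
  ev (pcomm 1 (fE R i m) (fF R j n) - ((i == j)%:R / (q - q^-1)) *:
     (fKseries logq true i (m + n) - fKseries logq false i (m + n))) (vec la) = 0.
Proof.
move=> st; refine (etrans _ _); first exact: fevalB.
apply/eqP; rewrite subr_eq0; apply/eqP.
refine (etrans _ _); first exact: EF_modes.
by symmetry; refine (etrans _ _); [exact: KK_modes | rewrite mulrA].
Qed.

Lemma ev_inverse (x y : free_alg C toroidal_gen) (h h' : {fset G0_box} -> C) :
  (forall la, stable (mem la) -> ev x (vec la) = h la *: vec la) ->
  (forall la, stable (mem la) -> ev y (vec la) = h' la *: vec la) ->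
  (forall la, stable (mem la) -> h' la * h la = 1) ->
  forall v, ev (x * y - 1) v = 0.
Proof.
move=> hx hy hh; apply: ev_eq0 => la st; rewrite fevalB feval1 fevalM hy //.
by rewrite linearZ /= hx // scalerA hh // scale1r subrr.
Qed.

Lemma rho_vanish (x : free_alg C toroidal_gen) : toroidal_relator logq logd x -> forall v, ev x v = 0.
Proof.
have dK i la : stable (mem la) -> ev (fK R i) (vec la) = eigen true la i 0 *: vec la.
  by move=> st; rewrite feval_gen /= diag_vec.
have dKV i la : stable (mem la) -> ev (fKV R i) (vec la) = eigen false la i 0 *: vec la.
  by move=> st; rewrite feval_gen /= diag_vec.
have dT v : ev (fT R) v = v by rewrite feval_gen /= lin_id.
have dTV v : ev (fTV R) v = v by rewrite feval_gen /= lin_id.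
have ei la i : stable (mem la) -> eigen false la i 0 * eigen true la i 0 = 1.
  move=> st; have [-> ->] := eigen0 hq lpos_inj u0 psc_neq0 psc_balanced i st.
  by rewrite mulVf // phifact_scal_neq0.
have ecom (y z : free_alg C toroidal_gen) v w : ev y (ev z v) = w -> ev z (ev y v) = w ->
    ev (y * z - z * y) v = 0.
  move=> h1 h2; refine (etrans (fevalB _ _ _ _) _).
  refine (etrans (congr2 (fun w w' : V => w - w') (etrans (fevalM _ _ _ _) h1)
    (etrans (fevalM _ _ _ _) h2)) _).
  exact: subrr.
have tid (y z : free_alg C toroidal_gen) : (forall v, ev y v = v) -> (forall v, ev z v = v) ->
    forall v, ev (y * z - 1) v = 0.
  by move=> hy hz v; rewrite fevalB feval1 fevalM hz hy subrr.
have tcom (y z : free_alg C toroidal_gen) : (forall v, ev y v = v) ->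
    forall v, ev (y * z - z * y) v = 0.
  move=> hy v; refine (ecom _ _ _ (ev z v) _ _); first exact: hy.
  exact: (congr1 (ev z) (hy v)).
have dcom (y z : free_alg C toroidal_gen) (h h' : C) la :
    ev y (vec la) = h *: vec la -> ev z (vec la) = h' *: vec la ->
    ev (y * z - z * y) (vec la) = 0.
  have lZ (t : free_alg C toroidal_gen) (c : C) v : ev t (c *: v) = c *: ev t v.
    by rewrite linearZ.
  move=> hy hz; refine (ecom _ _ _ (h *: (h' *: vec la)) _ _).
    refine (etrans (congr1 (ev y) hz) (etrans (lZ _ _ _) _)).
    by refine (etrans (congr1 _ hy) _); rewrite !scalerA mulrC.
  refine (etrans (congr1 (ev z) hy) (etrans (lZ _ _ _) _)).
  exact: (congr1 _ hz).
case=> {x}.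
- by move=> i; apply: (ev_inverse (dK i) (dKV i)) => la st; rewrite ei.
- by move=> i; apply: (ev_inverse (dKV i) (dK i)) => la st; rewrite mulrC ei.
- exact: tid dT dTV.
- exact: tid dTV dT.
- by move=> x; apply: tcom.
- move=> s s' i j m n; apply: ev_eq0 => la st.
  exact: (dcom _ _ _ _ _ (ev_K s i m st) (ev_K s' j n st)).
- by move=> s i j m n; apply: ev_eq0 => la; apply: rel_KE_ok.
- by move=> s i j m n; apply: ev_eq0 => la; apply: rel_KF_ok.
- by move=> i j m n; apply: ev_eq0 => la; apply: rel_EF_ok.
- by move=> i j m n; apply: ev_eq0 => la; apply: rel_EE_ok.
- by move=> i j m n; apply: ev_eq0 => la; apply: rel_FF_ok.
- move=> i k l; apply: ev_eq0 => la st; rewrite (ev_serre _ _ _ _ ev_E).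
  by rewrite (Emodes_serre i (nth l [:: l; k 0; k 1; k 2%:R]) st) scaler0.
- move=> i k l; apply: ev_eq0 => la st; rewrite (ev_serre _ _ _ _ ev_F).
  by rewrite (Fmodes_serre i (nth l [:: l; k 0; k 1; k 2%:R]) st) scaler0.
Qed.


Hypothesis vec_neq0 : forall la, stable (mem la) -> vec la != 0.
Hypothesis vec_span : forall v, exists (s : seq {fset G0_box}) (c : {fset G0_box} -> C),
  [/\ uniq s, forall la, la \in s -> stable (mem la) & v = \sum_(la <- s) c la *: vec la].


Local Notation act := (@pres_act _ _ _ rho (toroidal_relator logq logd)).

Implicit Types X Y : toroidal logq logd.

Lemma act_lin X : linear (act X).
Proof. by move=> c v w; rewrite /pres_act linearP. Qed.

Lemma act_add X v w : act X (v + w) = act X v + act X w.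
Proof. by rewrite -{1}[v]scale1r act_lin scale1r. Qed.

Lemma act_scale c X v : act X (c *: v) = c *: act X v.
Proof.
have e0 : act X 0 = 0 by rewrite /pres_act linear0.
by rewrite -[c *: v]addr0 act_lin e0 addr0.
Qed.

Definition tmod : toroidal_module logq logd V := ToroidalModule
  (fun X Y v => pres_actDl rho_vanish X Y v) (fun c X v => pres_actZl rho_vanish c X v)
  act_add act_scale (fun v => pres_act1 rho_vanish v) (fun X Y v => pres_actM rho_vanish X Y v).

Lemma tmodE (x : free_alg C toroidal_gen) v : tmod (tpi logq logd x) v = ev x v.
Proof. exact: (pres_act_pi rho_vanish). Qed.

Definition phiweight la : lweight C := fun i => fval (phifact la i).

Lemma tmod_K la : stable (mem la) -> has_lweight tmod (phiweight la) (vec la).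
Proof.
move=> st i; split.
  exists (eigen true la i) => [|m]; first exact: (eigen_expansion hq lpos_inj u0 psc true).
  refine (etrans (tmodE _ _) _); exact: ev_K.
exists (eigen false la i) => [|m]; first exact: (eigen_expansion hq lpos_inj u0 psc false).
refine (etrans (tmodE _ _) _); exact: ev_K.
Qed.

Definition convexlist la i :=
  [seq b <- boxrange (boxrank la).+2 | (G0_color b == i) && convex (mem la) b].
Definition concavelist la i :=
  [seq b <- boxrange (boxrank la).+2 | (G0_color b == i) && concave (mem la) b].

Lemma mem_convexlist la i b : stable (mem la) ->
  (b \in convexlist la i) = (G0_color b == i) && convex (mem la) b.
Proof.
move=> st; rewrite mem_filter /=; case: (boolP ((G0_color b == i) && convex (mem la) b)) => // /andP[_ cv].
by apply: boundary_range => //; rewrite /boundary cv.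
Qed.

Lemma mem_concavelist la i b : stable (mem la) ->
  (b \in concavelist la i) = (G0_color b == i) && concave (mem la) b.
Proof.
move=> st; rewrite mem_filter /=; case: (boolP ((G0_color b == i) && concave (mem la) b)) => // /andP[_ cv].
by apply: boundary_range => //; rewrite /boundary cv orbT.
Qed.

Lemma Emode_convex i k la : stable (mem la) -> Emode i k (vec la) =
  \sum_(b <- convexlist la i) (bpos b ^ k * weight gamE ME la b) *: vec (la `\ b)%fset.
Proof.
move=> st; refine (etrans (Emode_vec _ _ st (leqnSn _ : (boxrank la < (boxrank la).+2)%N)) _).
rewrite /convexlist big_filter big_mkcondr; apply: eq_bigr => b _.
rewrite (remop_vec lin_vec _ _ _ st) /rweight; case: ifP => _.
  by rewrite scalerA.
by rewrite scale0r scaler0.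
Qed.

Lemma add_convex la b : stable (mem la) -> stable (mem (b |` la)%fset) -> b \notin la ->
  convex (mem (b |` la)%fset) b.
Proof.
move=> st st' nb; apply/convexP => //=; first by rewrite !inE eqxx.
apply: eq_stable st => x; rewrite /= !inE; case: (x =P b) => [->|_] /=.
  by rewrite (negbTE nb).
by rewrite andbT.
Qed.

Lemma Fmode_concave i k la : stable (mem la) -> Fmode i k (vec la) =
  \sum_(b <- concavelist la i)
    (bpos b ^ k * weight gamF MF (b |` la)%fset b) *: vec (b |` la)%fset.
Proof.
move=> st; refine (etrans (Fmode_vec _ _ st (leqnSn _ : (boxrank la < (boxrank la).+2)%N)) _).
rewrite /concavelist big_filter big_mkcondr; apply: eq_bigr => b _.
rewrite (addop_vec lin_vec _ _ _ st); case: ifPn => bla.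
  rewrite scale0r scaler0 ifF //; apply/negP => /concave_notin /negP; exact.
have [st'|ns] := pselect (stable (mem (b |` la)%fset)); last first.
  rewrite (vec_out ns) !scaler0 ifF //; apply/negP => /(concaveP st bla) h.
  by apply: ns; apply: eq_stable h => x; rewrite /= !inE.
have -> : concave (mem la) b.
  by apply/concaveP => //; apply: eq_stable st' => x; rewrite /= !inE.
by rewrite /rweight add_convex // scalerA.
Qed.

Lemma weightE_neq0 la b : weight gamE ME la b != 0.
Proof.
rewrite mulf_neq0 //; last first.
  by rewrite prodf_seq_neq0; apply/allP => x _; rewrite (ME_neq0 u hq).
rewrite /gamE mulf_neq0 ?invr_neq0 // mulf_neq0 ?invr_neq0 ?(bpos_neq0 hq u0) //.
by rewrite flead_neq0 //= psc_neq0.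
Qed.

Lemma weightF_neq0 la b : weight gamF MF la b != 0.
Proof.
rewrite mulf_neq0 ?oner_neq0 // prodf_seq_neq0; apply/allP => x _.
exact: (MF_neq0 u hq).
Qed.

Lemma stable0 : stable (mem (fset0 : {fset G0_box})).
Proof. by move=> z k x; rewrite /= !inE. Qed.

Lemma convex0 b : convex (mem (fset0 : {fset G0_box})) b = false.
Proof. by apply/negP => /convex_mem; rewrite /= inE. Qed.

Lemma sum_list_set (s : seq G0_box) (A : set G0_box) (f : G0_box -> V) : uniq s ->
  (forall b, b \in s <-> A b) -> \sum_(b <- s) f b = \sum_(b \in A) f b.
Proof.
by move=> us sA; rewrite fsbig_seq //; apply: eq_fsbigl; apply/seteqP; split=> b /sA.
Qed.

Lemma tmod_E i k la : stable (mem la) -> tmod (tpi logq logd (fE R i k)) (vec la) =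
  \sum_(b \in [set b | [/\ G0_color b = i, b \in la & G0_states (la `\ b)%fset]]%classic)
    (weight gamE ME la b * bpos b ^ k) *: vec (la `\ b)%fset.
Proof.
move=> st; refine (etrans (tmodE _ _) _); refine (etrans (ev_E _ _ _) _).
refine (etrans (Emode_convex _ _ st) _).
refine (etrans _ (sum_list_set _ (filter_uniq _ (boxrange_uniq _)) _)).
  by apply: eq_bigr => b _; rewrite mulrC.
move=> b; rewrite (mem_convexlist _ _ st); split.
  move=> /andP[/eqP cb cv]; split=> //; first exact: (convex_mem cv).
  by apply/G0_statesP; apply: stable_rem.
move=> [cb bla /G0_statesP st']; rewrite cb eqxx /=; apply/convexP => //.
by apply: eq_stable st' => x; rewrite /= in_fsetD1 andbC.
Qed.

Lemma tmod_F i k la : stable (mem la) -> tmod (tpi logq logd (fF R i k)) (vec la) =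
  \sum_(b \in [set b | [/\ G0_color b = i, b \notin la & G0_states (b |` la)%fset]]%classic)
    (weight gamF MF (b |` la)%fset b * bpos b ^ k) *: vec (b |` la)%fset.
Proof.
move=> st; refine (etrans (tmodE _ _) _); refine (etrans (ev_F _ _ _) _).
refine (etrans (Fmode_concave _ _ st) _).
refine (etrans _ (sum_list_set _ (filter_uniq _ (boxrange_uniq _)) _)).
  by apply: eq_bigr => b _; rewrite mulrC.
move=> b; rewrite (mem_concavelist _ _ st); split.
  move=> /andP[/eqP cb cv]; have nb : ~~ (mem la) b := concave_notin cv.
  split=> //; apply/G0_statesP.
  by apply: eq_stable (elimT (concaveP st nb) cv) => x; rewrite /= !inE.
move=> [cb bla /G0_statesP st']; rewrite cb eqxx /=; apply/concaveP => //.
by apply: eq_stable st' => x; rewrite /= !inE.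
Qed.

Lemma tmod_highest i k : tmod (tpi logq logd (fE R i k)) (vec fset0) = 0.
Proof.
refine (etrans (tmodE _ _) _); refine (etrans (ev_E _ _ _) _).
refine (etrans (Emode_convex _ _ stable0) _).
rewrite big_seq big1 // => b; rewrite (mem_convexlist _ _ stable0) convex0 andbF //.
Qed.

Lemma tmod_simple (W : V -> Prop) v0 : W 0 -> (forall v w, W v -> W w -> W (v + w)) ->
  (forall c v, W v -> W (c *: v)) -> (forall X v, W v -> W (tmod X v)) ->
  W v0 -> v0 <> 0 -> forall v, W v.
Proof.
move=> W0 WD WZ WM.
have Wev (x : free_alg C toroidal_gen) v : W v -> W (ev x v) by move/(WM (tpi logq logd x)); rewrite tmodE.
have neq c (w : C) : c != 0 -> w != 0 -> c * w != 0 := @mulf_neq0 _ c w.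
apply: (@simple_span C V vec ('Z_2 * int)%type
  (fun im => feval rho (fKseries logq true im.1 im.2))
  (fun im la => eigen true la im.1 im.2) _ _ W W0 WD WZ _ vec_span
  (fun la b => bpos b ^ 0 * weight gamE ME la b)
  (fun la b => bpos b ^ 0 * weight gamF MF (b |` la)%fset b) _ _
  (fun i => Emode i 0) (fun i => Fmode i 0) convexlist concavelist).
- by move=> [i m] la st; apply: ev_K.
- move=> la la' st st' h; apply: (eigen_inj hq u0 lpos_inj psc_neq0 st st') => i m.
  exact: (h (i, m)).
- by move=> [i m] v Wv; apply: Wev.
- by move=> la b; rewrite expr0z mul1r weightE_neq0.
- by move=> la b; rewrite expr0z mul1r weightF_neq0.
- by move=> i la; apply: Emode_convex.
- by move=> i la; apply: Fmode_concave.
- by move=> la i; rewrite filter_uniq ?boxrange_uniq.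
- by move=> la i; rewrite filter_uniq ?boxrange_uniq.
- by move=> la i b; apply: mem_convexlist.
- by move=> la i b; apply: mem_concavelist.
- by move=> i v /(Wev (fE R i 0)); rewrite ev_E.
- by move=> i v /(Wev (fF R i 0)); rewrite ev_F.
Qed.

Lemma tmod_irreducible : irreducible_module tmod.
Proof.
split; first by exists (vec fset0); apply/vec_neq0/stable0.
move=> W [W0 WD WZ WM].
have [[v [Wv v0]]|n] := pselect (exists v, W v /\ v <> 0).
  right; apply/seteqP; split=> // w _; exact: (tmod_simple W0 WD WZ WM Wv v0).
left; apply/seteqP; split=> w /=; last by move=> ->.
by move=> Ww; apply: contrapT => nw; apply: n; exists w.
Qed.

Lemma tmod_generated : highest_lweight_module tmod (phiweight fset0).
Proof.
exists (vec fset0); split; [exact/tmod_K/stable0 | exact: tmod_highest |].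
apply: (tmod_simple (v0 := vec fset0)).
- by exists 0; have := actZl tmod 0 0 (vec fset0); rewrite !scale0r.
- by move=> v w [x ->] [y ->]; exists (x + y); rewrite (actDl tmod).
- by move=> c v [x ->]; exists (c *: x); rewrite (actZl tmod).
- by move=> y v [x ->]; exists (y * x); rewrite (actM tmod).
- by exists 1; rewrite (act1 tmod).
- by apply/eqP/vec_neq0/stable0.
Qed.

Lemma vec_coord la : stable (mem la) -> exists f : {linear V -> V},
  forall la', stable (mem la') -> f (vec la') = if la' == la then vec la else 0.
Proof.
by move=> st; exists (lin (fun la' => if la' == la then vec la else 0)) => la'; apply: lin_vec.
Qed.

Lemma vec_inj la la' : stable (mem la) -> stable (mem la') -> vec la = vec la' -> la = la'.
Proof.
move=> st st' e; have [f fE] := vec_coord st'.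
apply/eqP; have := congr1 f e; rewrite !fE // eqxx; case: eqP => // _ /esym/eqP.
by rewrite (negbTE (vec_neq0 st')).
Qed.

Lemma tmod_tame : tame_module tmod.
Proof.
exists [set v | exists2 la, stable (mem la) & v = vec la]%classic; split.
- split.
    move=> s c us hs e0 v vs; have [la st ev] := hs v vs.
    have [f fE] := vec_coord st.
    have := congr1 f e0; rewrite linear_sum linear0 (bigD1_seq v) //= big_seq_cond big1.
      rewrite addr0 linearZ /= ev fE // eqxx => /eqP; rewrite scaler_eq0.
      by rewrite (negbTE (vec_neq0 st)) orbF => /eqP.
    move=> w /andP[ws nwv]; have [la' st' ew] := hs w ws.
    rewrite linearZ /= ew fE // ifN ?scaler0 //; apply: contraNneq nwv => ell.
    by rewrite ew ell ev.
  move=> w; have [s [c [us st ->]]] := vec_span w.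
  exists (map vec s), (fun v => \sum_(la <- s | vec la == v) c la).
  split=> [v /mapP[la las ->]|]; first by exists la; [exact: st|].
  rewrite big_map; apply: eq_big_seq => la las; congr (_ *: _).
  rewrite big_mkcond (bigD1_seq la) //= eqxx big_seq_cond big1 ?addr0 //.
  move=> la' /andP[l's nl]; case: eqP => // e; case/negP: nl; apply/eqP.
  exact: (vec_inj (st _ l's) (st _ las) e).
- by move=> v [la st ->]; exists (phiweight la); apply: tmod_K.
move=> v w phi [la st ->] [la' st' ->] h h'; congr vec.
have key la1 : stable (mem la1) -> has_lweight tmod phi (vec la1) ->
    forall i, expansion_infty (phi i) (eigen true la1 i).
  move=> st1 h1 i; have [[s ex hs] _] := h1 i.
  suff es : s =1 eigen true la1 i by rewrite -(funext es).
  move=> m; have := etrans (esym (hs m)) (etrans (tmodE _ _)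
    (ev_K true i m st1)).
  move/eqP; rewrite -subr_eq0 -scalerBl scaler_eq0 (negbTE (vec_neq0 st1)) orbF.
  by rewrite subr_eq0 => /eqP.
apply: (eigen_inj hq u0 lpos_inj psc_neq0 st st') => i.
exact: (@expansion_uniq _ true (phi i) _ _ (key _ st h i) (key _ st' h' i)).
Qed.

Lemma tmod_level : has_level tmod (psc 0 * psc 1).
Proof.
move=> v; refine (etrans (tmodE _ _) _); have [s [c [_ st ->]]] := vec_span v.
rewrite linear_sum scaler_sumr; apply: eq_big_seq => la /st stl.
rewrite linearZ /= [RHS]scalerA [_ * c la]mulrC -[RHS]scalerA; congr (_ *: _).
have dK i : ev (fK R i) (vec la) = eigen true la i 0 *: vec la.
  by refine (etrans (feval_gen _ _ _) _); rewrite /= diag_vec.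
have lZ (y : free_alg C toroidal_gen) (a : C) w : ev y (a *: w) = a *: ev y w.
  by rewrite linearZ.
refine (etrans (fevalM _ _ _ _) _); refine (etrans (congr1 _ (dK 1)) _).
refine (etrans (lZ _ _ _) _); refine (etrans (congr1 _ (dK 0)) _).
rewrite scalerA; congr (_ *: _).
have e0 i : eigen true la i 0 = fscal (phifact la i).
  by have [] := eigen0 hq lpos_inj u0 psc_neq0 psc_balanced i stl.
rewrite !e0 !phifact_scal mulrACA [psc 1 * _]mulrC -big_split big1 ?mulr1 // => b _ /=.
have n1 := q1_neq0 hq; have n2 := q2_neq0 hq; have n3 := q3_neq0 hq.
have e2 : (q1 * q3)^-1 = q2 := inv_outer hq.
rewrite e2; have [->|->] := Z2_case (G0_color b).
  by rewrite eqxx mulfV.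
by rewrite eqxx mulVf.
Qed.

Lemma tmod_T v : tmod (tpi logq logd (fT R)) v = v.
Proof.
refine (etrans (tmodE _ _) _); refine (etrans (feval_gen _ _ _) _).
exact: lin_id.
Qed.

End Representation.

(** * The parameters *)

Section Exponentials.
Variable R : realType.
Local Notation C := R[i].
Implicit Types x y : C.

Lemma cexpD x y : cexp (x + y) = cexp x * cexp y.
Proof.
case: x y => [a b] [a' b']; apply/eqP; rewrite eq_complex /= expRD cosD sinD.
by apply/andP; split; apply/eqP; ring.
Qed.

Lemma cexp0 : cexp 0 = 1 :> C.
Proof. by rewrite /cexp /= expR0 cos0 sin0 mulr0 mulr1. Qed.

Lemma cexp_neq0 x : cexp x != 0.
Proof.
have e : cexp x * cexp (- x) = 1 by rewrite -cexpD subrr cexp0.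
by apply: contra_eq_neq e => ->; rewrite mul0r eq_sym oner_neq0.
Qed.

Lemma cexpN x : cexp (- x) = (cexp x)^-1.
Proof.
apply: (mulfI (cexp_neq0 x)); rewrite -cexpD subrr cexp0 divff //.
exact: cexp_neq0.
Qed.

Lemma cexp_int (n : int) x : cexp (n%:~R * x) = cexp x ^ n.
Proof.
have H (m : nat) : cexp (m%:R * x) = cexp x ^+ m.
  elim: m => [|m ih]; first by rewrite mul0r cexp0.
  by rewrite -natr1 mulrDl mul1r cexpD ih exprSr.
case: n => m; first by rewrite -pmulrn H.
by rewrite NegzE mulrNz mulNr cexpN -pmulrn H -exprnN.
Qed.

Section Generic.
Variables logq logd mu : C.
Hypothesis hgen : generic logq logd.
Local Notation q := (q logq).
Local Notation d := (d logd).
Local Notation q1 := (q1 logq logd).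
Local Notation q2 := (q2 logq).
Local Notation q3 := (q3 logq logd).

Lemma q1q2q3 : q1 * q2 * q3 = 1.
Proof.
have n1 : q != 0 := cexp_neq0 logq; have n2 : d != 0 := cexp_neq0 logd.
by rewrite /Defs.q1 /Defs.q2 /Defs.q3; field; rewrite n1 n2.
Qed.

Lemma q1E : q1 = cexp (logd - logq).
Proof. by rewrite cexpD cexpN mulrC. Qed.
Lemma q2E : q2 = cexp (2 * logq).
Proof. by rewrite mulrDl mul1r cexpD. Qed.
Lemma q3expE : q3 = cexp (- logq - logd).
Proof. by rewrite cexpD !cexpN. Qed.

Lemma q1_q2_free (a b : int) : q1 ^ a * q2 ^ b = 1 -> a = 0 /\ b = 0.
Proof.
move=> e; have : qpow logq (ratr (2 * b - a)%:~R) * dpow logd (ratr a%:~R) = 1.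
  rewrite -e q1E q2E -!cexp_int /qpow /dpow -!cexpD !ratr_int; congr cexp.
  by rewrite rmorphB rmorphM /=; ring.
move/hgen => [/eqP e1 /eqP e2]; rewrite !intr_eq0 in e1 e2.
by move/eqP: e1 e2 => e1 /eqP e2; split; lia.
Qed.

Lemma q_inv_neq : q - q^-1 != 0.
Proof.
have n1 : q != 0 := cexp_neq0 logq.
apply/eqP => /eqP; rewrite subr_eq0 => /eqP e.
have : q1 ^ 0 * q2 ^ 1 = 1 by rewrite expr0z mul1r expr1z /Defs.q2 expr2 {2}e divff.
by move/q1_q2_free => [].
Qed.

Local Notation u := (q2pow logq (- mu)).

Lemma u_neq0 : u != 0. Proof. exact: cexp_neq0. Qed.

Hypothesis hconv : position_color_convention logq logd (G0 logq logd mu).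
Hypothesis hres : forall a b : int, q2pow logq mu <> q1 ^ (2 * a) * q2 ^ b.

Local Notation lpos := (lpos q1 q2 q3 u).
Local Notation bpos := (bpos q1 q2 q3 u).

Lemma box_posE b : box_pos logq logd (D := G0 logq logd mu) b = bpos b.
Proof.
have n1 := q1_neq0 q1q2q3; have n2 := q2_neq0 q1q2q3; have n3 := q3_neq0 q1q2q3.
have e1 (n : nat) : q1pow logq logd (- n%:R) = q1 ^ (- n%:Z).
  by rewrite q1E -cexp_int mulrNz -pmulrn.
have e2 (n : nat) : q2pow logq (- n%:R) = q2 ^ (- n%:Z).
  by rewrite q2E -cexp_int mulrNz -pmulrn.
have e3 (n : nat) : q3pow logq logd (- n%:R) = q3 ^ (- n%:Z).
  by rewrite q3expE -cexp_int mulrNz -pmulrn.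
case: b => [[] [k x]]; rewrite /box_pos /bpos /lpos /=.
  by rewrite e1 e2 (e3 1%N) -exprN1; ring.
rewrite e1 (e3 0%N) expr0z mulr1 opprD /q2pow mulrDl cexpD -/(q2pow logq _) -/(q2pow logq _).
by rewrite e2; ring.
Qed.

(** A box of each family at the same position: their colours differ exactly
    when the exponent m of q1 is odd. *)
Lemma u_resonance (m n : int) : u <> q1 ^ m * q2 ^ n.
Proof.
have n1 := q1_neq0 q1q2q3; have n2 := q2_neq0 q1q2q3; have n3 := q3_neq0 q1q2q3.
have split_int (m' : int) : exists a b : nat, m' = 1 - a%:Z + b%:Z.
  case em : (m' - 1) => [p|p]; first by exists 0%N, p; lia.
  by exists p.+1, 0%N; lia.
move=> e; have [a [b ma]] := split_int m; have [k [k' nk]] := split_int n.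
have [oab|oab] := eqVneq (odd a) (odd b).
  have /hconv : box_pos logq logd (D := G0 logq logd mu) (true, (k, a)) =
      box_pos logq logd (D := G0 logq logd mu) (false, (k', b)).
    rewrite !box_posE /bpos /lpos /= e (q3VE q1q2q3) ma nk.
    rewrite !expfzDr // !expr1z -!exprnN -!exprnP; field.
    by rewrite (expf_neq0 k' n2) (expf_neq0 b n1) (expf_neq0 k n2) (expf_neq0 a n1).
  have natZ2 (p : nat) : p%:R = (odd p)%:R :> 'Z_2.
    exact: (Z2_intr p).
  by rewrite /= natZ2 [b%:R]natZ2 oab; case: (odd b).
have [c mc] : exists c : int, m = 2 * c.
  have ha := odd_double_half a; have hb := odd_double_half b.
  exists (if odd a then (b./2)%:Z - (a./2)%:Z else 1 + (b./2)%:Z - (a./2)%:Z).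
  by move: oab ha hb; case: (odd a); case: (odd b) => //= _; lia.
apply: (hres (a := - c) (b := - n)).
have -> : q2pow logq mu = u^-1 by rewrite -cexpN /q2pow mulNr opprK.
by rewrite e invfM !invr_expz mc mulrN.
Qed.

Lemma lpos_injective : injective lpos.
Proof.
have n1 := q1_neq0 q1q2q3; have n2 := q2_neq0 q1q2q3; have n3 := q3_neq0 q1q2q3.
have free (a b a' b' : int) : q1 ^ a * q2 ^ b = q1 ^ a' * q2 ^ b' -> a = a' /\ b = b'.
  move=> e; have /q1_q2_free[] : q1 ^ (a - a') * q2 ^ (b - b') = 1.
    rewrite !expfzDr // mulrACA e -mulrACA -!expfzDr //.
    by rewrite !subrr !expr0z mulr1.
  by split; lia.
have cross (a b a' b' : int) : u * q1 ^ a * q2 ^ b <> q3^-1 * q1 ^ a' * q2 ^ b'.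
  rewrite (q3VE q1q2q3) => e; apply: (@u_resonance (1 + a' - a) (1 + b' - b)).
  rewrite !expfzDr // !expr1z -!invr_expz.
  have na : q1 ^ a != 0 by rewrite expfz_neq0.
  have nb : q2 ^ b != 0 by rewrite expfz_neq0.
  have -> : q1 * q1 ^ a' * (q1 ^ a)^-1 * (q2 * q2 ^ b' * (q2 ^ b)^-1) =
     (q1 * q2 * q1 ^ a' * q2 ^ b') / (q1 ^ a * q2 ^ b) by field; rewrite na nb.
  by rewrite -e -[u * _ * _]mulrA mulfK // mulf_neq0.
move=> [z [y x]] [z' [y' x']]; rewrite /lpos /=; case: z; case: z' => //.
- rewrite -!mulrA => /(mulfI (invr_neq0 n3)) /free[e1 e2].
  by congr (_, (_, _)); lia.
- by move/esym/cross.
- by move/cross.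
- rewrite -!mulrA => /(mulfI u_neq0) /free[e1 e2].
  by congr (_, (_, _)); lia.
Qed.

End Generic.
End Exponentials.

(** * The l-weights of the construction *)

Section WeightFunctions.
Variable C : fieldType.
Implicit Types a b c : C.

Lemma A_same_val c a : c != 0 ->
  ((c *: 'X - a%:P)%:F / ('X - (c * a)%:P)%:F)^-1 =
  fval (Factored c^-1 [:: c * a] [:: c^-1 * a]).
Proof.
move=> c0; rewrite invf_div /fval /polyroots /= !big_seq1 -tofracM.
have e : c *: 'X - a%:P = c%:P * ('X - (c^-1 * a)%:P).
  by rewrite mulrBr -polyCM mulVKf // mul_polyC.
have nX (x : C) : 'X - x%:P != 0 by rewrite polyXsubC_eq0.
apply: frac_eq; rewrite ?nX //; first by rewrite e mulf_neq0 ?polyC_eq0.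
by rewrite e [RHS]mulrACA -polyCM mulVf // mul1r.
Qed.

Lemma A_diff_val c c' a : c != 0 -> c' != 0 ->
  (((c *: 'X - a%:P) * (c' *: 'X - a%:P))%:F
   / (('X - (c * a)%:P) * ('X - (c' * a)%:P))%:F)^-1 =
  fval (Factored (c * c')^-1 [:: c * a; c' * a] [:: c^-1 * a; c'^-1 * a]).
Proof.
move=> c0 c'0; have -> : Factored (c * c')^-1 [:: c * a; c' * a] [:: c^-1 * a; c'^-1 * a] =
    fmul (Factored c^-1 [:: c * a] [:: c^-1 * a]) (Factored c'^-1 [:: c' * a] [:: c'^-1 * a]).
  by rewrite /fmul /= invfM.
rewrite fvalM -!A_same_val // -invfM !tofracM; congr (_^-1).
by rewrite mulf_div.
Qed.

Lemma Psi_val c a b :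
  c%:P%:F * (('X - a%:P)%:F / ('X - b%:P)%:F) = fval (Factored c [:: a] [:: b]).
Proof. by rewrite /fval /polyroots /= !big_seq1 mulrA. Qed.

Lemma Psi_balanced c a b : c != 0 -> a != 0 -> b != 0 -> c * (c * a / b) = 1 ->
  balanced (c%:P%:F * (('X - a%:P)%:F / ('X - b%:P)%:F)).
Proof.
move=> c0 a0 b0 h; exists (c * a / b), c; split; last by rewrite mulrC.
  rewrite Psi_val; have <- : flead (Factored c [:: a] [:: b]) 0 = c * a / b.
    rewrite /flead /diffprod /= !big_cons !big_nil a0 b0 !mulr1 !sub0r mulrN invrN mulrNN //.
  by apply: fval_value; rewrite /ford /= (negbTE a0) (negbTE b0).
exists (c *: ('X - a%:P)), ('X - b%:P); split.
- by rewrite polyXsubC_eq0.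
- by rewrite size_XsubC (leq_trans (size_scale_leq _ _)) ?size_XsubC.
- by rewrite -mul_polyC tofracM mulrA.
- rewrite size_XsubC /= coefZ coefB coefX coefC subr0 mulr1.
  by rewrite lead_coefXsubC divr1.
Qed.

End WeightFunctions.

Section Data.
Variables (R : realType) (logq logd mu : R[i]).
Hypothesis hgen : generic logq logd.
Hypothesis hconv : position_color_convention logq logd (G0 logq logd mu).
Hypothesis hres : forall a b : int,
  q2pow logq mu <> q1 logq logd ^ (2 * a) * q2 logq ^ b.
Local Notation C := R[i].
Local Notation q := (q logq).
Local Notation q1 := (q1 logq logd).
Local Notation q2 := (q2 logq).
Local Notation q3 := (q3 logq logd).
Local Notation u := (q2pow logq (- mu)).
Local Notation D := (G0 logq logd mu).
Local Notation hq := (q1q2q3 logq logd).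
Local Notation linj := (lpos_injective hgen hconv hres).

(** The values of Psi at infinity; their product is the level. *)
Definition psc (i : 'Z_2) : C := if i == 0 then q3 * qpow logq (- mu) else qpow logq mu.

Lemma psc_neq0 i : psc i != 0.
Proof.
rewrite /psc; case: ifP => _; last exact: cexp_neq0.
by rewrite mulf_neq0 ?(q3_neq0 hq) ?cexp_neq0.
Qed.

Lemma uE : u = qpow logq (- mu) * qpow logq (- mu).
Proof. by rewrite /qpow -cexpD /q2pow; congr cexp; ring. Qed.

Lemma psc_balanced i : psc i * (psc i *
  lpos q1 q2 q3 u (i == 0, (-1, -1)) / lpos q1 q2 q3 u (i != 0, (0, 0))) = 1.
Proof.
have n1 := q1_neq0 hq; have n2 := q2_neq0 hq; have n3 := q3_neq0 hq.
have nq : qpow logq (- mu) != 0 := cexp_neq0 _.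
have e12 w : w * q1 * q2 = w / q3 by rewrite -(mulrA w q1 q2) -(q3VE hq).
rewrite /psc /lpos /= !opprK oppr0 !expr0z !expr1z !mulr1 e12.
have [_|_] := eqVneq i 0 => /=.
  by rewrite uE; field; rewrite n3 nq.
have -> : qpow logq mu = (qpow logq (- mu))^-1 by rewrite -cexpN mulNr opprK.
by rewrite uE; field; rewrite n3 nq.
Qed.

Lemma Psi_root0 : lpos q1 q2 q3 u (true, (-1, -1)) = q3 ^- 2.
Proof.
rewrite /lpos /= !opprK !expr1z -(mulrA _ q1 q2) -(q3VE hq).
by rewrite -(exprVn q3 2) (expr2 q3^-1).
Qed.

Lemma Psi_root1 : lpos q1 q2 q3 u (false, (-1, -1)) = q3^-1 * u.
Proof.
by rewrite /lpos /= !opprK !expr1z -(mulrA _ q1 q2) -(q3VE hq) mulrC.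
Qed.

Lemma Psi_pole z : lpos q1 q2 q3 u (z, (0, 0)) = if z then q3^-1 else u.
Proof. by rewrite /lpos /= !oppr0 !expr0z !mulr1. Qed.

Lemma PsiE i : Psi D i = fval (Psifact q1 q2 q3 u psc i).
Proof.
rewrite /Psifact /psc /Psizeros /Psipoles /= /G0_Psi Psi_pole.
by have [_|_] /= := eqVneq i 0; rewrite ?Psi_root0 ?Psi_root1; apply: Psi_val.
Qed.

Lemma Psi_is_balanced i : balanced (Psi D i).
Proof.
have n3 := q3_neq0 hq; have := psc_balanced i; have := psc_neq0 i.
rewrite /psc /= /G0_Psi Psi_pole.
have [_|_] /= := eqVneq i 0; rewrite ?Psi_root0 ?Psi_root1 => c0 e.
  refine (Psi_balanced c0 _ _ e); last exact: u_neq0.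
  by rewrite invr_neq0 ?expf_neq0.
refine (Psi_balanced c0 _ _ e); last by rewrite invr_neq0.
by apply: mulf_neq0; rewrite ?invr_neq0 ?u_neq0.
Qed.

Lemma A_boxE b i : (A_box logq logd (D := D) b i)^-1 = fval (Afact q1 q2 q3 u b i).
Proof.
have n1 := q1_neq0 hq; have n2 := q2_neq0 hq; have n3 := q3_neq0 hq.
rewrite /A_box /A_weight box_posE -/(G0_color b).
have [->|n] := eqVneq i (G0_color b).
  by rewrite ?eqxx (Afact_same _ hq); apply: A_same_val.
by rewrite ?(negbTE n) (Afact_diff _ hq n); apply: A_diff_val.
Qed.

Lemma phiE la i : phi logq logd (D := D) la i = fval (phifact q1 q2 q3 u psc la i).
Proof.
rewrite /phifact fvalM fprod_val /phi PsiE; congr (_ * _).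
by apply: eq_bigr => b _; apply: A_boxE.
Qed.

Lemma phi_ltE la b i : phi_lt logq logd (D := D) la b i =
  fval (phifact q1 q2 q3 u psc [seq x <- la | (x < b)%O] i).
Proof.
rewrite /phifact fvalM fprod_val /phi_lt PsiE big_filter; congr (_ * _).
by apply: eq_bigr => x _; apply: A_boxE.
Qed.

Lemma phi_gtE la b i : phi_gt logq logd (D := D) la b i =
  fval (fprod (fun x => Afact q1 q2 q3 u x i) [seq x <- la | (b < x)%O]).
Proof.
by rewrite fprod_val /phi_gt big_filter; apply: eq_bigr => x _; apply: A_boxE.
Qed.

End Data.

(** * The module and its properties *)

Section FockModule.
Variables (R : realType) (logq logd mu : R[i]).
Hypothesis hgen : generic logq logd.
Hypothesis hconv : position_color_convention logq logd (G0 logq logd mu).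
Hypothesis hres : forall a b : int,
  q2pow logq mu <> q1 logq logd ^ (2 * a) * q2 logq ^ b.
Local Notation C := R[i].
Local Notation q := (q logq).
Local Notation q1 := (q1 logq logd).
Local Notation q2 := (q2 logq).
Local Notation q3 := (q3 logq logd).
Local Notation u := (q2pow logq (- mu)).
Local Notation D := (G0 logq logd mu).
Local Notation hq := (q1q2q3 logq logd).
Local Notation linj := (lpos_injective hgen hconv hres).
Local Notation psc := (psc logq logd mu).
Local Notation kap := (q - q^-1)^-1.
Local Notation gamE := (gamE q1 q2 q3 u psc kap).
Local Notation gamF := (@gamF C).
Local Notation ME := (ME q1 q2 q3 u).
Local Notation MF := (MF q1 q2 q3 u).

(** The boxes above b contribute order 0 at b in total, and those below b are not
    seen, so the value is a leading coefficient. *)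
Lemma F_value (la : {fset G0_box}) b : stable (mem la) -> b \notin la ->
  stable (mem (b |` la)%fset) ->
  is_value (phi_gt logq logd (D := D) la b (G0_color b))
    (box_pos logq logd (D := D) b) (weight gamF MF (b |` la)%fset b).
Proof.
move=> st nb st'; rewrite phi_gtE box_posE weightF_lead //; apply: fval_value.
have cb : concave (mem la) b.
  by apply/concaveP => //; apply: eq_stable st' => x; rewrite /= !inE.
rewrite fprod_ord big_filter; refine (etrans _ (above_order0 st (fset_uniq _) cb)).
by apply: eq_bigr => x _; apply: (Afact_ord linj).
Qed.

(** The boxes below b form a state to which b can be added, so the pole at b is
    simple. *)
Lemma E_residue (la : {fset G0_box}) b : stable (mem la) -> b \in la ->
  is_residue (phi_lt logq logd (D := D) la b (G0_color b) / 'X%:F)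
    (box_pos logq logd (D := D) b) ((q - q^-1) * weight gamE ME la b).
Proof.
move=> st bla; rewrite phi_ltE box_posE weightE_lead //.
rewrite (mulVKf (q_inv_neq hgen)); apply: fval_residue.
  exact: (bpos_neq0 hq (u_neq0 logq mu)).
by rewrite (phifact_ord linj) (phiorder_below st (fset_uniq _)) //; left.
Qed.

Lemma space_span (v : space C) :
  exists (s : seq {fset G0_box}) (c : {fset G0_box} -> C),
  [/\ uniq s, forall la, la \in s -> stable (mem la) & v = \sum_(la <- s) c la *: vec C la].
Proof.
exists (map val (msupp v : seq _)), (fun la => if insub la is Some l then v@_l else 0).
split.
- by rewrite map_inj_uniq ?fset_uniq //; apply: val_inj.
- by move=> la /mapP[l _ ->]; apply: val_stable.
- rewrite big_map {1}[v]vec_expand; apply: eq_bigr => l _; rewrite valK //.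
Qed.

Lemma vec_neq0 (la : {fset G0_box}) : stable (mem la) -> vec C la != 0.
Proof.
case/(vec_in C) => l _ ->; apply/eqP => /(congr1 (mcoeff l)).
by rewrite mcoeffUU mcoeff0 => /eqP; rewrite oner_eq0.
Qed.

Definition G0_module : toroidal_module logq logd (space C) :=
  tmod hq (q_inv_neq hgen) (u_neq0 logq mu) linj (@psc_neq0 _ logq logd mu)
    (@psc_balanced _ logq logd mu) (@lin_vec C) (@vec_out C) (@linear_ext C).

Lemma G0_action : @is_comb_action R logq logd D G0_module.
Proof.
have stP (la : {fset G0_box}) : G0_states la -> stable (mem la) by move/G0_statesP.
split.
- by apply/G0_statesP; apply: stable0.
- exact: Psi_is_balanced.
- move=> v; exact: tmod_T.
- move=> la /stP st i.
  rewrite (phiE (la : {fset G0_box}) i).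
  exact: (tmod_K hq (q_inv_neq hgen) (u_neq0 logq mu) linj (@psc_neq0 _ logq logd mu)
    (@psc_balanced _ logq logd mu) (@lin_vec C) (@vec_out C) (@linear_ext C) st i).
- exists (fun i la b => weight gamF MF (b |` la)%fset b); split.
    by move=> i la b /stP st [<- nb /stP st']; apply: F_value.
  move=> i la k /stP st.
  refine (etrans (tmod_F hq (q_inv_neq hgen) (u_neq0 logq mu) linj (@psc_neq0 _ logq logd mu)
    (@psc_balanced _ logq logd mu) (@lin_vec C) (@vec_out C) (@linear_ext C) i k st) _).
  by apply: eq_fsbigr => b _; rewrite box_posE.
- exists (fun i la b => (q - q^-1) * weight gamE ME la b); split.
    by move=> i la b /stP st [<- bla _]; apply: E_residue.
  move=> i la k /stP st.
  refine (etrans (tmod_E hq (q_inv_neq hgen) (u_neq0 logq mu) linj (@psc_neq0 _ logq logd mu)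
    (@psc_balanced _ logq logd mu) (@lin_vec C) (@vec_out C) (@linear_ext C) i k st) _).
  apply: eq_fsbigr => b _; rewrite box_posE.
  by rewrite (mulKf (q_inv_neq hgen)).
Qed.

Lemma psc_level : psc 0 * psc 1 = q3.
Proof.
rewrite /psc /= -mulrA /qpow -cexpD mulNr addNr cexp0.
exact: mulr1.
Qed.

Lemma G0_highest : highest_lweight_module G0_module (G0_Psi logq logd mu).
Proof.
have := tmod_generated hq (q_inv_neq hgen) (u_neq0 logq mu) linj (@psc_neq0 _ logq logd mu)
  (@psc_balanced _ logq logd mu) (@lin_vec C) (@vec_out C) (@linear_ext C) vec_neq0 space_span.
congr (highest_lweight_module _ _); apply/funext => i.
refine (etrans (esym (@phiE R logq logd mu fset0 i)) _).
by rewrite /phi big_seq_fset0 mulr1.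
Qed.

End FockModule.

Theorem proposition4p5 (R : realType) (logq logd mu : R[i])
  (hgen : generic logq logd)
  (hmu : ~ is_integer mu)
  (hconv : position_color_convention logq logd (G0 logq logd mu))
  (hres : forall a b : int,
      q2pow logq mu <> q1 logq logd ^ (2 * a) * q2 logq ^ b) :
  exists M : toroidal_module logq logd (comb_space (G0 logq logd mu)),
    [/\ is_comb_action M,
        irreducible_module M,
        tame_module M,
        highest_lweight_module M (G0_Psi logq logd mu)
      & has_level M (q3 logq logd)].
Proof.
exists (G0_module hgen hconv hres); split.
- exact: G0_action.
- exact: (tmod_irreducible _ _ _ _ _ _ _ _ _ (@vec_neq0 R) (@space_span R)).
- exact: (tmod_tame _ _ _ _ _ _ _ _ _ (@vec_neq0 R) (@space_span R)).
- exact: G0_highest.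
- rewrite -(psc_level logq logd mu).
  exact: (tmod_level _ _ _ _ _ _ _ _ _ (@space_span R)).
Qed.
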